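(* Let $M=\{M_i\}_{i=1,\dots,m}$ be a family of real analytic totally real $n$-submanifolds of $(\mathbb C^n,0)$ passing through the origin, with pairwise distinct tangent spaces at $0$, $M_i$ being the fixed point set of the anti-holomorphic involution $\rho_i(z)=B_i\bar z+R_i(\bar z)$. Let $G$ be the group generated by $F_{i,j}=\rho_i\circ\rho_j$, $1\le i,j\le m$, let $D_{i,j}=B_i\bar B_j$ be the linear part of $F_{i,j}$ at $0$, and assume that all $D_{i,j}=\mathrm{diag}(\mu_{i,j,1},\dots,\mu_{i,j,n})$ are diagonal. Assume that $G$ is abelian. Let $\mathcal I\subset\mathcal O_n$ be a monomial ideal left invariant by the family $D=\{D_{i,j}\}$ and by the involutions $z\mapsto B_i\bar z$. Assume that either $D$ is diophantine, or $\mathcal I$ is properly embedded and $D$ is diophantine on $\mathcal I$. Assume that $M$ is non-resonant on $\mathcal I$ and that $G$ is formally linearizable on $\mathcal I$. Then the family $F=\{F_{i,j}\}$ is holomorphically linearizable on $\mathcal I$ and, moreover, in these coordinates the $\rho_i$'s are linear and anti-holomorphic on $\bar{\mathcal I}$; that is, there is a germ of holomorphic diffeomorphism $\Phi$ of $(\mathbb C^n,0)$, tangent to the identity at $0$, such that for all $1\le i,j\le m$ $$\Phi^{-1}\circ F_{i,j}\circ\Phi(z)-D_{i,j}z\in\mathcal I^n,\qquad \Phi^{-1}\circ\rho_i\circ\Phi(z)= B_i\bar z \mod \bar{\mathcal I}.$$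
   Context: Each $R_i$ is a germ of holomorphic map at $0$ with $R_i(0)=0$, $DR_i(0)=0$; $B_i$ is an invertible matrix with $B_i\bar B_i=\mathrm{Id}$; and $\rho_i\circ\rho_i=\mathrm{Id}$. The tangent space of $M_i$ at $0$ is $\{z=B_i\bar z\}$. $\mathcal O_n$ is the ring of germs of holomorphic functions at $0\in\mathbb C^n$, $\widehat{\mathcal O}_n$ the ring of formal power series, $\widehat{\mathcal M}_n$ its maximal ideal. A monomial ideal $\mathcal I$ is one generated by monomials $x^{R_1},\dots,x^{R_p}$; $\hat{\mathcal I}$ is the ideal it generates in $\widehat{\mathcal O}_n$, and $\bar{\mathcal I}$ is the ideal of power series in $\bar x_1,\dots,\bar x_n$ generated by $\bar x^{R_1},\dots,\bar x^{R_p}$. ''mod $\bar{\mathcal I}$'' for maps is understood componentwise. $\mathcal I$ is left invariant by $D_{i,j}$ if $f\circ D_{i,j}\in\mathcal I$ for all $f\in\mathcal I$, and by $z\mapsto B_i\bar z$ if $f(B_i\bar z)\in\bar{\mathcal I}$ for all $f\in\mathcal I$. $\mathcal I$ is properly embedded if it has a set of monomial generators not involving all the variables (the zero ideal is regarded as properly embedded). For $Q\in\mathbb N^n$: $|Q|=q_1+\dots+q_n$, $\mu_{i,j}^Q=\mu_{i,j,1}^{q_1}\cdots\mu_{i,j,n}^{q_n}$, and $\bar\mu_{i,j}^Q$ is its complex conjugate. For $k\ge1$, $\omega_k(D,\mathcal I)=\inf\{\max_{1\le i,j\le m}|\mu_{i,j}^Q-\mu_{i,j,s}|\ne0\mid 2\le|Q|\le2^k,\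 1\le s\le n,\ Q\in\mathbb N^n,\ x^Q\notin\mathcal I\}$, and $\omega_k(D)$ is defined in the same way without the condition $x^Q\notin\mathcal I$. $D$ is diophantine (resp. diophantine on $\mathcal I$) if $-\sum_{k\ge1}\frac{\ln\omega_k(D)}{2^k}<+\infty$ (resp. $-\sum_{k\ge1}\frac{\ln\omega_k(D,\mathcal I)}{2^k}<+\infty$). $M$ is non-resonant on $\mathcal I$ if for every monomial $z^Q\notin\mathcal I$ with $|Q|\ge2$ and all couples $(i,k)$, $1\le i\le m$, $1\le k\le n$, there exists $1\le j\le m$ such that $\bar\mu_{i,j}^Q\ne\mu_{i,j,k}^{-1}$. $\mathcal C_D=\{H\in(\widehat{\mathcal M}_n^2)^n\mid H(D_{i,j}x)=D_{i,j}H(x)\ \text{for all } i,j\}$. ''Zero projection on $\mathcal C_D$'' means that no monomial $x^Qe_s$ ($e_s$ the $s$-th basis vector) lying in $\mathcal C_D$ occurs with nonzero coefficient. $G$ is formally linearizable on $\mathcal I$ if there is a formal diffeomorphism $\hat\Phi$ of $(\mathbb C^n,0)$, tangent to the identity at $0$, with zero projection on $\mathcal C_D$, such that $\hat\Phi^{-1}\circ F_{i,j}\circ\hat\Phi-D_{i,j}x\in(\hat{\mathcal I})^n$ for all $i,j$. *)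

(* Defs.v *)
From HB Require Import structures.
From mathcomp Require Import all_boot all_order all_algebra complex.
From mathcomp Require Import all_classical all_reals all_analysis.
Import Order.TTheory GRing.Theory Num.Theory.
Import numFieldNormedType.Exports.

Set Implicit Arguments.
Unset Strict Implicit.
Unset Printing Implicit Defensive.

Local Open Scope classical_set_scope.
Local Open Scope ring_scope.

(* The complex numbers R[i].  Giving the structure as a numClosedFieldType is
   what lets the topology of a numFieldType be inferred on Cplx R and on
   'cV[Cplx R]_n (the topology of R[i] bare is not found). *)
Definition Cplx (R : realType) : numClosedFieldType := (R[i])%C.

Definition cmod (R : realType) (x : Cplx R) : R := complex.Re `|x|.

Definition cplx_of_real (R : realType) (x : R) : Cplx R := (x%:C)%C.

Definition mxconj (R : realType) (p q : nat) (A : 'M[Cplx R]_(p, q)) :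
  'M[Cplx R]_(p, q) := map_mx Num.conj A.

Notation midx n := {ffun 'I_n -> nat}.

Definition mlen (n : nat) (Q : midx n) : nat := (\sum_i Q i)%N.

Definition midx_of_box (n N : nat) (Q : {ffun 'I_n -> 'I_N}) : midx n :=
  [ffun i => Q i : nat].

Definition midx_unit (n : nat) (j : 'I_n) : midx n :=
  [ffun k => (k == j) : nat].

Definition monom (R : realType) (n : nat) (Q : midx n) (z : 'cV[Cplx R]_n) :
  Cplx R := \prod_i z i 0 ^+ Q i.

Definition fps (R : realType) (n : nat) : Type := midx n -> Cplx R.

Definition smonom (R : realType) (n : nat) (Q : midx n) : fps R n :=
  fun P => (P == Q)%:R.

Definition smul (R : realType) (n : nat) (f g : fps R n) : fps R n :=
  fun Q => \sum_(P : {ffun 'I_n -> 'I_(mlen Q).+1} | [forall i, P i <= Q i]%N)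
    f (midx_of_box P) * g [ffun i => Q i - P i]%N.

Definition spow (R : realType) (n : nat) (G : 'I_n -> fps R n)
    (Q : midx n) : fps R n :=
  \big[@smul R n/smonom R 0]_(i < n) iter (Q i) (smul (G i)) (smonom R 0).

(* The substitution f \o G, meaningful when the G i have no constant term:
   then G ^ Q has no coefficient at P as soon as |P| < |Q|, so that only the
   multi-indices Q with all entries at most |P| matter. *)
Definition scomp (R : realType) (n : nat) (f : fps R n)
    (G : 'I_n -> fps R n) : fps R n :=
  fun P => \sum_(Q : {ffun 'I_n -> 'I_(mlen P).+1})
    f (midx_of_box Q) * spow G (midx_of_box Q) P.

Definition smap (R : realType) (n : nat) : Type := 'I_n -> fps R n.

Definition smap_comp (R : realType) (n : nat) (F G : smap R n) : smap R n :=
  fun s => scomp (F s) G.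

Definition smap_lin (R : realType) (n : nat) (A : 'M[Cplx R]_n) : smap R n :=
  fun s Q => \sum_j A s j * (Q == midx_unit j)%:R.

Definition smap_id (R : realType) (n : nat) : smap R n := smap_lin 1%:M.

Definition jac (R : realType) (n : nat) (F : smap R n) : 'M[Cplx R]_n :=
  \matrix_(s, j) F s (midx_unit j).

Definition fixes0 (R : realType) (n : nat) (F : smap R n) : Prop :=
  forall s, F s 0 = 0.

Definition smap_tangent_id (R : realType) (n : nat) (F : smap R n) : Prop :=
  fixes0 F /\ jac F = 1%:M.

(* The germ of f at 0 is the sum of the power series c, which converges
   absolutely on a polydisc around 0 (Cauchy estimates). *)
Definition has_taylor (R : realType) (n : nat) (f : 'cV[Cplx R]_n -> Cplx R)
    (c : fps R n) : Prop :=
  (exists r K : Cplx R, 0 < r /\ forall Q, `|c Q| * r ^+ mlen Q <= K) /\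
  \forall z \near (0 : 'cV[Cplx R]_n),
    (fun N => \sum_(Q : {ffun 'I_n -> 'I_N})
       c (midx_of_box Q) * monom (midx_of_box Q) z) @ \oo --> f z.

Definition holo (R : realType) (n : nat) (f : 'cV[Cplx R]_n -> Cplx R) : Prop :=
  exists c, has_taylor f c.

Definition has_taylor_map (R : realType) (n : nat)
    (F : 'cV[Cplx R]_n -> 'cV[Cplx R]_n) (c : smap R n) : Prop :=
  forall s, has_taylor (fun z => F z s 0) (c s).

Definition holo_map (R : realType) (n : nat)
    (F : 'cV[Cplx R]_n -> 'cV[Cplx R]_n) : Prop :=
  exists c, has_taylor_map F c.

(* F and G are inverse to each other, as germs of biholomorphisms fixing 0. *)
Definition holo_diffeo (R : realType) (n : nat)
    (F G : 'cV[Cplx R]_n -> 'cV[Cplx R]_n) : Prop :=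
  [/\ holo_map F /\ F 0 = 0, holo_map G /\ G 0 = 0,
      \forall z \near (0 : 'cV[Cplx R]_n), F (G z) = z &
      \forall z \near (0 : 'cV[Cplx R]_n), G (F z) = z].

Definition tangent_id (R : realType) (n : nat)
    (F : 'cV[Cplx R]_n -> 'cV[Cplx R]_n) : Prop :=
  exists c, has_taylor_map F c /\ smap_tangent_id c.

(* Representatives of the elements of the group of germs generated by the
   germs at 0 of the F i j. *)
Inductive gen_group (R : realType) (m n : nat)
    (F : 'I_m -> 'I_m -> 'cV[Cplx R]_n -> 'cV[Cplx R]_n) :
    ('cV[Cplx R]_n -> 'cV[Cplx R]_n) -> Prop :=
| gen_group_gen i j : gen_group F (F i j)
| gen_group_id : gen_group F id
| gen_group_comp g h :
    gen_group F g -> gen_group F h -> gen_group F (g \o h)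
| gen_group_inv g h :
    gen_group F g -> holo_diffeo g h -> gen_group F h
| gen_group_germ g h :
    gen_group F g -> (\forall z \near (0 : 'cV[Cplx R]_n), g z = h z) ->
    gen_group F h.

Definition abelian_germs (R : realType) (n : nat)
    (G : ('cV[Cplx R]_n -> 'cV[Cplx R]_n) -> Prop) : Prop :=
  forall g h, G g -> G h ->
    \forall z \near (0 : 'cV[Cplx R]_n), g (h z) = h (g z).

(* M is, near 0, a real analytic totally real submanifold of real dimension n
   with tangent space T at 0: the germ of M is the image of (R^n, 0) by a real
   analytic map (the restriction to R^n of the holomorphic germ g) whose
   differential at 0 is injective with image T, and T meets i T only at 0. *)
Definition totally_real_submanifold (R : realType) (n : nat)
    (M T : set 'cV[Cplx R]_n) : Prop :=
  exists (g : 'cV[Cplx R]_n -> 'cV[Cplx R]_n) (c : smap R n),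
    let dg (t : 'cV[R]_n) := jac c *m map_mx (@cplx_of_real R) t in
    [/\ has_taylor_map g c /\ fixes0 c,
        injective dg /\ T = range dg,
        (forall z, T z -> T ('i *: z) -> z = 0) &
        \forall e \near (0 : R)^'+, \forall z \near (0 : 'cV[Cplx R]_n),
          M z <-> exists t : 'cV[R]_n,
            (forall k, `|t k 0| < e) /\ z = g (map_mx (@cplx_of_real R) t)].

Definition antilin (R : realType) (n : nat) (B : 'M[Cplx R]_n)
    (z : 'cV[Cplx R]_n) : 'cV[Cplx R]_n := B *m mxconj z.

(* Monomial ideals are given by the finite list gs of the exponents of monomial
   generators. *)

Definition in_ideal (R : realType) (n : nat) (gs : seq (midx n))
    (f : 'cV[Cplx R]_n -> Cplx R) : Prop :=
  exists a : 'I_(size gs) -> 'cV[Cplx R]_n -> Cplx R,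
    (forall k, holo (a k)) /\
    \forall z \near (0 : 'cV[Cplx R]_n),
      f z = \sum_k a k z * monom (tnth (in_tuple gs) k) z.

(* The ideal of convergent power series in the conjugate variables generated
   by the conjugates of the same monomials. *)
Definition in_conj_ideal (R : realType) (n : nat) (gs : seq (midx n))
    (f : 'cV[Cplx R]_n -> Cplx R) : Prop :=
  exists a : 'I_(size gs) -> 'cV[Cplx R]_n -> Cplx R,
    (forall k, holo (a k)) /\
    \forall z \near (0 : 'cV[Cplx R]_n),
      f z = \sum_k a k (mxconj z) * monom (tnth (in_tuple gs) k) (mxconj z).

Definition in_formal_ideal (R : realType) (n : nat) (gs : seq (midx n))
    (f : fps R n) : Prop :=
  exists a : 'I_(size gs) -> fps R n,
    forall Q, f Q = \sum_k smul (a k) (smonom R (tnth (in_tuple gs) k)) Q.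

(* The case gs' = [::] with n = 0 is the zero ideal in zero variables. *)
Definition properly_embedded (R : realType) (n : nat) (gs : seq (midx n)) :
    Prop :=
  exists gs' : seq (midx n),
    (forall f : 'cV[Cplx R]_n -> Cplx R, in_ideal gs f <-> in_ideal gs' f) /\
    (gs' = [::] \/ exists k : 'I_n, forall Q, Q \in gs' -> Q k = 0%N).

Definition eigpow (R : realType) (n : nat) (mu : 'rV[Cplx R]_n) (Q : midx n) :
  Cplx R := \prod_i mu 0 i ^+ Q i.

(* omega_k, where S is the set of the multi-indices taken into account; the
   infimum is taken in the extended reals, with inf of the empty set +oo. *)
Definition omega (R : realType) (m n : nat) (mu : 'I_m -> 'I_m -> 'rV[Cplx R]_n)
    (S : set (midx n)) (k : nat) : \bar R :=
  ereal_inf [set x%:E | x in [set x : R | x != 0 /\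
    exists (Q : midx n) (s : 'I_n),
      [/\ (2 <= mlen Q <= 2 ^ k)%N, S Q &
          x = \big[Num.max/0]_(p : 'I_m * 'I_m)
                cmod (eigpow (mu p.1 p.2) Q - mu p.1 p.2 0 s)]]].

Definition diophantine (R : realType) (m n : nat)
    (mu : 'I_m -> 'I_m -> 'rV[Cplx R]_n) (S : set (midx n)) : Prop :=
  (- \sum_(1 <= k <oo) (lne (omega mu S k) * ((2 ^+ k)^-1)%:E) < +oo)%E.

Definition outside_ideal (R : realType) (n : nat) (gs : seq (midx n)) :
  set (midx n) := [set Q | ~ in_ideal gs (@monom R n Q)].

Definition nonresonant_on (R : realType) (m n : nat)
    (mu : 'I_m -> 'I_m -> 'rV[Cplx R]_n) (gs : seq (midx n)) : Prop :=
  forall Q : midx n, outside_ideal R gs Q -> (2 <= mlen Q)%N ->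
  forall (i : 'I_m) (k : 'I_n), exists j : 'I_m,
    (eigpow (mu i j) Q)^* != (mu i j 0 k)^-1.

Definition in_CD (R : realType) (m n : nat)
    (D : 'I_m -> 'I_m -> 'M[Cplx R]_n) (H : smap R n) : Prop :=
  (forall s Q, (mlen Q < 2)%N -> H s Q = 0) /\
  forall i j s Q,
    smap_comp H (smap_lin (D i j)) s Q = \sum_t D i j s t * H t Q.

Definition smonom_vec (R : realType) (n : nat) (Q : midx n) (s : 'I_n) :
  smap R n := fun t P => (t == s)%:R * smonom R Q P.

Definition zero_projection_CD (R : realType) (m n : nat)
    (D : 'I_m -> 'I_m -> 'M[Cplx R]_n) (H : smap R n) : Prop :=
  forall Q s, in_CD D (smonom_vec R Q s) -> H s Q = 0.

Definition formally_linearizable_on (R : realType) (m n : nat)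
    (F : 'I_m -> 'I_m -> 'cV[Cplx R]_n -> 'cV[Cplx R]_n)
    (D : 'I_m -> 'I_m -> 'M[Cplx R]_n) (gs : seq (midx n)) : Prop :=
  exists Phi Psi : smap R n,
    [/\ smap_tangent_id Phi,
        [/\ fixes0 Psi, smap_comp Phi Psi = @smap_id R n &
            smap_comp Psi Phi = @smap_id R n],
        zero_projection_CD D Phi &
        forall i j, exists f, has_taylor_map (F i j) f /\
          forall s, in_formal_ideal gs (fun Q =>
            smap_comp Psi (smap_comp f Phi) s Q - smap_lin (D i j) s Q)].

(* Main.v *)
(** Fix a formal linearization.  Only its coefficients at the monomials outside
    the ideal matter; at such a monomial [x^Q] in the component [s] they solve
    [(mu_ij^Q - mu_ij,s) phi_Q,s = (nonlinear part of F_ij at x + phi)_Q,s]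
    for all [i], [j].  Non-resonance of [M] forces [max_ij |mu_ij^Q - mu_ij,s|],
    the divisor at [(Q, s)], to be nonzero, so the formal solution is unique
    and it is enough to bound it; no Newton scheme is needed.

    The bound is Siegel's majorant method with Brjuno's way of counting small
    divisors.  If the divisors at [(P, s)] and [(Q, s)], [P < Q], are both
    small, then so is the one at [(Q - P + e_k, k)] for every [k], hence
    [|Q - P|] is large; for a properly embedded ideal, [k] is chosen to be a
    variable not occurring in the generators, so that this divisor is again
    outside the ideal.  The counting yields a supermultiplicative weight which
    absorbs the small divisors.

    Finally, if [h] denotes the conjugate of [rho_i], then [h] intertwines the
    conjugates of [F_ji] and [F_ij].  Comparing, degree by degree, the
    coefficients outside the ideal shows that those of degree at least 2 vanish,
    since otherwise [conj(mu_ij^Q) = mu_ij,s^-1] for all [j]. *)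
Require Import Defs.
From HB Require Import structures.
From mathcomp Require Import all_boot all_order all_algebra complex.
From mathcomp Require Import all_classical all_reals all_analysis.
From mathcomp Require Import ring lra zify.
Import Order.TTheory GRing.Theory Num.Theory.
Import numFieldNormedType.Exports.

Set Implicit Arguments.
Unset Strict Implicit.
Unset Printing Implicit Defensive.

Local Open Scope classical_set_scope.
Local Open Scope ring_scope.

(** * The modulus on R[i] *)

Section ComplexModulus.
Variable R : realType.
Implicit Types (x y : Cplx R) (a b : R).

(** The exponents outside a monomial ideal are closed under divisors, so a coefficient of [f o G]
    outside the ideal depends only on coefficients of [G] outside it. Computations modulo the ideal
    thus become exact identities between these coefficients, and those of the formal solution inside
    the ideal, which nothing controls, can be replaced by zero before anything is estimated.

    Siegel's majorant equation is usually solved by the implicit function theorem. Here an explicit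
    ball of coefficient sequences replaces it: the weight [vweight] is stable under convolution up
    to a constant, so substitution into a series of order 2 maps a small ball into itself. With
    trivial arithmetic weights, the same estimate gives the convergence of compositions and
    inverses.

    The arithmetic weights are built only up to degree [2 ^ J], to keep all sums finite. Their
    exponential bound does not depend on [J], which suffices because every coefficient is estimated
    separately. *)

Lemma cmodE x : cplx_of_real (cmod x) = `|x|.
Proof. by case: x. Qed.

Lemma cplx_of_real_inj : injective (@cplx_of_real R).
Proof. by move=> a b []. Qed.

Lemma cplx_of_realM a b :
  cplx_of_real (a * b) = cplx_of_real a * cplx_of_real b.
Proof. exact: (rmorphM (real_complex R)). Qed.

Lemma cplx_of_realX a k : cplx_of_real (a ^+ k) = cplx_of_real a ^+ k.
Proof. exact: (rmorphXn (real_complex R)). Qed.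

Lemma cplx_of_realD a b :
  cplx_of_real (a + b) = cplx_of_real a + cplx_of_real b.
Proof. exact: (rmorphD (real_complex R)). Qed.

Lemma ler_cplx a b : (cplx_of_real a <= cplx_of_real b) = (a <= b).
Proof. exact: lecR. Qed.

Lemma ltr_cplx a b : (cplx_of_real a < cplx_of_real b) = (a < b).
Proof. exact: ltcR. Qed.

Lemma cplx_of_realRe x : 0 <= x -> cplx_of_real (complex.Re x) = x.
Proof. by move=> x0; apply: RRe_real; rewrite ger0_real. Qed.

Lemma cmod_ge0 x : 0 <= cmod x.
Proof. by rewrite -ler_cplx cmodE normr_ge0. Qed.

Lemma cmod0 : cmod (0 : Cplx R) = 0.
Proof. by apply: cplx_of_real_inj; rewrite cmodE normr0. Qed.

Lemma cmod1 : cmod (1 : Cplx R) = 1.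
Proof. by apply: cplx_of_real_inj; rewrite cmodE normr1. Qed.

Lemma cmod_eq0 x : (cmod x == 0) = (x == 0).
Proof.
rewrite -(inj_eq cplx_of_real_inj) cmodE.
exact: (normr_eq0 x).
Qed.

Lemma cmodM x y : cmod (x * y) = cmod x * cmod y.
Proof. by apply: cplx_of_real_inj; rewrite cplx_of_realM !cmodE normrM. Qed.

Lemma cmodX x k : cmod (x ^+ k) = cmod x ^+ k.
Proof. by apply: cplx_of_real_inj; rewrite cplx_of_realX !cmodE normrX. Qed.

Lemma cmodD x y : cmod (x + y) <= cmod x + cmod y.
Proof. by rewrite -ler_cplx cplx_of_realD !cmodE ler_normD. Qed.

Lemma cmodN x : cmod (- x) = cmod x.
Proof. by apply: cplx_of_real_inj; rewrite !cmodE normrN. Qed.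

Lemma cmodB x y : cmod (x - y) = cmod (y - x).
Proof. by rewrite -cmodN opprB. Qed.

Lemma cmod_conj x : cmod x^* = cmod x.
Proof. by apply: cplx_of_real_inj; rewrite !cmodE norm_conjC. Qed.

Lemma cmodV x : cmod x^-1 = (cmod x)^-1.
Proof.
have [->|x0] := eqVneq x 0; first by rewrite !(invr0, cmod0).
have cx0 : cmod x != 0 by rewrite cmod_eq0.
by apply: (mulfI cx0); rewrite -cmodM !mulfV // cmod1.
Qed.

Lemma cmod_real a : cmod (cplx_of_real a) = `|a|.
Proof.
rewrite /cmod normc_def /= expr0n addr0.
exact: sqrtr_sqr.
Qed.

Lemma cmod_sum (I : Type) (r : seq I) (P : pred I) (F : I -> Cplx R) :
  cmod (\sum_(i <- r | P i) F i) <= \sum_(i <- r | P i) cmod (F i).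
Proof.
elim/big_ind2: _ => [|x a y b xa yb|//]; first by rewrite cmod0.
by apply: le_trans (cmodD _ _) _; apply: lerD.
Qed.

Lemma cmod_prod (I : Type) (r : seq I) (P : pred I) (F : I -> Cplx R) :
  cmod (\prod_(i <- r | P i) F i) = \prod_(i <- r | P i) cmod (F i).
Proof. by elim/big_ind2: _ => [|x a y b <- <-|//]; rewrite (cmod1, cmodM). Qed.

Lemma cmod_Re x : `|complex.Re x| <= cmod x.
Proof. by rewrite -ler_cplx cmodE; exact: normc_ge_Re. Qed.

Lemma cmod_Im x : `|complex.Im x| <= cmod x.
Proof.
case: x => u v; rewrite /cmod normc_def /= -sqrtr_sqr ler_sqrt ?addr_ge0 ?sqr_ge0//.
by rewrite lerDr sqr_ge0.
Qed.

Lemma cmod_ReIm x : cmod x <= `|complex.Re x| + `|complex.Im x|.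
Proof.
case: x => u v; rewrite /cmod normc_def /=.
rewrite -[leRHS]ger0_norm ?addr_ge0// -sqrtr_sqr ler_sqrt ?sqr_ge0//.
rewrite sqrrD !real_normK ?num_real// addrAC lerDl.
by rewrite mulrn_wge0 ?mulr_ge0.
Qed.

End ComplexModulus.

(** * Multi-indices *)

Section MultiIndices.
Variable n : nat.
Implicit Types P Q : midx n.

Definition mle P Q := [forall i, (P i <= Q i)%N].

Definition msub Q P : midx n := [ffun i => (Q i - P i)%N].

Definition mbox N : seq (midx n) :=
  [seq midx_of_box b | b <- enum {: {ffun 'I_n -> 'I_N}}].

Lemma mleP P Q : reflect (forall i, (P i <= Q i)%N) (mle P Q).
Proof. exact: forallP. Qed.

Lemma mle_trans P Q T : mle P Q -> mle Q T -> mle P T.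
Proof. by move=> /mleP PQ /mleP QT; apply/mleP => i; apply: leq_trans (QT i). Qed.

Lemma mlenD P Q : mlen (P + Q) = (mlen P + mlen Q)%N.
Proof. by rewrite /mlen -big_split; apply: eq_bigr => i _; rewrite ffunE. Qed.

Lemma mlen0 : @mlen n 0 = 0%N.
Proof. by rewrite /mlen big1// => i _; rewrite ffunE. Qed.

Lemma leq_mlen Q i : (Q i <= mlen Q)%N.
Proof. by rewrite /mlen (bigD1 i)//= leq_addr. Qed.

Lemma mlen_eq0 Q : (mlen Q == 0%N) = (Q == 0).
Proof.
apply/eqP/eqP => [Q0|->]; last exact: mlen0.
by apply/ffunP => i; have := leq_mlen Q i; rewrite ffunE Q0 leqn0 => /eqP.
Qed.

Lemma mlen_unit (i : 'I_n) : mlen (midx_unit i) = 1%N.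
Proof.
rewrite /mlen (bigD1 i)//= ffunE eqxx big1// => j /negPf.
by rewrite ffunE => ->.
Qed.

Lemma mlen1P Q : mlen Q = 1%N -> exists i, Q = midx_unit i.
Proof.
move=> Q1; have /existsP[i Qi] : [exists i, (0 < Q i)%N].
  rewrite -[X in is_true X]negbK negb_exists; apply/negP => /forallP Q0.
  have /eqP: Q = 0.
    by apply/ffunP => j; move: (Q0 j); rewrite -eqn0Ngt ffunE => /eqP.
  by rewrite -mlen_eq0 Q1.
exists i; apply/ffunP => j; rewrite ffunE.
have := Q1; rewrite /mlen (bigD1 i)//=.
have [->|ji] := eqVneq j i.
  by move: Qi; case: (Q i) => // -[|k] //; rewrite !addSn.
rewrite (bigD1 j)//=; lia.
Qed.

Lemma midx_unit_inj : injective (@midx_unit n).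
Proof.
move=> i j /ffunP /(_ i); rewrite !ffunE eqxx.
by case: eqP => // ->.
Qed.

Lemma mle_mlen P Q : mle P Q -> (mlen P <= mlen Q)%N.
Proof. by move=> /mleP PQ; apply: leq_sum => i _. Qed.

Lemma mle_addr P Q : mle P (P + Q).
Proof. by apply/mleP => i; rewrite ffunE leq_addr. Qed.

Lemma mle_addl P Q : mle P (Q + P).
Proof. by apply/mleP => i; rewrite ffunE leq_addl. Qed.

Lemma mle0 Q : mle 0 Q.
Proof. by apply/mleP => i; rewrite ffunE. Qed.

Lemma msubKC P Q : mle P Q -> P + msub Q P = Q.
Proof. by move=> /mleP PQ; apply/ffunP => i; rewrite !ffunE; exact: subnKC. Qed.

Lemma addmK P Q : msub (P + Q) P = Q.
Proof. by apply/ffunP => i; rewrite !ffunE; exact: addKn. Qed.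

Lemma msub0 Q : msub Q 0 = Q.
Proof. by apply/ffunP => i; rewrite !ffunE subn0. Qed.

Lemma msubK P Q : mle P Q -> msub Q (msub Q P) = P.
Proof. by move=> PQ; rewrite -{1}(msubKC PQ) addrC addmK. Qed.

Lemma mle_msub P Q : mle (msub Q P) Q.
Proof. by apply/mleP => i; rewrite ffunE leq_subr. Qed.

Lemma mlen_msub P Q : mle P Q -> (mlen P + mlen (msub Q P) = mlen Q)%N.
Proof. by move=> PQ; rewrite -mlenD msubKC. Qed.

Lemma mle_eqlen P Q : mle P Q -> mlen P = mlen Q -> P = Q.
Proof.
move=> PQ PQl; have := mlen_msub PQ; rewrite PQl -[RHS]addn0 => /addnI/eqP.
by rewrite mlen_eq0 => /eqP s0; rewrite -(msubKC PQ) s0 addr0.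
Qed.

Lemma midx_of_box_inj N : injective (@midx_of_box n N).
Proof.
by move=> b c /ffunP bc; apply/ffunP => i; have := bc i; rewrite !ffunE => /val_inj.
Qed.

Lemma uniq_mbox N : uniq (mbox N).
Proof. by rewrite map_inj_uniq ?enum_uniq//; exact: midx_of_box_inj. Qed.

Lemma mem_mbox N Q : (Q \in mbox N) = [forall i, (Q i < N)%N].
Proof.
apply/mapP/forallP => [[P _ ->] i|QN]; first by rewrite ffunE.
exists [ffun i => Ordinal (QN i)]; first by rewrite mem_enum.
by apply/ffunP => i; rewrite !ffunE.
Qed.

Lemma mlen_mbox N Q : (mlen Q < N)%N -> Q \in mbox N.
Proof.
by move=> QN; rewrite mem_mbox; apply/forallP => i; apply: leq_ltn_trans QN; exact: leq_mlen.
Qed.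

Lemma big_box (V : nmodType) N (A : pred (midx n)) (F : midx n -> V) :
  \sum_(b : {ffun 'I_n -> 'I_N} | A (midx_of_box b)) F (midx_of_box b) =
  \sum_(Q <- mbox N | A Q) F Q.
Proof. by rewrite /mbox big_map big_enum_cond. Qed.

Lemma eq_big_uniq (T : eqType) (V : nmodType) (r1 r2 : seq T)
    (A1 A2 : pred T) (F : T -> V) :
  uniq r1 -> uniq r2 ->
  (forall x, (x \in r1) && A1 x = (x \in r2) && A2 x) ->
  \sum_(x <- r1 | A1 x) F x = \sum_(x <- r2 | A2 x) F x.
Proof.
move=> u1 u2 e; rewrite -big_filter -[RHS]big_filter; apply: perm_big.
apply: uniq_perm; rewrite ?filter_uniq// => x.
by rewrite !mem_filter andbC e andbC.
Qed.

Lemma big_mbox_widen (V : nmodType) N N' (F : midx n -> V) :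
  (N <= N')%N -> (forall Q, F Q != 0 -> Q \in mbox N) ->
  \sum_(Q <- mbox N') F Q = \sum_(Q <- mbox N) F Q.
Proof.
move=> NN' F0; rewrite (bigID (fun Q => Q \in mbox N))/= [X in _ + X]big1 ?addr0; last first.
  by move=> Q; apply: contraNeq => /F0.
apply: eq_big_uniq; rewrite ?uniq_mbox// => Q; rewrite andbT.
rewrite andb_idl// !mem_mbox => /forallP QN; apply/forallP => i.
exact: leq_trans NN'.
Qed.

Lemma big_mbox_shift (V : nmodType) N P (F : midx n -> V) :
  \sum_(Q <- mbox N | mle P Q) F (msub Q P) =
  \sum_(Q <- mbox N | P + Q \in mbox N) F Q.
Proof.
rewrite -big_filter.
have -> : [seq Q <- mbox N | mle P Q] =i
    [seq P + Q | Q <- [seq Q <- mbox N | P + Q \in mbox N]] -> 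
  \sum_(Q <- [seq Q <- mbox N | mle P Q]) F (msub Q P) =
  \sum_(Q <- mbox N | P + Q \in mbox N) F Q => // [e|].
  transitivity (\sum_(Q <- [seq P + Q | Q <- [seq Q <- mbox N | P + Q \in mbox N]]) F (msub Q P)).
    apply: perm_big; apply: uniq_perm => //; first by rewrite filter_uniq ?uniq_mbox.
    rewrite map_inj_uniq ?filter_uniq ?uniq_mbox// => Q Q' /(congr1 (msub^~ P)).
    by rewrite !addmK.
  rewrite big_map big_filter; apply: eq_bigr => Q _; by rewrite addmK.
move=> Q; rewrite mem_filter; apply/andP/mapP => [[PQ QN]|[T]].
  exists (msub Q P); rewrite ?msubKC// mem_filter msubKC// QN/=.
  move: QN; rewrite !mem_mbox => /forallP QN; apply/forallP => i; rewrite ffunE.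
  by apply: leq_ltn_trans (QN i); exact: leq_subr.
by rewrite mem_filter => /andP[PT _] ->; rewrite mle_addr.
Qed.

End MultiIndices.
Arguments mbox : clear implicits.

(** * Formal power series *)

Section FormalSeries.
Variables (R : realType) (n : nat).
Implicit Types (f g : fps R n) (G H : 'I_n -> fps R n) (P Q : midx n).
Implicit Types (z : 'cV[Cplx R]_n).

(** [smul] sums over a box whose side depends on [Q]; one box for all exponents is needed before
    sums over [P] and [Q] can be exchanged. *)
Lemma smulE N f g Q : Q \in mbox n N ->
  smul f g Q = \sum_(P <- mbox n N | mle P Q) f P * g (msub Q P).
Proof.
move=> QN; rewrite /smul (eq_big (fun b => mle (midx_of_box b) Q)
  (fun b => f (midx_of_box b) * g (msub Q (midx_of_box b)))); last first.
- by move=> b _; congr (_ * g _); apply/ffunP => i; rewrite !ffunE.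
- by move=> b; apply: eq_forallb => i; rewrite ffunE.
rewrite (@big_box n _ _ (fun P => mle P Q) (fun P => f P * g (msub Q P))).
apply: eq_big_uniq; rewrite ?uniq_mbox// => P.
rewrite ![(_ \in _) && _]andbC; apply: andb_id2l => /mleP PQ.
rewrite !mem_mbox; transitivity true; last symmetry; apply/forallP => i.
  by rewrite ltnS (leq_trans (PQ i))// leq_mlen.
by move: QN; rewrite mem_mbox => /forallP/(_ i); apply: leq_ltn_trans.
Qed.

Lemma smul_mem f g Q :
  smul f g Q = \sum_(P <- mbox n (mlen Q).+1 | mle P Q) f P * g (msub Q P).
Proof. by apply: smulE; apply: mlen_mbox. Qed.

Lemma smulC f g : smul f g = smul g f.
Proof.
apply/funext => Q; rewrite !smul_mem.
set r := mbox n _; have mr P : mle P Q -> P \in r.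
  by move=> /mle_mlen PQ; apply: mlen_mbox.
rewrite -big_filter -[RHS]big_filter.
have perm : perm_eq [seq P <- r | mle P Q] [seq msub Q P | P <- [seq P <- r | mle P Q]].
  apply: uniq_perm; rewrite ?filter_uniq ?uniq_mbox//.
    rewrite map_inj_in_uniq ?filter_uniq ?uniq_mbox// => P P'.
    rewrite !mem_filter => /andP[PQ _] /andP[P'Q _] /(congr1 (msub Q)).
    by rewrite !msubK.
  move=> P; rewrite mem_filter; apply/andP/mapP => [[PQ _]|[P' _ ->]].
    exists (msub Q P); rewrite ?msubK// mem_filter mle_msub mr//; exact: mle_msub.
  by rewrite mle_msub mr// mle_msub.
rewrite [RHS](perm_big _ perm) big_map !big_filter; apply: eq_bigr => P PQ.
by rewrite msubK// mulrC.
Qed.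

Lemma smul_smonom f T Q :
  smul (smonom R T) f Q = if mle T Q then f (msub Q T) else 0.
Proof.
rewrite smul_mem; case: ifP => TQ; last first.
  rewrite big1// => P PQ; rewrite /smonom; case: eqP => [PT|_]; last by rewrite mul0r.
  by move: TQ; rewrite -PT PQ.
rewrite -big_filter (bigD1_seq T)/=; last first.
- by rewrite filter_uniq ?uniq_mbox.
- by rewrite mem_filter TQ mlen_mbox// ltnS mle_mlen.
rewrite /smonom eqxx mul1r big1 ?addr0// => P /negPf ->; exact: mul0r.
Qed.

Lemma smul1 f : smul (smonom R 0) f = f.
Proof. by apply/funext => Q; rewrite smul_smonom mle0 msub0. Qed.

(** The first argument of [Rel] counts factors, so that quantities adding up under products, such as
    orders of vanishing, can be carried along. *)
Lemma spow_ind2 (Rel : nat -> fps R n -> fps R n -> Prop) G H Q :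
  Rel 0%N (smonom R 0) (smonom R 0) -> (forall i, Rel 1%N (G i) (H i)) ->
  (forall k l f f' g g', Rel k f f' -> Rel l g g' ->
     Rel (k + l)%N (smul f g) (smul f' g')) ->
  Rel (mlen Q) (spow G Q) (spow H Q).
Proof.
move=> R0 R1 RM; rewrite /mlen /spow.
elim/big_rec3: _ => // i k f f' _ ff'; apply: (RM (Q i)) => //.
elim: (Q i) => [//|l IH]; exact: (RM 1%N).
Qed.

Lemma spow_ind (A : nat -> fps R n -> Prop) G Q :
  A 0%N (smonom R 0) -> (forall i, A 1%N (G i)) ->
  (forall k l f g, A k f -> A l g -> A (k + l)%N (smul f g)) ->
  A (mlen Q) (spow G Q).
Proof.
move=> A0 A1 AM; apply: (@spow_ind2 (fun k f f' => A k f) G G) => //.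
by move=> k l f _ g _; exact: AM.
Qed.

Definition sorder k f := forall Q, (mlen Q < k)%N -> f Q = 0.

Lemma sorder_smul k l f g :
  sorder k f -> sorder l g -> sorder (k + l) (smul f g).
Proof.
move=> fk gl Q Qkl; rewrite smul_mem big1// => P PQ.
have [Pk|Pk] := ltnP (mlen P) k; first by rewrite fk// mul0r.
by rewrite gl ?mulr0//; have := mlen_msub PQ; lia.
Qed.

Lemma sorder_fixes0 G : fixes0 G <-> forall s, sorder 1 (G s).
Proof.
split=> G0 s; last by apply: G0; rewrite mlen0.
by move=> Q; rewrite ltnS leqn0 mlen_eq0 => /eqP ->; exact: G0.
Qed.

Lemma sorder_spow G Q : fixes0 G -> sorder (mlen Q) (spow G Q).
Proof.
move=> /sorder_fixes0 G0; apply: (@spow_ind sorder) => //; exact: sorder_smul.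
Qed.

(* [d] bounds the degree up to which [G] and [H] agree on [U]; since they have
   no constant term, their products of at least two factors agree one degree
   further. *)
Lemma spow_agree (U : pred (midx n)) d G H P Q :
  (forall S T, mle S T -> U T -> U S) -> fixes0 G -> fixes0 H ->
  (forall s T, U T -> (mlen T < d)%N -> G s T = H s T) ->
  U Q -> ((mlen Q).+1 < d + mlen P)%N || (P == 0) ->
  spow G P Q = spow H P Q.
Proof.
move=> Udown /sorder_fixes0 G0 /sorder_fixes0 H0 GH; rewrite -mlen_eq0.
have := @spow_ind2 (fun k f f' => [/\ sorder k f, sorder k f' &
  forall T, U T -> ((mlen T).+1 < d + k)%N || (k == 0)%N -> f T = f' T]) G H P.
move=> -[//||k l f f' g g' [fk f'k ff'] [gl g'l gg']|_ _ GHP UQ QP]; last exact: GHP.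
- move=> i; split=> // T UT; rewrite addn1 ltnS orbF; exact: GH.
- split; [exact: sorder_smul|exact: sorder_smul|] => T UT Tkl.
  rewrite !smul_mem; apply: eq_bigr => S ST.
  have ST' := mlen_msub ST.
  have [Sk|Sk] := ltnP (mlen S) k; first by rewrite fk// f'k// !mul0r.
  have [Sl|Sl] := ltnP (mlen (msub T S)) l; first by rewrite gl// g'l// !mulr0.
  rewrite ff'; [|exact: Udown UT|by move: Tkl; lia].
  rewrite gg'//; [|by move: Tkl; lia].
  by apply: Udown UT; exact: mle_msub.
Qed.

Lemma scompE N f G P : fixes0 G -> (mlen P < N)%N ->
  scomp f G P = \sum_(Q <- mbox n N) f Q * spow G Q P.
Proof.
move=> G0 PN; rewrite /scomp (@big_box n _ _ xpredT (fun Q => f Q * spow G Q P)).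
symmetry; apply: big_mbox_widen => // Q; apply: contraR => QP.
rewrite (sorder_spow G0) ?mulr0// ltnNge; apply: contra QP => QP.
exact: mlen_mbox.
Qed.

(** The exponents of the factors of a monomial divide its exponent, so a downward closed [U] is all
    that [G] needs to be known on. With the complement of a monomial ideal as [U], this is how
    composition passes to the quotient. *)
Lemma scomp_agree (U : pred (midx n)) f f' G H Q :
  (forall S T, mle S T -> U T -> U S) -> fixes0 G -> fixes0 H ->
  (forall P, (mlen P <= mlen Q)%N -> f P = f' P) ->
  (forall s T, U T -> (mlen T <= mlen Q)%N -> G s T = H s T) ->
  U Q -> scomp f G Q = scomp f' H Q.
Proof.
move=> Ud G0 H0 ff' GH UQ; rewrite !(@scompE (mlen Q).+1)//.
apply: eq_bigr => P _; have [PQ|PQ] := leqP (mlen P) (mlen Q); last first.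
  by rewrite !sorder_spow ?mulr0.
rewrite ff'//; congr (_ * _); apply: (@spow_agree U (mlen Q).+1) => //.
by rewrite -mlen_eq0; case: (mlen P) => [|k]; rewrite ?orbT//; lia.
Qed.

Lemma scomp_agree_deg f f' G H Q : fixes0 G -> fixes0 H ->
  (forall P, (mlen P <= mlen Q)%N -> f P = f' P) ->
  (forall s P, (mlen P <= mlen Q)%N -> G s P = H s P) ->
  scomp f G Q = scomp f' H Q.
Proof.
move=> G0 H0 ff' GH; apply: (@scomp_agree xpredT) => // s T _; exact: GH.
Qed.

Definition strunc N f : fps R n := fun Q => if (mlen Q < N)%N then f Q else 0.

Definition ssupp N f := forall Q, (N <= mlen Q)%N -> f Q = 0.

Definition ev N f z := \sum_(Q <- mbox n N) f Q * monom Q z.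

Lemma ssupp_strunc N f : ssupp N (strunc N f).
Proof. by move=> Q; rewrite /strunc ltnNge => ->. Qed.

Lemma ssuppW N N' f : (N <= N')%N -> ssupp N f -> ssupp N' f.
Proof. by move=> NN' fN Q QN'; apply: fN; apply: leq_trans QN'. Qed.

Lemma ev_widen N N' f z : ssupp N f -> (N <= N')%N -> ev N' f z = ev N f z.
Proof.
move=> fN NN'; apply: big_mbox_widen => // Q; apply: contraR => QN.
rewrite fN ?mul0r// leqNgt; apply: contra QN; exact: mlen_mbox.
Qed.

Lemma monomD P Q z : monom (P + Q) z = monom P z * monom Q z.
Proof. by rewrite -big_split; apply: eq_bigr => i _; rewrite ffunE exprD. Qed.

Lemma monom0 z : monom 0 z = 1.
Proof. by rewrite /monom big1// => i _; rewrite ffunE. Qed.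

Lemma monom_unit (i : 'I_n) z : monom (midx_unit i) z = z i 0.
Proof.
rewrite /monom (bigD1 i)//= ffunE eqxx expr1 big1 ?mulr1// => j /negPf ji.
by rewrite ffunE ji.
Qed.

Lemma ssupp_smul N1 N2 f g :
  ssupp N1.+1 f -> ssupp N2.+1 g -> ssupp (N1 + N2).+1 (smul f g).
Proof.
move=> fN gN Q QN; rewrite smul_mem big1// => P PQ.
have [Pk|Pk] := leqP N1.+1 (mlen P); first by rewrite fN// mul0r.
by rewrite gN ?mulr0//; have := mlen_msub PQ; lia.
Qed.

Lemma ev_smul N1 N2 N f g z : ssupp N1.+1 f -> ssupp N2.+1 g -> (N1 + N2 < N)%N ->
  ev N (smul f g) z = ev N f z * ev N g z.
Proof.
move=> fN gN NN.
transitivity (\sum_(Q <- mbox n N) \sum_(P <- mbox n N | mle P Q)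
    (f P * monom P z) * (g (msub Q P) * monom (msub Q P) z)).
  rewrite /ev !(big_seq_cond xpredT); apply: eq_bigr => Q /andP[QN _].
  rewrite (smulE f g QN) mulr_suml; apply: eq_bigr => P PQ.
  by rewrite -{2}(msubKC PQ) monomD; ring.
rewrite (exchange_big_dep xpredT)//= /ev mulr_suml; apply: eq_bigr => P _.
rewrite -big_distrr/= (big_mbox_shift N P (fun T => g T * monom T z)) mulr_sumr.
have [PN|PN] := leqP N1.+1 (mlen P).
  by rewrite fN// !mul0r big1// => Q _; rewrite mul0r.
rewrite -mulr_sumr; congr (_ * _); rewrite [RHS](bigID (fun Q => P + Q \in mbox n N))/=.
rewrite [X in _ = _ + X]big1 ?addr0// => Q; apply: contraNeq => gQ.
apply: mlen_mbox; rewrite mlenD; have [QN|] := leqP N2.+1 (mlen Q); last by lia.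
by rewrite gN// mul0r eqxx in gQ.
Qed.

Lemma ssupp1 N : ssupp N.+1 (smonom R (0 : midx n)).
Proof.
move=> Q QN; rewrite /smonom; case: eqP => // Q0.
by rewrite Q0 mlen0 in QN.
Qed.

Lemma ev1 N z : (0 < N)%N -> ev N (smonom R 0) z = 1.
Proof.
move=> N0; rewrite /ev (bigD1_seq 0) ?uniq_mbox//=; last first.
  by rewrite mlen_mbox// mlen0.
rewrite monom0 /smonom eqxx mulr1 big1 ?addr0// => Q /negPf ->.
exact: mul0r.
Qed.

Lemma ev_spow N G P z : (forall i, ssupp N.+1 (G i)) ->
  ssupp (mlen P * N).+1 (spow G P) /\
  forall N', (mlen P * N < N')%N -> (N < N')%N ->
  ev N' (spow G P) z = monom P (\col_i ev N.+1 (G i) z).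
Proof.
move=> GN.
have iterE i k : ssupp (k * N).+1 (iter k (smul (G i)) (smonom R 0)) /\
    forall N', (k * N < N')%N -> (N < N')%N ->
    ev N' (iter k (smul (G i)) (smonom R 0)) z = (ev N.+1 (G i) z) ^+ k.
  elim: k => [|k [IH1 IH2]]; first by split=> [|N' N'0 _]; [exact: ssupp1|exact: ev1].
  split=> [|N' kN' NN'] /=; first by rewrite mulSn; exact: ssupp_smul.
  rewrite (ev_smul _ (GN i) IH1) ?IH2//; last by rewrite mulSn in kN'; lia.
  by rewrite exprS (ev_widen _ (GN i)).
rewrite /spow /monom /mlen.
elim/big_rec3: _ => [|i x y k _ [IH1 IH2]].
  by split=> [|N' N'0 _]; [exact: ssupp1|exact: ev1].
split=> [|N']; rewrite mulnDl; first by apply: ssupp_smul => //; case: (iterE i (P i)).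
move=> PN' NN'; rewrite (@ev_smul (P i * N) (k * N))//; last by case: (iterE i (P i)).
rewrite IH2//; last by lia.
by rewrite (iterE i (P i)).2 ?mxE//; lia.
Qed.

(** Identities between compositions of series are reduced to truncations and then read off from
    values of polynomials; this avoids multinomial sums. *)
Lemma ev_scomp N f G z : fixes0 G -> ssupp N.+1 f -> (forall i, ssupp N.+1 (G i)) ->
  ssupp (N * N).+1 (scomp f G) /\
  forall N', (N * N < N')%N -> (N < N')%N ->
  ev N' (scomp f G) z = ev N.+1 f (\col_i ev N.+1 (G i) z).
Proof.
move=> G0 fN GN.
have E Q M : (N < M)%N ->
    scomp f G Q = \sum_(P <- mbox n M) f P * spow G P Q.
  move=> NM; rewrite (@scompE (maxn M (mlen Q).+1))//; last by rewrite leq_max ltnSn orbT.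
  apply: big_mbox_widen; rewrite ?leq_maxl// => P; apply: contraR => PM.
  rewrite fN ?mul0r//; apply: leq_trans NM _; rewrite leqNgt.
  apply: contra PM; exact: mlen_mbox.
have fP P : f P != 0 -> (mlen P * N <= N * N)%N.
  move=> fP; rewrite leq_mul2r; apply/orP; right; rewrite leqNgt.
  by apply: contraNN fP => ?; rewrite fN.
split=> [Q QN|N' NN' N1].
  rewrite (E _ N.+1)// big1// => P _.
  have [->|/fP fP0] := eqVneq (f P) 0; first by rewrite mul0r.
  by rewrite ((ev_spow P z GN).1 Q) ?mulr0//; lia.
rewrite /ev; under eq_bigr do rewrite (E _ N.+1)// mulr_suml.
rewrite exchange_big/=; apply: eq_bigr => P _.
under eq_bigr do rewrite -mulrA.
rewrite -mulr_sumr.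
have [->|/fP fP0] := eqVneq (f P) 0; first by rewrite !mul0r.
by rewrite -((ev_spow P z GN).2 N')//; lia.
Qed.

End FormalSeries.

(** * Uniqueness of polynomial coefficients and associativity of substitution *)

Section CompositionAlgebra.
Variables (R : realType) (n : nat).
Implicit Types (f g : fps R n) (G H : smap R n) (P Q : midx n).
Implicit Types (z : 'cV[Cplx R]_n).

Lemma digits_inj k N (a b : 'I_k -> nat) :
  (forall i, (a i < N)%N) -> (forall i, (b i < N)%N) ->
  (\sum_i a i * N ^ i = \sum_i b i * N ^ i)%N -> a =1 b.
Proof.
elim: k a b => [|k IH] a b aN bN; first by move=> _ [].
rewrite !big_ord_recl/= !expn0 !muln1.
have E (c : 'I_k.+1 -> nat) : (\sum_(i < k) c (lift ord0 i) * N ^ bump 0 i =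
    N * \sum_(i < k) c (lift ord0 i) * N ^ i)%N.
  by rewrite big_distrr/=; apply: eq_bigr => i _; rewrite /bump/= expnS mulnCA.
rewrite !E => ab.
have ab0 : a ord0 = b ord0.
  by have := congr1 (modn^~ N) ab; rewrite ![(_ + N * _)%N]addnC ![(N * _)%N]mulnC
    !modnMDl !modn_small.
move: ab; rewrite ab0 => /addnI/eqP; rewrite eqn_mul2l => /orP[/eqP N0|/eqP ab].
  by have := aN ord0; rewrite N0.
move=> i; case: (unliftP ord0 i) => [j|] ->//.
by apply: (IH (a \o lift ord0) (b \o lift ord0)) => // i'; [exact: aN|exact: bN].
Qed.

(* Kronecker substitution: [z_i = t ^ (N ^ i)] separates the monomials with
   exponents below [N]. *)
Lemma ev_near0 N f (r : R) : ssupp N f -> 0 < r ->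
  (forall z, (forall i, cmod (z i 0) < r) -> ev N f z = 0) ->
  forall Q, f Q = 0.
Proof.
move=> fN r0 ev0 Q; have [QN|] := ltnP (mlen Q) N; last exact: fN.
have N0 : (0 < N)%N by apply: leq_ltn_trans QN.
pose code P := (\sum_i P i * N ^ i)%N.
pose p : {poly Cplx R} := \sum_(P <- mbox n N) f P *: 'X^(code P).
(* With [r' <= 1], no power [t ^+ (N ^ i)] exceeds [t] in modulus, so the points [r' / k.+2] all
   lead into the polydisc and give infinitely many roots of [p]. *)
pose r' := Num.min r 1.
have r'0 : 0 < r' by rewrite lt_min r0 ltr01.
have root_p k : root p (cplx_of_real (r' / k.+2%:R)).
  set t := cplx_of_real _; apply/eqP.
  have tr : cmod t < r'.
    rewrite cmod_real ger0_norm ?divr_ge0 ?ltW// ltr_pdivrMr//.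
    by rewrite ltr_pMr// ltr1n.
  rewrite -(ev0 (\col_i t ^+ (N ^ i))) => [|i]; last first.
    rewrite mxE cmodX; apply: le_lt_trans (_ : cmod t < r); last first.
      by apply: lt_le_trans tr _; rewrite ge_min lexx.
    rewrite -[leRHS]expr1; apply: ler_wiXn2l; rewrite ?cmod_ge0 ?expn_gt0 ?N0//.
    by apply: le_trans (ltW tr) _; rewrite ge_min lexx orbT.
  rewrite /p /ev horner_sum; apply: eq_bigr => P _.
  rewrite hornerZ hornerXn; congr (_ * _); rewrite /code /monom -prodrXr.
  by apply: eq_bigr => i _; rewrite mxE -exprM mulnC.
have p0 : p = 0.
  apply/eqP; apply/negPn/negP => /max_poly_roots.
  move=> /(_ [seq cplx_of_real (r' / k.+2%:R) | k <- iota 0 (size p)]).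
  rewrite size_map size_iota ltnn => /(_ _ _)/notF; apply.
    by apply/allP => _ /mapP[k _ ->].
  rewrite map_inj_uniq ?iota_uniq// => k l /cplx_of_real_inj.
  move/(mulfI (lt0r_neq0 r'0))/invr_inj/eqP; rewrite eqr_nat => /eqP; lia.
have := congr1 (fun q : {poly Cplx R} => q`_(code Q)) p0.
rewrite coef0 /p coef_sum (bigD1_seq Q) ?uniq_mbox ?mlen_mbox//=.
rewrite coefZ coefXn eqxx mulr1 big_seq_cond big1 ?addr0// => P /andP[PN PQ].
rewrite coefZ coefXn; case: eqP => [cPQ|_]; last by rewrite mulr0.
case/eqP: PQ; apply/ffunP => i; symmetry; apply: (digits_inj _ _ cPQ) => {}i.
  by apply: leq_ltn_trans QN; exact: leq_mlen.
by move: PN; rewrite mem_mbox => /forallP.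
Qed.

Lemma ev_inj N f g : ssupp N f -> ssupp N g -> (forall z, ev N f z = ev N g z) ->
  f =1 g.
Proof.
move=> fN gN fg Q; apply/eqP; rewrite -subr_eq0; apply/eqP.
apply: (@ev_near0 N (fun Q => f Q - g Q) 1) => // [P PN|z _].
  by rewrite fN// gN// subr0.
rewrite /ev; under eq_bigr do rewrite mulrBl.
by rewrite sumrB -/(ev N f z) fg subrr.
Qed.

Lemma spow0 G : spow G 0 = smonom R 0.
Proof.
by rewrite /spow; elim/big_rec: _ => [|i x _ ->]//; rewrite ffunE/=; exact: smul1.
Qed.

Lemma scomp0 f G : fixes0 G -> scomp f G 0 = f 0.
Proof.
move=> G0; rewrite (@scompE _ _ 1)// ?mlen0// (bigD1_seq 0) ?uniq_mbox/= ?mlen_mbox ?mlen0//.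
rewrite spow0 {1}/smonom eqxx mulr1 big1 ?addr0// => P P0.
by rewrite sorder_spow ?mulr0// mlen0 lt0n mlen_eq0.
Qed.

Lemma fixes0_comp G H : fixes0 G -> fixes0 H -> fixes0 (smap_comp G H).
Proof. by move=> G0 H0 s; rewrite /smap_comp scomp0. Qed.

Lemma fixes0_lin (A : 'M[Cplx R]_n) : fixes0 (smap_lin A).
Proof.
move=> s; rewrite /smap_lin big1// => j _; case: eqP => [e|_]; last by rewrite mulr0.
by have := mlen_unit j; rewrite -e mlen0.
Qed.

Lemma fixes0_strunc N G : fixes0 G -> fixes0 (fun s => strunc N (G s)).
Proof. by move=> G0 s; rewrite /strunc G0 if_same. Qed.

Lemma scompA f G H : fixes0 G -> fixes0 H ->
  scomp (scomp f G) H = scomp f (smap_comp G H).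
Proof.
move=> G0 H0; apply/funext => Q; pose N := mlen Q.
pose f' := strunc N.+1 f; pose G' := fun s => strunc N.+1 (G s).
pose H' := fun s => strunc N.+1 (H s).
have G'0 : fixes0 G' by exact: fixes0_strunc.
have H'0 : fixes0 H' by exact: fixes0_strunc.
have tE g P : (mlen P <= N)%N -> g P = strunc N.+1 g P by rewrite /strunc ltnS => ->.
transitivity (scomp (scomp f' G') H' Q).
  apply: scomp_agree_deg => // [P PQ|s P PQ]; last exact: tE.
  apply: scomp_agree_deg => // [T TP|s T TP]; apply: tE; exact: leq_trans PQ.
transitivity (scomp f' (smap_comp G' H') Q); last first.
  apply: scomp_agree_deg; [exact: fixes0_comp|exact: fixes0_comp|..].
    by move=> P PQ; symmetry; exact: tE.
  move=> s P PQ; apply: scomp_agree_deg => // [T TP|t T TP]; symmetry; apply: tE.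
    exact: leq_trans PQ.
  exact: leq_trans PQ.
have f'N : ssupp N.+1 f' := @ssupp_strunc _ _ _ _.
have G'N i : ssupp N.+1 (G' i) := @ssupp_strunc _ _ _ _.
have H'N i : ssupp N.+1 (H' i) := @ssupp_strunc _ _ _ _.
(* [N1] bounds the degrees of the truncated series and of their inner compositions at once, as
   [ev_scomp] asks for a common bound. *)
pose N1 := (N * N + N)%N; have NN1 : (N.+1 <= N1.+1)%N by rewrite /N1; lia.
have NNN1 : ((N * N).+1 <= N1.+1)%N by rewrite /N1; lia.
have f'N1 := ssuppW NN1 f'N; have H'N1 i := ssuppW NN1 (H'N i).
have fGN1 := ssuppW NNN1 (ev_scomp 0 G'0 f'N G'N).1.
have GHN1 i := ssuppW NNN1 (ev_scomp 0 H'0 (G'N i) H'N).1.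
have GH0 := fixes0_comp G'0 H'0.
apply: (@ev_inj (N1 * N1 + N1).+1) => [||z].
- by apply: ssuppW (ev_scomp 0 H'0 fGN1 H'N1).1; lia.
- by apply: ssuppW (ev_scomp 0 GH0 f'N1 GHN1).1; lia.
have N1l : (N1 * N1 < (N1 * N1 + N1).+1)%N by lia.
have N1l' : (N1 < (N1 * N1 + N1).+1)%N by lia.
rewrite (ev_scomp z H'0 fGN1 H'N1).2// (ev_scomp z GH0 f'N1 GHN1).2//.
have N1m : (N * N < N1.+1)%N by rewrite /N1; lia.
have N1m' : (N < N1.+1)%N by rewrite /N1; lia.
rewrite (ev_scomp _ G'0 f'N G'N).2// (ev_widen _ f'N)//; congr ev.
apply/matrixP => i j; rewrite !mxE (ev_scomp _ H'0 (G'N i) H'N).2//; congr ev.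
by apply/matrixP => k l; rewrite !mxE (ev_widen _ (H'N k)).
Qed.

Lemma ssupp_lin (A : 'M[Cplx R]_n) s : ssupp 2 (smap_lin A s).
Proof.
move=> Q Q2; rewrite /smap_lin big1// => j _; case: eqP => [e|_]; last by rewrite mulr0.
by rewrite e mlen_unit in Q2.
Qed.

Lemma ev_lin N (A : 'M[Cplx R]_n) s z : (1 < N)%N ->
  ev N (smap_lin A s) z = \sum_j A s j * z j 0.
Proof.
move=> N1; rewrite /ev /smap_lin; under eq_bigr do rewrite mulr_suml.
rewrite exchange_big/=; apply: eq_bigr => j _.
rewrite (bigD1_seq (midx_unit j)) ?uniq_mbox ?mlen_mbox ?mlen_unit//=.
rewrite eqxx mulr1 monom_unit big1 ?addr0// => Q /negPf ->.
by rewrite mulr0 mul0r.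
Qed.

Lemma spow_unit G j : fixes0 G -> spow G (midx_unit j) = G j.
Proof.
move=> G0; apply/funext => Q; pose N := mlen Q.
pose G' := fun s => strunc N.+1 (G s).
have G'N i : ssupp N.+1 (G' i) := @ssupp_strunc _ _ _ _.
have G'0 : fixes0 G' by exact: fixes0_strunc.
transitivity (spow G' (midx_unit j) Q).
  apply: (@spow_agree _ _ xpredT N.+1) => //; last by rewrite mlen_unit; lia.
  by move=> s T _ TN; rewrite /G' /strunc TN.
transitivity (G' j Q); last by rewrite /G' /strunc ltnS leqnn.
have [sG eG] := ev_spow (midx_unit j) 0 G'N; rewrite mlen_unit mul1n in sG eG.
apply: (@ev_inj N.+1) => // z.
have [_ ->] := ev_spow (midx_unit j) z G'N; rewrite ?mlen_unit ?mul1n//.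
by rewrite monom_unit mxE.
Qed.

Lemma scomp_lin (A : 'M[Cplx R]_n) s G Q : fixes0 G ->
  scomp (smap_lin A s) G Q = \sum_j A s j * G j Q.
Proof.
move=> G0; rewrite (@scompE _ _ (mlen Q).+2)// /smap_lin.
under eq_bigr do rewrite mulr_suml.
rewrite exchange_big/=; apply: eq_bigr => j _.
rewrite (bigD1_seq (midx_unit j)) ?uniq_mbox ?mlen_mbox ?mlen_unit//=.
rewrite eqxx mulr1 spow_unit// big1 ?addr0// => P /negPf ->.
by rewrite mulr0 mul0r.
Qed.

Lemma scomp_diag f (mu : 'rV[Cplx R]_n) Q :
  scomp f (smap_lin (diag_mx mu)) Q = eigpow mu Q * f Q.
Proof.
pose N := (mlen Q).+1; pose f' := strunc N.+1 f; pose L := smap_lin (diag_mx mu).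
have f'N : ssupp N.+1 f' := @ssupp_strunc _ _ _ _.
have L0 : fixes0 L by exact: fixes0_lin.
have LN i : ssupp N.+1 (L i) by apply: ssuppW (@ssupp_lin _ _).
have tE P : (mlen P <= mlen Q)%N -> f P = f' P by rewrite /f' /strunc /N ltnS => /leqW ->.
rewrite (@scomp_agree_deg _ _ _ f' L L)// tE//.
apply: (@ev_inj (N * N + N).+1 (scomp f' L) (fun Q => eigpow mu Q * f' Q)).
- by apply: ssuppW (ev_scomp 0 L0 f'N LN).1; lia.
- by move=> P PN; rewrite f'N ?mulr0//; lia.
move=> z; rewrite (ev_scomp _ L0 f'N LN).2; [|by lia|by lia].
have -> : \col_i ev N.+1 (L i) z = \col_i (mu 0 i * z i 0).
  apply/matrixP => i j; rewrite !mxE /L ev_lin// (bigD1 i)//= big1 => [|k /negPf ki].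
    by rewrite addr0 mxE eqxx mulr1n.
  by rewrite mxE eq_sym ki mulr0n mul0r.
rewrite -[LHS](ev_widen (N' := (N * N + N).+1) _ f'N); last by lia.
rewrite /ev; apply: eq_bigr => P _; rewrite mulrAC [RHS]mulrC; congr (_ * _).
rewrite /eigpow /monom -big_split; apply: eq_bigr => i _ /=.
by rewrite mxE exprMn.
Qed.

Lemma scomp_id f : scomp f (@smap_id R n) = f.
Proof.
apply/funext => Q; rewrite /smap_id -[1%:M]diag_const_mx scomp_diag /eigpow.
by rewrite big1 ?mul1r// => i _; rewrite mxE expr1n.
Qed.

Lemma scompD f g G Q :
  scomp (fun P => f P + g P) G Q = scomp f G Q + scomp g G Q.
Proof. by rewrite /scomp -big_split; apply: eq_bigr => P _; rewrite mulrDl. Qed.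

End CompositionAlgebra.

(** * Majorants *)

Ltac nneg := repeat first
  [ assumption | done | (apply: exprn_ge0) | (apply: divr_ge0)
  | (apply: mulr_ge0) | (rewrite invr_ge0) | (apply: ltW; assumption)
  | (apply: ltW; done) ].

Section Majorants.
Variables (R : realType) (n : nat).
Implicit Types (f g : fps R n) (G H : smap R n) (P Q : midx n) (K A x y : R).

(** The convolution of this weight with itself is at most [8 ^+ n] times the weight, so bounds
    carrying it survive products of any number of series without a change of the geometric rate. *)
Definition vweight Q : R := \prod_i (Q i).+1%:R ^- 2.

Lemma vweight_gt0 Q : 0 < vweight Q.
Proof. by apply: prodr_gt0 => i _; rewrite invr_gt0 exprn_gt0. Qed.

Lemma vweight_le1 Q : vweight Q <= 1.
Proof.
apply: prodr_ile1 => i _; rewrite invr_ge0 exprn_ge0//=.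
by rewrite invf_le1 ?exprn_gt0// exprn_ege1// ler1n.
Qed.

Lemma vweight_ge Q : 4 ^- mlen Q <= vweight Q.
Proof.
rewrite /mlen -prodrXr -prodfV; apply: ler_prod => i _.
rewrite invr_ge0 exprn_ge0//= lef_pV2 ?posrE ?exprn_gt0//.
rewrite (_ : 4 = 2 ^+ 2 :> R) -?exprM ?[(2 * _)%N]mulnC ?exprM; last by rewrite -natrX.
by rewrite lerXn2r ?nnegrE// -natrX ler_nat ltn_expl.
Qed.

Lemma sum_inv_sqr N : \sum_(p < N) (p.+1%:R : R) ^- 2 <= 2.
Proof.
(* The correction [N.+1%:R^-1] makes the induction telescope. *)
suff H : \sum_(p < N.+1) (p.+1%:R : R) ^- 2 <= 2 - N.+1%:R^-1.
  apply: le_trans (_ : _ <= 2 - N.+1%:R^-1) _; last by rewrite gerBl.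
  by apply: le_trans H; rewrite big_ord_recr/= lerDl invr_ge0 exprn_ge0.
elim: N => [|N IH]; first by rewrite big_ord_recr big_ord0 /= add0r expr1n invr1; lra.
rewrite big_ord_recr/=; apply: le_trans (lerD IH (lexx _)) _.
have N0 : (0 : R) < N.+1%:R by [].
rewrite -[N.+2]addn1 natrD; set a : R := N.+1%:R in N0 *.
rewrite -subr_ge0.
have -> : 2 - (a + 1%:R)^-1 - (2 - a^-1 + (a + 1%:R) ^- 2) =
    a^-1 * (a + 1) ^- 2.
  by field; rewrite !gt_eqF//; lra.
by rewrite mulr_ge0 ?invr_ge0 ?exprn_ge0//; lra.
Qed.

(* The terms are bounded via [(a + b)^2 <= 2 (a^2 + b^2)] with [a + b = q + 2]. *)
Lemma conv_inv_sqr N q : (q < N)%N ->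
  \sum_(p < N | (p <= q)%N) (p.+1%:R : R) ^- 2 * (q - p).+1%:R ^- 2
  <= 8 * q.+1%:R ^- 2.
Proof.
move=> qN; pose F p : R := (p.+1%:R : R) ^- 2 * (q - p).+1%:R ^- 2.
rewrite -(big_ord_widen_cond N xpredT F qN).
apply: (@le_trans _ _ (\sum_(p < q.+1)
    2 * q.+1%:R ^- 2 * ((p.+1%:R : R) ^- 2 + (q - p).+1%:R ^- 2))).
  apply: ler_sum => p _; rewrite /F.
  have e : q.+1%:R + 1 = p.+1%:R + (q - p).+1%:R :> R.
    by rewrite -!natrD -[1]/(1%:R) -natrD; congr _%:R; have := ltn_ord p; lia.
  have a0 : (0 : R) < p.+1%:R by []. have b0 : (0 : R) < (q - p).+1%:R by [].
  have c0 : (0 : R) < q.+1%:R by [].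
  move: e a0 b0 c0; set a : R := p.+1%:R; set b : R := (q - p).+1%:R.
  set c : R := q.+1%:R => e a0 b0 c0.
  rewrite -subr_ge0.
  have -> : 2 * c ^- 2 * (a ^- 2 + b ^- 2) - a ^- 2 * b ^- 2 =
      (2 * (a ^+ 2 + b ^+ 2) - c ^+ 2) * ((a ^- 2 * b ^- 2) * c ^- 2).
    by field; rewrite !gt_eqF.
  rewrite mulr_ge0//.
    rewrite (_ : _ - _ = (a - b) ^+ 2 + 2 * c + 1); last first.
      by rewrite (_ : c = a + b - 1); [ring|lra].
    by have := sqr_ge0 (a - b); lra.
  by rewrite !mulr_ge0// invr_ge0 exprn_ge0// ltW.
rewrite -mulr_sumr big_split/=.
have S1 := sum_inv_sqr q.+1.
have S2 : \sum_(p < q.+1) (q - p).+1%:R ^- 2 <= 2 :> R.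
  rewrite (reindex_inj rev_ord_inj)/=; apply: le_trans S1; apply: ler_sum => p _.
  by rewrite subSS subKn// -ltnS.
have q0 : (0 : R) <= q.+1%:R ^- 2 by rewrite invr_ge0 exprn_ge0.
rewrite (_ : 8 * _ = 2 * q.+1%:R ^- 2 * (2 + 2)); last by ring.
by rewrite ler_wpM2l ?mulr_ge0// lerD.
Qed.

Lemma vweight_conv N Q : Q \in mbox n N ->
  \sum_(P <- mbox n N | mle P Q) vweight P * vweight (msub Q P)
  <= 8 ^+ n * vweight Q.
Proof.
rewrite mem_mbox => /forallP QN.
rewrite -(@big_box n _ _ (fun P => mle P Q) (fun P => vweight P * vweight (msub Q P))).
under eq_bigr => b _.
  rewrite -big_split/=.
  under eq_bigr => i _ do rewrite !ffunE.
  over.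
rewrite /=.
pose F i (p : 'I_N) : R := (p.+1%:R : R) ^- 2 * (Q i - p).+1%:R ^- 2.
rewrite (eq_bigl (fun b => b \in family (fun i (p : 'I_N) => (p <= Q i)%N))); last first.
  by move=> b; apply: eq_forallb => i; rewrite ffunE.
rewrite -(bigA_distr_big_dep (fun i (p : 'I_N) => (p <= Q i)%N) F).
have -> : 8 ^+ n * vweight Q = \prod_i (8 * (Q i).+1%:R ^- 2).
  by rewrite big_split/= prodr_const card_ord.
apply: ler_prod => i _; rewrite conv_inv_sqr// andbT sumr_ge0// => p _.
by rewrite mulr_ge0 ?invr_ge0 ?exprn_ge0.
Qed.

Lemma sum_half N : \sum_(p < N) (2^-1 : R) ^+ p <= 2.
Proof.
suff -> : \sum_(p < N) (2^-1 : R) ^+ p = 2 - 2 * 2^-1 ^+ N.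
  by rewrite gerBl mulr_ge0// exprn_ge0// invr_ge0.
elim: N => [|N IH]; first by rewrite big_ord0 expr0; lra.
by rewrite big_ord_recr/= IH exprS; field.
Qed.

(** Split [x] as [(2 * x) / 2]: since [2 * x <= 1], the first factor yields [(2 * x) ^+ k], and the
    powers of [2^-1] sum to at most [2 ^+ n]. *)
Lemma geometric_tail N k x : 0 <= x -> x <= 2^-1 ->
  \sum_(Q <- mbox n N | (k <= mlen Q)%N) x ^+ mlen Q <= (2 * x) ^+ k * 2 ^+ n.
Proof.
move=> x0 x2; apply: (@le_trans _ _ (\sum_(Q <- mbox n N) (2 * x) ^+ k * 2^-1 ^+ mlen Q)).
  rewrite [leRHS](bigID (fun Q => (k <= mlen Q)%N))/= -[leLHS]addr0 lerD//; last first.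
    by apply: sumr_ge0 => Q _; rewrite mulr_ge0 ?exprn_ge0 ?mulr_ge0// invr_ge0.
  apply: ler_sum => Q kQ.
  have -> : x ^+ mlen Q = (2 * x) ^+ mlen Q * 2^-1 ^+ mlen Q.
    by rewrite -exprMn mulrAC mulfV ?mul1r.
  apply: ler_wpM2r; first by rewrite exprn_ge0// invr_ge0.
  by apply: ler_wiXn2l => //; lra.
rewrite -mulr_sumr ler_wpM2l ?exprn_ge0 ?mulr_ge0//.
rewrite -(@big_box n _ _ xpredT (fun Q => 2^-1 ^+ mlen Q)).
under eq_bigr => b _.
  rewrite /mlen -prodrXr.
  under eq_bigr => i _ do rewrite !ffunE.
  over.
rewrite -(bigA_distr_bigA (fun (i : 'I_n) (p : 'I_N) => (2^-1 : R) ^+ p)).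
rewrite prodr_const card_ord lerXn2r ?nnegrE ?sum_half//.
by apply: sumr_ge0 => p _; rewrite exprn_ge0// invr_ge0.
Qed.

(* The weight [w] is meant to absorb small divisors: [d Q] bounds the divisors at
   [Q] from below, and [w] is supermultiplicative with a gain of [1 / d]. *)
Section PowerBound.
Variables (U : pred (midx n)) (w d : midx n -> R) (tau : R).
Hypothesis Udown : forall P Q, mle P Q -> U Q -> U P.
Hypothesis w_ge0 : forall P, 0 <= w P.
Hypothesis d01 : forall P, 0 <= d P <= 1.
Hypothesis w_superM : forall P Q, P != 0 -> Q != 0 -> U (P + Q) ->
  w P * w Q <= d (P + Q) * w (P + Q).
Hypothesis tau_ge0 : 0 <= tau.

Definition majorant Q := w Q * tau ^+ mlen Q * vweight Q.

Lemma majorant_ge0 Q : 0 <= majorant Q.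
Proof. by apply: mulr_ge0; [nneg|exact/ltW/vweight_gt0]. Qed.

(** Only a product of at least two factors gains [d Q], the factor that will cancel a small
    divisor. *)
Let dk k Q := if (1 < k)%N then d Q else 1.

(** Division by [8 ^+ n] compensates the convolution constant, so that the bounds for [k] and [l]
    multiply to the one for [k + l]. The empty product has a constant term and is kept apart; for
    the others, order 1 removes the terms of a convolution with an index 0, where [w_superM] says
    nothing. *)
Let bounded x k f := if k is 0 then f = smonom R 0 else
  sorder 1 f /\ forall Q, U Q ->
    cmod (f Q) <= x ^+ k / 8 ^+ n * (dk k Q * majorant Q).

Lemma bounded_smul x k l f g : 0 <= x ->
  bounded x k f -> bounded x l g -> bounded x (k + l) (smul f g).
Proof.
move=> x0; case: k => [->|k]; first by rewrite smul1.
case: l => [fk ->|l [f0 fB] [g0 gB]]; first by rewrite smulC smul1 addn0.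
rewrite addSn addnS; split=> [|Q UQ].
  by move=> Q Q1; apply: (sorder_smul f0 g0); rewrite ltnW.
rewrite (_ : dk _ _ = d Q)// smul_mem; apply: le_trans (cmod_sum _ _ _) _.
have C0 : (0 : R) < 8 ^+ n by rewrite exprn_gt0.
have dk01 j P : 0 <= dk j P <= 1 by rewrite /dk; case: ifP; rewrite ?d01 ?ler01 ?lexx.
have /andP[dQ0 dQ1] := d01 Q; have wQ0 := w_ge0 Q.
have c0 : 0 <= x ^+ (k + l).+2 / (8 ^+ n * 8 ^+ n) * (d Q * (w Q * tau ^+ mlen Q)).
  by nneg.
have := ler_wpM2l c0 (@vweight_conv (mlen Q).+1 Q (mlen_mbox (leqnn _))).
rewrite (_ : _ * (8 ^+ n * _) = x ^+ (k + l).+2 / 8 ^+ n * (d Q * majorant Q)); last first.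
  by rewrite /majorant; field; rewrite gt_eqF.
apply: le_trans; rewrite mulr_sumr; apply: ler_sum => P PQ; rewrite cmodM.
have v0 P' : 0 <= vweight P' by exact/ltW/vweight_gt0.
have c0v P' : 0 <= x ^+ (k + l).+2 / (8 ^+ n * 8 ^+ n) * (d Q * (w Q * tau ^+ mlen Q)) *
    (vweight P' * vweight (msub Q P')) by apply: mulr_ge0 => //; apply: mulr_ge0.
have [->|P0] := eqVneq P 0.
  by rewrite f0 ?mlen0// cmod0 mul0r c0v.
have [s0|s0] := eqVneq (msub Q P) 0.
  by rewrite [in g _]s0 g0 ?mlen0// cmod0 mulr0 c0v.
have UP := Udown PQ UQ; have UQP := Udown (mle_msub P Q) UQ.
apply: le_trans (ler_pM (cmod_ge0 _) (cmod_ge0 _) (fB _ UP) (gB _ UQP)) _.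
have Hw := w_superM P0 s0; rewrite msubKC// in Hw; have {}Hw := Hw UQ.
have t0 (j : nat) : 0 <= tau ^+ j by rewrite exprn_ge0.
rewrite [leLHS](_ : _ = x ^+ (k + l).+2 / (8 ^+ n * 8 ^+ n) * (tau ^+ mlen Q) *
   (vweight P * vweight (msub Q P)) * ((dk k.+1 P * dk l.+1 (msub Q P)) * (w P * w (msub Q P)))); last first.
  rewrite /majorant -(mlen_msub PQ) exprD -addSn -addnS exprD; field.
  by rewrite gt_eqF.
rewrite [leRHS](_ : _ = x ^+ (k + l).+2 / (8 ^+ n * 8 ^+ n) * (tau ^+ mlen Q) *
   (vweight P * vweight (msub Q P)) * (d Q * w Q)); last by ring.
apply: ler_wpM2l.
  by have vP := v0 P; have vQP := v0 (msub Q P); nneg.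
apply: le_trans Hw; rewrite ler_piMl ?mulr_ge0//.
have /andP[? ?] := dk01 k.+1 P; have /andP[? ?] := dk01 l.+1 (msub Q P).
exact: mulr_ile1.
Qed.

Lemma spow_bound x G P Q : 0 <= x -> fixes0 G ->
  (forall s T, U T -> cmod (G s T) <= x / 8 ^+ n * majorant T) ->
  P != 0 -> U Q ->
  cmod (spow G P Q) <=
    x ^+ mlen P / 8 ^+ n * ((if (1 < mlen P)%N then d Q else 1) * majorant Q).
Proof.
move=> x0 /sorder_fixes0 G0 GB P0 UQ.
have : bounded x (mlen P) (spow G P).
  apply: (@spow_ind _ _ (bounded x)) => // [i|k l f g]; last exact: bounded_smul.
  by split=> // T UT; rewrite expr1 /dk /= mul1r; exact: GB.
rewrite /bounded; move: P0; rewrite -mlen_eq0.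
by case: (mlen P) => // k _ [_]; exact.
Qed.

(** A power with exponent [P] contributes [(A * x) ^+ mlen P], so the sum is a geometric tail. For
    [k = 2] the bound is quadratic in [x] and carries the gain [d Q]; the case [k = 1] serves for
    plain convergence. *)
Lemma scomp_bound x K A k f G Q : 0 <= x -> 0 <= K -> 0 <= A -> A * x <= 2^-1 ->
  (0 < k)%N -> sorder k f ->
  fixes0 G ->
  (forall s T, U T -> cmod (G s T) <= x / 8 ^+ n * majorant T) ->
  (forall P, cmod (f P) <= K * A ^+ mlen P) -> U Q ->
  cmod (scomp f G Q) <= K * (2 * (A * x)) ^+ k * 2 ^+ n / 8 ^+ n *
    ((if (1 < k)%N then d Q else 1) * majorant Q).
Proof.
move=> x0 K0 A0 Ax k0 fk G0 GB fB UQ; rewrite (@scompE _ _ (mlen Q).+1)//.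
apply: le_trans (cmod_sum _ _ _) _.
have [dQ0 dQ1] := andP (d01 Q); have m0 := majorant_ge0 Q.
have := geometric_tail (mlen Q).+1 k (mulr_ge0 A0 x0) Ax.
set D := (if _ then _ else _).
have D0 : 0 <= D * majorant Q by rewrite mulr_ge0// /D; case: ifP.
have C0 : (0 : R) < 8 ^+ n by rewrite exprn_gt0.
have KD0 : 0 <= K / 8 ^+ n * (D * majorant Q) 
  by apply: mulr_ge0 => //; nneg.
move=> /(ler_wpM2l KD0).
rewrite (_ : _ * (_ * 2 ^+ n) = K * (2 * (A * x)) ^+ k * 2 ^+ n / 8 ^+ n * (D * majorant Q)); last by ring.
apply: le_trans; rewrite mulr_sumr (bigID (fun P => (k <= mlen P)%N))/=.
rewrite [X in _ + X]big1 ?addr0; last first.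
  by move=> P; rewrite -ltnNge => /fk ->; rewrite mul0r cmod0.
apply: ler_sum => P kP; rewrite cmodM.
have P0 : P != 0 by rewrite -mlen_eq0 -lt0n (leq_trans k0).
apply: le_trans (ler_pM (cmod_ge0 _) (cmod_ge0 _) (fB P) (spow_bound x0 G0 GB P0 UQ)) _.
rewrite [leLHS](_ : _ = K / 8 ^+ n * (A * x) ^+ mlen P *
  ((if (1 < mlen P)%N then d Q else 1) * majorant Q)); last by rewrite exprMn; ring.
rewrite [leLHS]mulrAC; apply: ler_wpM2r; first by nneg.
apply: ler_wpM2l; first by nneg.
apply: ler_wpM2r => //; rewrite /D.
case: (ltnP 1 k) => k1; first by rewrite (leq_trans k1).
by case: ifP.
Qed.

End PowerBound.

End Majorants.

(** * Convergent series, their products and compositions *)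

Section BoundedSeries.
Variables (R : realType) (n : nat).
Implicit Types (f g : fps R n) (G H : smap R n) (P Q : midx n) (K A x y : R).

Definition sbound f :=
  exists K A : R, [/\ 0 < K, 0 < A & forall Q, cmod (f Q) <= K * A ^+ mlen Q].

Lemma bound_weaken (K K' A A' : R) f : 0 <= K -> 0 <= A -> K <= K' -> A <= A' ->
  (forall Q, cmod (f Q) <= K * A ^+ mlen Q) ->
  forall Q, cmod (f Q) <= K' * A' ^+ mlen Q.
Proof.
move=> K0 A0 KK' AA' fB Q; apply: le_trans (fB Q) _.
apply: ler_pM => //; first exact: exprn_ge0.
by apply: lerXn2r => //; rewrite nnegrE// (le_trans A0).
Qed.

Lemma sbound_uniform (I : finType) (F : I -> fps R n) : (forall s, sbound (F s)) ->
  exists K A : R, [/\ 0 < K, 0 < A &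
    forall s Q, cmod (F s Q) <= K * A ^+ mlen Q].
Proof.
move=> /choice[K /choice[A FB]].
have K0 s : 0 < K s by have [] := FB s.
have A0 s : 0 < A s by have [] := FB s.
exists (1 + \sum_s K s), (1 + \sum_s A s); split.
- by rewrite ltr_pwDl// sumr_ge0// => s _; exact: ltW.
- by rewrite ltr_pwDl// sumr_ge0// => s _; exact: ltW.
move=> s; apply: (@bound_weaken (K s) _ (A s)); last by have [] := FB s.
- exact: ltW.
- exact: ltW.
- rewrite (bigD1 s)//= addrCA lerDl addr_ge0// sumr_ge0// => i _; exact: ltW.
- rewrite (bigD1 s)//= addrCA lerDl addr_ge0// sumr_ge0// => i _; exact: ltW.
Qed.

(** With trivial weights the majorants measure plain convergence. *)
Let one (Q : midx n) : R := 1.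

Lemma majorant1E tau Q : majorant one tau Q = tau ^+ mlen Q * vweight R Q.
Proof. by rewrite /majorant mul1r. Qed.

Lemma majorize K A y : 0 < K -> 0 < A -> 0 < y -> exists2 tau : R, 0 < tau &
  forall f, f 0 = 0 -> (forall Q, cmod (f Q) <= K * A ^+ mlen Q) ->
  forall Q, cmod (f Q) <= y * majorant one tau Q.
Proof.
move=> K0 A0 y0.
(* The factor 4 pays for the lower bound [vweight_ge]; [1 + K / y], raised to a power at least 1
   because [f 0 = 0], turns the constant [K] into [y]. *)
have t0 : 0 < 4 * (A * (1 + K / y)).
  by rewrite !mulr_gt0// ltr_pwDl// divr_ge0// ltW.
exists (4 * (A * (1 + K / y))) => // f f0 fB Q.
have [->|Q0] := eqVneq Q 0.
  by rewrite f0 cmod0 mulr_ge0 ?ltW// majorant1E mulr_gt0 ?vweight_gt0 ?exprn_gt0.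
apply: le_trans (fB Q) _; rewrite majorant1E exprMn.
have v4 := vweight_ge R Q.
apply: (@le_trans _ _ (y * (A * (1 + K / y)) ^+ mlen Q)); last first.
  rewrite ler_pM2l// mulrAC -[leLHS]mul1r ler_wpM2r//.
    by rewrite exprn_ge0// mulr_ge0 ?ltW// ltr_pwDl// divr_ge0// ltW.
  have p4 : (0 : R) < 4 ^+ mlen Q by rewrite exprn_gt0.
  by rewrite -[leLHS](mulfV (lt0r_neq0 p4)) ler_pM2l.
rewrite exprMn mulrCA [leLHS]mulrC ler_pM2l ?exprn_gt0//.
have Ky : 0 <= K / y by rewrite divr_ge0 ?ltW.
apply: (@le_trans _ _ (y * (1 + K / y))).
  by rewrite mulrDr mulr1 mulrCA mulfV ?gt_eqF// mulr1 lerDr ltW.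
rewrite ler_pM2l// -[leLHS]expr1; apply: ler_weXn2l; first by rewrite lerDl.
by rewrite lt0n mlen_eq0.
Qed.

Lemma sbound_majorant f y tau : 0 < y -> 0 < tau ->
  (forall Q, cmod (f Q) <= y * majorant one tau Q) -> sbound f.
Proof.
move=> y0 t0 fB; exists y, tau; split=> // Q; apply: le_trans (fB Q) _.
rewrite majorant1E ler_pM2l// -[leRHS]mulr1 ler_pM2l ?exprn_gt0//.
exact: vweight_le1.
Qed.

Lemma one_superM P Q : P != 0 -> Q != 0 -> xpredT (P + Q) ->
  one P * one Q <= one (P + Q) * one (P + Q).
Proof. by []. Qed.

Lemma contraction_radius K A : 0 < K -> 0 < A -> exists x : R,
  [/\ 0 < x, A * x <= 2^-1 & K * (2 * (A * x)) ^+ 2 * 2 ^+ n <= x].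
Proof.
move=> K0 A0; have n0 : (0 : R) < 2 ^+ n by rewrite exprn_gt0.
(* The quadratic term equals [B * x ^+ 2], so [x <= B^-1] suffices for it, and [A * x <= 2^-1] asks
   for [x <= (2 * A)^-1]; the inverse of the sum satisfies both. *)
pose B := 4 * (K * A ^+ 2 * 2 ^+ n).
have B0 : 0 < B by rewrite !mulr_gt0// exprn_gt0.
have D0 : 0 < 2 * A + B by lra.
exists (2 * A + B)^-1; split; first by rewrite invr_gt0.
- by rewrite ler_pdivrMr//; lra.
- rewrite -subr_ge0.
  have -> : (2 * A + B)^-1 - K * (2 * (A / (2 * A + B))) ^+ 2 * 2 ^+ n =
     2 * A * (2 * A + B) ^- 2.
    by rewrite /B in D0 *; field; rewrite gt_eqF.
  by rewrite !mulr_ge0 ?invr_ge0 ?exprn_ge0 ?ltW.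
Qed.

Lemma contraction_radius1 K A : 0 < K -> 0 < A -> exists x : R,
  [/\ 0 < x & A * x <= 2^-1].
Proof. by move=> K0 A0; have [x [? ? _]] := contraction_radius K0 A0; exists x. Qed.

(** The constants do not depend on [f] and [G], so a composition and the compositions of all
    truncations share one bound; the convergence of composed germs rests on this. *)
Lemma scomp_uniform_bound K A L B : 0 < K -> 0 < A -> 0 < L -> 0 < B ->
  exists K1 A1 : R, [/\ 0 < K1, 0 < A1 & forall f G, fixes0 G ->
    (forall Q, cmod (f Q) <= K * A ^+ mlen Q) ->
    (forall s Q, cmod (G s Q) <= L * B ^+ mlen Q) ->
    forall Q, cmod (scomp f G Q) <= K1 * A1 ^+ mlen Q].
Proof.
move=> K0 A0 L0 B0; have [x [x0 Ax]] := contraction_radius1 K0 A0.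
have C0 : (0 : R) < 8 ^+ n by rewrite exprn_gt0.
have [tau t0 tauP] := majorize L0 B0 (divr_gt0 x0 C0).
pose c := K * (2 * (A * x)) ^+ 1 * 2 ^+ n / 8 ^+ n.
have c0 : 0 < c by rewrite !mulr_gt0// ?exprn_gt0 ?invr_gt0// !mulr_gt0.
exists (K + c), (1 + tau); split; [exact: addr_gt0|exact: addr_gt0|].
move=> f G G0 fB GB Q.
have Gt s := tauP (G s) (G0 s) (GB s).
(* [scomp_bound] needs a positive order; removing the constant term affects only the coefficient at
   0, treated apart. *)
pose f' Q := if Q == 0 then 0 else f Q.
have f'B P : cmod (f' P) <= K * A ^+ mlen P.
  by rewrite /f'; case: ifP => // _; rewrite cmod0 mulr_ge0 ?exprn_ge0 ?ltW.
have f'1 : sorder 1 f'.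
  by move=> P; rewrite ltnS leqn0 mlen_eq0 /f' => ->.
have fG : Q != 0 -> scomp f G Q = scomp f' G Q.
  move=> Q0; rewrite !(@scompE _ _ (mlen Q).+1)//; apply: eq_bigr => P _; rewrite /f'.
  by case: eqP => // ->; rewrite spow0 /smonom (negPf Q0) !mulr0.
have [->|Q0] := eqVneq Q 0.
  rewrite scomp0// mlen0 mulr1; have := fB 0; rewrite mlen0 mulr1 => /le_trans; apply.
  by rewrite lerDl ltW.
have one01 (P : midx n) : 0 <= one P <= 1 by rewrite /one ler01 lexx.
rewrite fG//; apply: le_trans (@scomp_bound _ _ xpredT one one tau _ _ _ one_superM
  _ x K A 1 f' G Q _ _ _ Ax _ f'1 G0 _ f'B _) _ => //; try exact: ltW.
have v0 := ltW (vweight_gt0 R Q); have t0' := ltW t0; have c0' := ltW c0.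
rewrite /= mul1r -/c majorant1E; apply: ler_pM => //; first by nneg.
  by rewrite lerDr ltW.
apply: (@le_trans _ _ (tau ^+ mlen Q)).
  by rewrite ler_piMr ?vweight_le1//; nneg.
by apply: lerXn2r; rewrite ?nnegrE ?lerDr//; apply: addr_ge0.
Qed.

Lemma sbound_scomp f G : fixes0 G -> sbound f -> (forall s, sbound (G s)) ->
  sbound (scomp f G).
Proof.
move=> G0 [K [A [K0 A0 fB]]] /sbound_uniform[L [B [L0 B0 GB]]].
have [K1 [A1 [K10 A10 H]]] := scomp_uniform_bound K0 A0 L0 B0.
by exists K1, A1; split=> //; exact: H.
Qed.

(** The factor 4 in the new rate pays for inserting [vweight], after which the convolution estimate
    applies. *)
Lemma sbound_smul f g : sbound f -> sbound g -> sbound (smul f g).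
Proof.
move=> [K [A [K0 A0 fB]]] [L [B [L0 B0 gB]]].
pose D := A + B; have D0 : 0 < D by exact: addr_gt0.
have AD : A <= D by rewrite lerDl ltW.
have BD : B <= D by rewrite lerDr ltW.
exists (K * L * 8 ^+ n), (4 * D); split; rewrite ?mulr_gt0 ?exprn_gt0// => Q.
have v4 (P : midx n) : 1 <= 4 ^+ mlen P * vweight R P.
  have p4 : (0 : R) < 4 ^+ mlen P by rewrite exprn_gt0.
  by rewrite -[leLHS](mulfV (lt0r_neq0 p4)) ler_pM2l ?vweight_ge.
have hB h M E (P : midx n) : 0 < M -> 0 < E -> E <= D ->
    (forall Q, cmod (h Q) <= M * E ^+ mlen Q) ->
    cmod (h P) <= M * (4 * D) ^+ mlen P * vweight R P.
  move=> M0 E0 ED /(_ P) /le_trans; apply.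
  rewrite -mulrA ler_pM2l// exprMn mulrAC -[leLHS]mul1r; apply: ler_pM => //.
    by nneg.
  by apply: lerXn2r => //; rewrite nnegrE ltW.
rewrite smul_mem; apply: le_trans (cmod_sum _ _ _) _.
apply: (@le_trans _ _ (K * L * (4 * D) ^+ mlen Q *
    \sum_(P <- mbox n (mlen Q).+1 | mle P Q) vweight R P * vweight R (msub Q P))).
  rewrite mulr_sumr; apply: ler_sum => P PQ; rewrite cmodM.
  apply: le_trans (ler_pM (cmod_ge0 _) (cmod_ge0 _)
    (hB _ _ _ P K0 A0 AD fB) (hB _ _ _ (msub Q P) L0 B0 BD gB)) _.
  by rewrite -(mlen_msub PQ) exprD le_eqVlt; apply/orP; left; apply/eqP; ring.
have c0 : 0 <= K * L * (4 * D) ^+ mlen Q by nneg.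
apply: le_trans (ler_wpM2l c0 (vweight_conv _ (mlen_mbox (leqnn _)))) _.
rewrite [leRHS]mulrAC ler_wpM2l// -[leRHS]mulr1 ler_wpM2l ?vweight_le1//.
Qed.

Lemma sboundD f g : sbound f -> sbound g -> sbound (fun Q => f Q + g Q).
Proof.
move=> [K [A [K0 A0 fB]]] [L [B [L0 B0 gB]]].
exists (K + L), (A + B); split; rewrite ?addr_gt0// => Q.
apply: le_trans (cmodD _ _) _; rewrite mulrDl; apply: lerD.
  by apply: (@bound_weaken K _ A) => //; rewrite ?lerDl; exact: ltW.
by apply: (@bound_weaken L _ B) => //; rewrite ?lerDr; exact: ltW.
Qed.

Lemma sboundZ (a : Cplx R) f : sbound f -> sbound (fun Q => a * f Q).
Proof.
move=> [K [A [K0 A0 fB]]]; exists ((1 + cmod a) * K), A; split=> // [|Q].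
  by rewrite mulr_gt0// ltr_pwDl// cmod_ge0.
rewrite cmodM -mulrA; apply: ler_pM; rewrite ?cmod_ge0//.
by rewrite lerDr.
Qed.

Lemma sbound_supp N f : ssupp N f -> sbound f.
Proof.
move=> fN; exists (1 + \sum_(Q <- mbox n N) cmod (f Q)), 1; split=> // [|Q].
  by rewrite ltr_pwDl// sumr_ge0// => Q _; exact: cmod_ge0.
rewrite expr1n mulr1; have S0 (r : seq (midx n)) (A : pred (midx n)) : 0 <= \sum_(P <- r | A P) cmod (f P).
  by apply: sumr_ge0 => P _; exact: cmod_ge0.
have [NQ|QN] := leqP N (mlen Q); first by rewrite fN// cmod0 addr_ge0.
rewrite (bigD1_seq Q) ?uniq_mbox ?mlen_mbox//= addrCA lerDl addr_ge0//.
Qed.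

Lemma sbound_lin (B : 'M[Cplx R]_n) s : sbound (smap_lin B s).
Proof. exact: sbound_supp (@ssupp_lin _ _ _ _). Qed.

Lemma sbound_smonom Q : sbound (smonom R Q).
Proof.
apply: (@sbound_supp (mlen Q).+1) => P PQ; rewrite /smonom; case: eqP => // PQ'.
by rewrite PQ' ltnn in PQ.
Qed.

Lemma smap_idE s Q : @smap_id R n s Q = (Q == midx_unit s)%:R.
Proof.
rewrite /smap_id /smap_lin (bigD1 s)//= mxE eqxx mul1r big1 ?addr0// => j /negPf js.
by rewrite mxE eq_sym js mul0r.
Qed.

Lemma smap_id_bound (w : midx n -> R) y tau s Q : 0 < y -> 4 / y <= tau ->
  (forall P, 1 <= w P) ->
  cmod (@smap_id R n s Q) <= y * majorant w tau Q.
Proof.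
move=> y0 ty w1; have w0 P : 0 <= w P by exact: le_trans (w1 P).
have t0 : 0 <= tau by apply: le_trans ty; rewrite divr_ge0// ltW.
rewrite smap_idE; case: eqP => [->|_]; last first.
  by rewrite cmod0 mulr_ge0 ?majorant_ge0// ltW.
rewrite cmod1 /majorant mlen_unit expr1.
have := @vweight_ge R n (midx_unit s); rewrite mlen_unit expr1 => v4.
have : 1 * (4 / y) * 4^-1 <= w (midx_unit s) * tau * vweight R (midx_unit s).
  have y4 : 0 <= 4 / y by rewrite divr_ge0// ltW.
  by apply: ler_pM => //; [rewrite mul1r|exact: ler_pM].
rewrite mul1r mulrAC mulfV// => /(ler_wpM2l (ltW y0)).
by rewrite mul1r mulfV ?gt_eqF.
Qed.

End BoundedSeries.

(** * Inverse of a map tangent to the identity *)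

Section FormalInverse.
Variables (R : realType) (n : nat).
Implicit Types (phi psi G H : smap R n) (P Q : midx n).

Definition near_id phi : smap R n := fun s Q => @smap_id R n s Q + phi s Q.

Lemma fixes0_id : fixes0 (@smap_id R n).
Proof. exact: fixes0_lin. Qed.

Lemma fixes0_near_id phi : (forall s, sorder 2 (phi s)) -> fixes0 (near_id phi).
Proof. by move=> phi2 s; rewrite /near_id fixes0_id add0r phi2// mlen0. Qed.

Lemma sorder_scomp k (f : fps R n) G : fixes0 G -> sorder k f -> sorder k (scomp f G).
Proof.
move=> G0 fk Q Qk; rewrite (@scompE _ _ (mlen Q).+1)// big1// => P _.
have [Pk|Pk] := ltnP (mlen P) k; first by rewrite fk ?mul0r.
by rewrite sorder_spow ?mulr0// (leq_trans Qk).
Qed.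

Lemma sbound_near_id phi s : sbound (phi s) -> sbound (near_id phi s).
Proof. by move=> pB; apply: sboundD => //; exact: sbound_lin. Qed.

Lemma scomp_near_id phi s G Q : fixes0 G ->
  scomp (near_id phi s) G Q = G s Q + scomp (phi s) G Q.
Proof.
move=> G0; rewrite scompD scomp_lin// (bigD1 s)//= mxE eqxx mul1r big1 ?addr0// => j /negPf js.
by rewrite mxE eq_sym js mul0r.
Qed.

(** The inverse is the fixed point of [T]. Since [phi] has order 2, each iteration settles one more
    degree, which gives the formal limit [Y]. With the radius of [contraction_radius], [T] also
    preserves a ball of majorized series, which gives convergence. *)
Lemma right_inverse phi : (forall s, sorder 2 (phi s)) ->
  exists psi, [/\ forall s, sorder 2 (psi s),
    smap_comp (near_id phi) (near_id psi) = @smap_id R n &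
    (forall s, sbound (phi s)) -> forall s, sbound (psi s)].
Proof.
move=> phi2; pose T G : smap R n := fun s Q => @smap_id R n s Q - scomp (phi s) G Q.
pose X k := iter k T (@smap_id R n).
have X0 k : fixes0 (X k).
  elim: k => [|k IH]; first exact: fixes0_id.
  by move=> s; rewrite /= /T fixes0_id scomp0// phi2 ?mlen0// subr0.
have XS k : forall s Q, (mlen Q < k.+2)%N -> X k.+1 s Q = X k s Q.
  elim: k => [|k IH] s Q Qk.
    by rewrite /= /T (sorder_scomp fixes0_id (phi2 s)) ?subr0.
  have Xk := X0 k; have Xk1 : fixes0 (T (X k)) := X0 k.+1.
  rewrite /= -/(T (X k)) /T -/(T _); congr (_ - _); rewrite !(@scompE _ _ (mlen Q).+1)//.
  apply: eq_bigr => P _; have [P2|P2] := ltnP (mlen P) 2; first by rewrite phi2 ?mul0r.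
  congr (_ * _); apply: (@spow_agree _ _ xpredT k.+2); [by []|exact: (X0 k.+1)|exact: X0|..] => //.
    by move=> t S _; exact: IH.
  by apply/orP; left; lia.
(* The coefficient at [Q] is stationary from iteration [mlen Q] on. *)
pose Y : smap R n := fun s Q => X (mlen Q) s Q.
have XY k s Q : (mlen Q <= k)%N -> X k s Q = Y s Q.
  elim: k => [|k IH]; first by rewrite leqn0 /Y => /eqP ->.
  rewrite leq_eqVlt => /orP[/eqP <-//|Qk]; rewrite XS ?IH//; lia.
have Y0 : fixes0 Y by move=> s; rewrite /Y X0.
have YT s Q : Y s Q = @smap_id R n s Q - scomp (phi s) Y Q.
  have Xm := X0 (mlen Q).
  rewrite -(XY (mlen Q).+1)//; congr (_ - _); apply: scomp_agree_deg => //.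
  by move=> t P PQ; rewrite [RHS]/Y [LHS]XY.
pose psi : smap R n := fun s Q => - scomp (phi s) Y Q.
have Ypsi : near_id psi = Y by apply/funext => s; apply/funext => Q; rewrite YT.
exists psi; split.
- by move=> s Q Q2; rewrite /psi (sorder_scomp Y0 (phi2 s)) ?oppr0.
- apply/funext => s; apply/funext => Q; rewrite Ypsi /smap_comp scomp_near_id//.
  by rewrite YT subrK.
move=> /sbound_uniform[K [A [K0 A0 phiB]]].
have [x [x0 Ax Kx]] := contraction_radius n K0 A0.
have C0 : (0 : R) < 8 ^+ n by rewrite exprn_gt0.
have y0 : 0 < x / 8 ^+ n by rewrite divr_gt0.
pose one (Q : midx n) : R := 1; pose tau := 4 / (x / 8 ^+ n).
have t0 : 0 < tau by rewrite divr_gt0.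
have XB k s Q : cmod (X k s Q) <= x / 8 ^+ n * majorant one tau Q.
  elim: k s Q => [|k IH] s Q; first by apply: smap_id_bound => // P; exact: lexx.
  have [Q2|Q2] := ltnP (mlen Q) 2.
    rewrite /= /T (sorder_scomp (X0 k) (phi2 s)) ?subr0//.
    by apply: smap_id_bound => // P; exact: lexx.
  rewrite /= /T smap_idE; case: eqP => [e|_]; first by rewrite e mlen_unit in Q2.
  have one01 (P : midx n) : 0 <= one P <= 1 by rewrite /one ler01 lexx.
  have one0 (P : midx n) : 0 <= one P by rewrite /one ler01.
  rewrite sub0r cmodN; apply: le_trans (@scomp_bound _ _ xpredT one one tau _ one0 one01
    (@one_superM R n) (ltW t0) x K A 2 (phi s) (X k) Q (ltW x0) (ltW K0) (ltW A0) Ax isT (phi2 s) (X0 k)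
    (fun t S _ => IH t S) (phiB s) isT) _; first by [].
  rewrite /= mul1r; apply: ler_wpM2r; first by apply: majorant_ge0 => //; exact: ltW.
  by apply: ler_wpM2r => //; rewrite invr_ge0 ltW.
have YB s : sbound (Y s) by apply: (sbound_majorant y0 t0) => Q; exact: XB.
move=> s; have -> : psi s = fun Q => (-1) * scomp (phi s) Y Q.
  by apply/funext => Q; rewrite mulN1r.
apply: sboundZ; apply: sbound_scomp => //; exists K, A; split=> //.
Qed.

Lemma smap_compA (F G H : smap R n) : fixes0 G -> fixes0 H ->
  smap_comp (smap_comp F G) H = smap_comp F (smap_comp G H).
Proof. by move=> G0 H0; apply/funext => s; exact: scompA. Qed.

Lemma smap_comp_id G : smap_comp G (@smap_id R n) = G.
Proof. by apply/funext => s; exact: scomp_id. Qed.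

Lemma smap_id_comp G : fixes0 G -> smap_comp (@smap_id R n) G = G.
Proof.
move=> G0; apply/funext => s; apply/funext => Q; rewrite /smap_comp scomp_lin//.
rewrite (bigD1 s)//= mxE eqxx mul1r big1 ?addr0// => j /negPf js.
by rewrite mxE eq_sym js mul0r.
Qed.

(** The right inverse has itself a right inverse [near_id chi]; by associativity the latter is
    [near_id phi], so the inverse is two-sided. *)
Lemma formal_inverse phi : (forall s, sorder 2 (phi s)) ->
  exists psi, [/\ forall s, sorder 2 (psi s),
    smap_comp (near_id phi) (near_id psi) = @smap_id R n,
    smap_comp (near_id psi) (near_id phi) = @smap_id R n &
    (forall s, sbound (phi s)) -> forall s, sbound (psi s)].
Proof.
move=> phi2; have [psi [psi2 E1 B]] := right_inverse phi2.
have [chi [chi2 E2 _]] := right_inverse psi2; exists psi; split=> //.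
have F0 := fixes0_near_id phi2; have G0 := fixes0_near_id psi2.
have H0 := fixes0_near_id chi2.
suff -> : near_id phi = near_id chi by [].
by rewrite -[LHS]smap_comp_id -E2 -smap_compA// E1 smap_id_comp.
Qed.

End FormalInverse.

(** * Germs and their Taylor series *)

Section Germs.
Variables (R : realType) (n : nat).
Implicit Types (c d : fps R n) (z w : 'cV[Cplx R]_n).
Implicit Types (f g : 'cV[Cplx R]_n -> Cplx R).

Lemma near0P (A : 'cV[Cplx R]_n -> Prop) :
  (\forall z \near (0 : 'cV[Cplx R]_n), A z) <->
  exists2 r : R, 0 < r & forall z, (forall i, cmod (z i 0) < r) -> A z.
Proof.
split=> [/nbhs_ballP[e /= e0 eA]|[r r0 rA]].
  have eE := cplx_of_realRe (ltW e0).
  exists (complex.Re e) => [|z zr]; first by rewrite -ltr_cplx eE.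
  apply: eA; split=> // i j; rewrite ord1 /ball/= mxE sub0r normrN.
  by rewrite -cmodE -eE ltr_cplx.
apply/nbhs_ballP; exists (cplx_of_real r) => /=; first by rewrite -[0]/(cplx_of_real 0) ltr_cplx.
move=> z [_ zr]; apply: rA => i; have := zr i 0.
by rewrite /ball/= mxE sub0r normrN -cmodE ltr_cplx.
Qed.

Lemma cplx_cvgP (u : nat -> Cplx R) (l : Cplx R) :
  (u @ \oo --> l) <->
  forall e : R, 0 < e -> exists N0, forall N, (N0 <= N)%N -> cmod (u N - l) < e.
Proof.
split=> [/cvgrPdist_lt ul e e0|H].
  have /ul : 0 < cplx_of_real e by rewrite -[0]/(cplx_of_real 0) ltr_cplx.
  by move=> [N0 _ N0P]; exists N0 => N /N0P /=; rewrite -normrN opprB -cmodE ltr_cplx.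
apply/cvgrPdist_lt => e e0; have eE := cplx_of_realRe (ltW e0).
have [|N0 N0P] := H (complex.Re e); first by rewrite -ltr_cplx eE.
by exists N0 => // N /= /N0P; rewrite -normrN opprB -cmodE -{2}eE ltr_cplx.
Qed.

Definition sums c z (l : Cplx R) := forall e : R, 0 < e ->
  exists N0, forall N, (N0 <= N)%N -> cmod (ev N c z - l) < e.

Lemma has_taylorP f c : has_taylor f c <-> sbound c /\
  exists2 r : R, 0 < r & forall z, (forall i, cmod (z i 0) < r) -> sums c z (f z).
Proof.
have sumE N z : \sum_(Q : {ffun 'I_n -> 'I_N}) c (midx_of_box Q) * monom (midx_of_box Q) z
    = ev N c z.
  by rewrite (@big_box n _ _ xpredT (fun Q => c Q * monom Q z)).
split=> [[[r [K [r0 cB]]] /near0P[r' r'0 cS]]|[[K [A [K0 A0 cB]]] [r r0 cS]]].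
  split; last first.
    exists r' => // z zr e e0; have [N0 N0P] := (cplx_cvgP _ _).1 (cS z zr) e e0.
    by exists N0 => N /N0P; rewrite sumE.
  have rE := cplx_of_realRe (ltW r0); set a := complex.Re r in rE.
  have a0 : 0 < a by rewrite -ltr_cplx rE.
  have K0 : 0 <= K.
    by apply: le_trans (cB 0); rewrite mulr_ge0// exprn_ge0// ltW.
  exists (1 + complex.Re K), a^-1; split; rewrite ?invr_gt0//.
    by rewrite ltr_pwDl// -ler_cplx cplx_of_realRe.
  move=> Q; rewrite exprVn ler_pdivlMr ?exprn_gt0//.
  have := cB Q; rewrite -cmodE -rE -cplx_of_realX -cplx_of_realM -(cplx_of_realRe K0).
  by rewrite ler_cplx => /le_trans; apply; rewrite lerDr.
split; last first.
  apply/near0P; exists r => // z zr; apply/cplx_cvgP => e e0.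
  by have [N0 N0P] := cS z zr e e0; exists N0 => N /N0P; rewrite sumE.
exists (cplx_of_real A^-1), (cplx_of_real K); split.
  by rewrite -[0]/(cplx_of_real 0) ltr_cplx invr_gt0.
move=> Q; rewrite -cmodE -cplx_of_realX -cplx_of_realM ler_cplx.
by rewrite exprVn ler_pdivrMr ?exprn_gt0.
Qed.

Lemma has_taylor_eq f g c : has_taylor f c ->
  (\forall z \near (0 : 'cV[Cplx R]_n), f z = g z) -> has_taylor g c.
Proof.
move=> /has_taylorP[cB [r r0 cS]] /near0P[r' r'0 fg]; apply/has_taylorP; split=> //.
exists (Num.min r r') => [|z zr]; first by rewrite lt_min r0.
rewrite -fg => [|i]; [apply: cS => i|]; apply: lt_le_trans (zr i) _.
  by rewrite ge_min lexx.
by rewrite ge_min lexx orbT.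
Qed.

Lemma sums_unique c z l l' : sums c z l -> sums c z l' -> l = l'.
Proof.
move=> cl cl'; apply/eqP; rewrite -subr_eq0 -cmod_eq0; apply/negPn/negP => ll'.
have e0 : 0 < cmod (l - l') / 2 by rewrite divr_gt0// lt_def ll' cmod_ge0.
have [N1 H1] := cl _ e0; have [N2 H2] := cl' _ e0.
have {}H1 := H1 _ (leq_maxl N1 N2); have {}H2 := H2 _ (leq_maxr N1 N2).
set u := ev _ c z in H1 H2.
have := cmodD (l - u) (u - l'); rewrite subrKA cmodB => H3.
by move: H1 H2 H3; rewrite ?(cmodB l u); lra.
Qed.

Lemma monom_bound Q z rho : (forall i, cmod (z i 0) <= rho) ->
  cmod (monom Q z) <= rho ^+ mlen Q.
Proof.
move=> zr; rewrite cmod_prod /mlen -prodrXr; apply: ler_prod => i _.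
rewrite cmod_ge0 cmodX; apply: lerXn2r => //; rewrite ?nnegrE ?cmod_ge0//.
exact: le_trans (cmod_ge0 _) (zr i).
Qed.

Lemma ev_small N0 N d z K A rho : 0 <= K -> 0 <= A -> 0 <= rho -> A * rho <= 2^-1 ->
  (forall i, cmod (z i 0) <= rho) -> sorder N0 d ->
  (forall Q, cmod (d Q) <= K * A ^+ mlen Q) ->
  cmod (ev N d z) <= K * (2 * (A * rho)) ^+ N0 * 2 ^+ n.
Proof.
move=> K0 A0 rho0 Ar zr dN dB; apply: le_trans (cmod_sum _ _ _) _.
have H := ler_wpM2l K0 (@geometric_tail R n N N0 _ (mulr_ge0 A0 rho0) Ar).
rewrite [leRHS]mulrA in H; apply: le_trans H; rewrite mulr_sumr.
rewrite (bigID (fun Q => (N0 <= mlen Q)%N))/= [X in _ + X]big1 ?addr0; last first.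
  by move=> Q; rewrite -ltnNge => /dN ->; rewrite mul0r cmod0.
apply: ler_sum => Q _; rewrite cmodM exprMn mulrA.
by apply: ler_pM; rewrite ?cmod_ge0//; exact: monom_bound.
Qed.

Lemma evB N c d z : ev N (fun Q => c Q - d Q) z = ev N c z - ev N d z.
Proof. by rewrite /ev -sumrB; apply: eq_bigr => Q _; rewrite mulrBl. Qed.

Lemma boundB c d K A L B : 0 <= K -> 0 <= A -> 0 <= L -> 0 <= B ->
  (forall Q, cmod (c Q) <= K * A ^+ mlen Q) ->
  (forall Q, cmod (d Q) <= L * B ^+ mlen Q) ->
  forall Q, cmod (c Q - d Q) <= (K + L) * (A + B) ^+ mlen Q.
Proof.
move=> K0 A0 L0 B0 cB dB Q; apply: le_trans (cmodD _ _) _; rewrite cmodN mulrDl.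
by apply: lerD; [apply: (@bound_weaken _ _ K _ A)|apply: (@bound_weaken _ _ L _ B)];
  rewrite ?lerDl ?lerDr.
Qed.

(** A quarter instead of a half in the condition on [rho] turns the tail [(2 * (A * rho)) ^+ N0]
    into [2^-1 ^+ N0], the rate used for all limits below. *)
Lemma ev_close N0 N c d z K A rho : 0 <= K -> 0 <= A -> 0 <= rho -> A * rho <= 4^-1 ->
  (forall i, cmod (z i 0) <= rho) ->
  (forall Q, (mlen Q < N0)%N -> c Q = d Q) ->
  (forall Q, cmod (c Q) <= K * A ^+ mlen Q) ->
  (forall Q, cmod (d Q) <= K * A ^+ mlen Q) ->
  cmod (ev N c z - ev N d z) <= 2 * K * 2 ^+ n * 2^-1 ^+ N0.
Proof.
move=> K0 A0 rho0 Ar zr cd cB dB; rewrite -evB.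
have := @ev_small N0 N (fun Q => c Q - d Q) z (2 * K) A rho.
rewrite mulr_ge0// => /(_ isT A0 rho0 _ zr _ _)/le_trans; apply.
- by apply: le_trans Ar _; lra.
- by move=> Q QN; rewrite cd// subrr.
- move=> Q; apply: le_trans (cmodD _ _) _; rewrite cmodN -mulrA mulr2n mulrDl mul1r.
  by apply: lerD.
rewrite mulrAC; apply: ler_wpM2l; first by nneg.
by apply: lerXn2r; rewrite ?nnegrE ?invr_ge0//; [nneg|lra].
Qed.

Lemma small_half (C e : R) : 0 <= C -> 0 < e -> exists N, C * 2^-1 ^+ N < e.
Proof.
move=> C0 e0; exists (Num.truncn (C / e)).+1.
rewrite exprVn ltr_pdivrMr ?exprn_gt0// -ltr_pdivrMl// mulrC.
apply: lt_trans (_ : (Num.truncn (C / e)).+1%:R < _); first exact: truncnS_gt.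
by rewrite -natrX ltr_nat ltn_expl.
Qed.

Lemma sums_trunc N c z l K A rho : 0 <= K -> 0 <= A -> 0 <= rho -> A * rho <= 4^-1 ->
  (forall i, cmod (z i 0) <= rho) -> (forall Q, cmod (c Q) <= K * A ^+ mlen Q) ->
  sums c z l -> cmod (ev N (strunc N c) z - l) <= 2 * K * 2 ^+ n * 2^-1 ^+ N.
Proof.
move=> K0 A0 rho0 Ar zr cB cl; apply/ler_addgt0Pr => e e0.
have [N0 N0P] := cl _ e0.
have := N0P _ (leq_maxl N0 N); set M := maxn N0 N => HM.
have tB Q : cmod (strunc N c Q) <= K * A ^+ mlen Q.
  by rewrite /strunc; case: ifP => // _; rewrite cmod0; nneg.
have E Q : (mlen Q < N)%N -> strunc N c Q = c Q by rewrite /strunc => ->.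
have := @ev_close N M _ _ z K A rho K0 A0 rho0 Ar zr E tB cB.
rewrite (ev_widen z (@ssupp_strunc _ _ N c) (leq_maxr _ _)).
have := cmodD (ev N (strunc N c) z - ev M c z) (ev M c z - l).
by rewrite subrKA; move: HM; lra.
Qed.

Lemma real_cauchy_geom (u : nat -> R) C : 0 <= C ->
  (forall M N, (M <= N)%N -> `|u N - u M| <= C * 2^-1 ^+ M) ->
  exists l, forall M, `|u M - l| <= 2 * C * 2^-1 ^+ M.
Proof.
(* The shift makes every [u M + C * 2^-1 ^+ M] an upper bound of all [v N], so that the supremum of
   [v] is the limit, with an explicit error. *)
move=> C0 uC; pose v N := u N - 2 * C * 2^-1 ^+ N.
have hp N : 0 <= 2^-1 ^+ N :> R by nneg.
have uv M N : v N <= u M + C * 2^-1 ^+ M.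
  have [MN|/ltnW NM] := leqP M N.
    have := uC _ _ MN; rewrite ler_norml => /andP[_]; rewrite /v.
    by have := mulr_ge0 C0 (hp N); lra.
  have := uC _ _ NM; rewrite ler_norml => /andP[+ _]; rewrite /v.
  by have := mulr_ge0 C0 (hp N); have := mulr_ge0 C0 (hp M); lra.
have S0 : has_sup (range v).
  split; first by exists (v 0%N); exists 0%N.
  by exists (u 0%N + C * 2^-1 ^+ 0) => _ [N _ <-].
exists (sup (range v)) => M; rewrite ler_norml; apply/andP; split.
  have : sup (range v) <= u M + C * 2^-1 ^+ M.
    by apply: ge_sup => [|_ [N _ <-]//]; exists (v 0%N); exists 0%N.
  by have := mulr_ge0 C0 (hp M); lra.
have : v M <= sup (range v) by apply: sup_upper_bound => //; exists M.
by rewrite /v; lra.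
Qed.

Lemma sums_exists c K A : 0 < K -> 0 < A -> (forall Q, cmod (c Q) <= K * A ^+ mlen Q) ->
  forall z, (forall i, cmod (z i 0) <= (4 * A)^-1) -> exists l, sums c z l.
Proof.
move=> K0 A0 cB z zr; have Ar : A * (4 * A)^-1 <= 4^-1.
  by rewrite invfM mulrCA mulfV ?gt_eqF// mulr1.
have r0 : 0 <= (4 * A)^-1 by rewrite invr_ge0; nneg.
pose C := 2 * K * 2 ^+ n; have C0 : 0 <= C by rewrite /C; nneg.
have cC M N : (M <= N)%N -> cmod (ev N c z - ev M c z) <= C * 2^-1 ^+ M.
  (* The partial sum over the smaller box is a partial sum over the larger one of a series [d] that
     agrees with [c] below degree [M]. *)
  move=> MN; pose d Q := if Q \in mbox n M then c Q else 0.
  have -> : ev M c z = ev N d z.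
    rewrite /ev [RHS](big_mbox_widen MN) => [|Q]; last first.
      by rewrite /d; case: ifP => //; rewrite mul0r eqxx.
    by rewrite big_seq [RHS]big_seq; apply: eq_bigr => Q; rewrite /d => ->.
  have K0' := ltW K0; have A0' := ltW A0.
  apply: (@ev_close M N c d z K A (4 * A)^-1) => // Q.
    by rewrite /d => QM; rewrite mlen_mbox.
  by rewrite /d; case: ifP => // _; rewrite cmod0; nneg.
have [a aP] : exists l, forall M, `|complex.Re (ev M c z) - l| <= 2 * C * 2^-1 ^+ M.
  apply: real_cauchy_geom => // M N /cC; apply: le_trans.
  by rewrite -raddfB; exact: cmod_Re.
have [b bP] : exists l, forall M, `|complex.Im (ev M c z) - l| <= 2 * C * 2^-1 ^+ M.
  apply: real_cauchy_geom => // M N /cC; apply: le_trans.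
  by rewrite -raddfB; exact: cmod_Im.
exists ((a +i* b)%C : Cplx R) => e e0.
have [N NP] := small_half (mulr_ge0 (ler0n R 4) C0) e0.
exists N => M NM; apply: le_lt_trans (cmod_ReIm _) _; apply: le_lt_trans NP.
apply: (@le_trans _ _ (4 * C * 2^-1 ^+ M)); last first.
  by apply: ler_wpM2l; [nneg|apply: ler_wiXn2l => //; lra].
rewrite !raddfB/=; apply: le_trans (lerD (aP M) (bP M)) _.
by rewrite le_eqVlt; apply/orP; left; apply/eqP; ring.
Qed.

Lemma germ_exists c : sbound c -> exists f, has_taylor f c.
Proof.
move=> [K [A [K0 A0 cB]]].
have /choice[f fP] : forall z, exists l, (forall i, cmod (z i 0) <= (4 * A)^-1) -> sums c z l.
  move=> z; have [zr|zr] := pselect (forall i, cmod (z i 0) <= (4 * A)^-1).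
    by have [l lP] := sums_exists K0 A0 cB zr; exists l.
  by exists 0.
exists f; apply/has_taylorP; split; first by exists K, A.
exists (4 * A)^-1; first by rewrite invr_gt0 mulr_gt0.
by move=> z zr; apply: fP => i; exact: ltW.
Qed.

End Germs.

(** * Uniqueness and algebra of Taylor series *)

Section TaylorCalculus.
Variables (R : realType) (n : nat).
Implicit Types (c d : fps R n) (z w : 'cV[Cplx R]_n).
Implicit Types (f g : 'cV[Cplx R]_n -> Cplx R).

(** If the homogeneous part [p] of lowest degree [k] were nonzero at [w], its value at [t w] would
    be of exact size [t ^+ k], while the remaining terms are of size [t ^+ k.+1]. *)
Lemma zero_series d K A (r : R) : 0 < K -> 0 < A -> 0 < r ->
  (forall Q, cmod (d Q) <= K * A ^+ mlen Q) ->
  (forall z, (forall i, cmod (z i 0) < r) -> sums d z 0) ->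
  forall Q, d Q = 0.
Proof.
move=> K0 A0 r0 dB d0; suff H k : sorder k d by move=> Q; apply: (H (mlen Q).+1).
elim: k => [//|k IH].
pose p Q := if mlen Q == k then d Q else 0.
have pS : ssupp k.+1 p by move=> Q; rewrite /p; case: eqP => // ->; rewrite ltnn.
suff p0 T : p T = 0.
  move=> Q; rewrite ltnS leq_eqVlt => /orP[Qk|]; last exact: IH.
  by rewrite -(p0 Q) /p Qk.
apply: (@ev_near0 _ _ k.+1 p 1) => // w w1; apply/eqP; rewrite -cmod_eq0.
apply/negPn/negP => a0; set a := cmod _ in a0.
have {}a0 : 0 < a by rewrite lt_def a0 cmod_ge0.
pose C := K * (2 * A) ^+ k.+1 * 2 ^+ n; have C0 : 0 <= C by rewrite /C; nneg.
have key (t : R) : 0 < t -> t < r -> A * t <= 2^-1 -> a <= t * C.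
  move=> t0 tr At; rewrite -(ler_pM2l (exprn_gt0 k t0)).
  rewrite (_ : _ * (t * C) = K * (2 * (A * t)) ^+ k.+1 * 2 ^+ n); last first.
    by rewrite /C [2 * (A * t)]mulrA [(2 * A * t) ^+ _]exprMn [t ^+ k.+1]exprS; ring.
  apply/ler_addgt0Pr => e e0.
  pose z : 'cV[Cplx R]_n := \col_i (cplx_of_real t * w i 0).
  have zt i : cmod (z i 0) <= t.
    rewrite mxE cmodM cmod_real (ger0_norm (ltW t0)) ler_piMr ?ltW//; exact: ltW.
  have [|N0 N0P] := d0 z _ e e0; first by move=> i; apply: le_lt_trans tr.
  have := N0P _ (leq_maxl N0 k.+1); set N := maxn N0 k.+1; rewrite subr0 => dz.
  have pz : ev N p z = cplx_of_real t ^+ k * ev k.+1 p w.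
    rewrite -(ev_widen w pS (leq_maxr N0 k.+1)) /ev mulr_sumr; apply: eq_bigr => Q _.
    rewrite /p; case: eqP => [Qk|_]; last by rewrite !mul0r mulr0.
    rewrite mulrCA; congr (_ * _); rewrite /monom -Qk /mlen -prodrXr -big_split.
    by apply: eq_bigr => i _; rewrite mxE exprMn.
  have dpz : cmod (ev N (fun Q => d Q - p Q) z) <= K * (2 * (A * t)) ^+ k.+1 * 2 ^+ n.
    apply: ev_small (ltW t0) At zt _ _ => //; try exact: ltW.
      move=> Q; rewrite ltnS leq_eqVlt /p => /orP[->|Qk]; first by rewrite subrr.
      by rewrite IH// if_same subr0.
    by move=> Q; rewrite /p; case: ifP => _; rewrite ?subr0// subrr cmod0; nneg.
  rewrite evB in dpz.
  have := cmodD (ev N p z - ev N d z) (ev N d z); rewrite subrK [in X in _ <= X]cmodB.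
  rewrite {1}pz cmodM cmodX cmod_real (ger0_norm (ltW t0)) -/a.
  by move: dz dpz; lra.
(* The first two constraints are those of [key]; the third makes [t * C] smaller than [a], against
   its conclusion. *)
pose t := Num.min (r / 2) (Num.min (2 * A)^-1 (a / (2 * (C + 1)))).
have t0 : 0 < t by rewrite !lt_min !divr_gt0 ?invr_gt0 ?mulr_gt0// ltr_wpDl.
have tr : t < r by rewrite gt_min ltr_pdivrMr//; apply/orP; left; lra.
have At : A * t <= 2^-1.
  have : t <= (2 * A)^-1 by rewrite !ge_min lexx !orbT.
  by move=> /(ler_wpM2l (ltW A0)); rewrite invfM mulrCA mulfV ?gt_eqF// mulr1.
have := key t t0 tr At.
have : t <= a / (2 * (C + 1)) by rewrite !ge_min lexx !orbT.
rewrite ler_pdivlMr; last by rewrite mulr_gt0// ltr_wpDl.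
by nra.
Qed.

Lemma taylor_unique f c d : has_taylor f c -> has_taylor f d -> c = d.
Proof.
move=> /has_taylorP[[K [A [K0 A0 cB]]] [r r0 cS]].
move=> /has_taylorP[[L [B [L0 B0 dB]]] [r' r'0 dS]].
apply/funext => Q; apply/eqP; rewrite -subr_eq0; apply/eqP.
have rr0 : 0 < Num.min r r' by rewrite lt_min r0.
move: Q; apply: (@zero_series (fun Q => c Q - d Q) _ _ _ (addr_gt0 K0 L0) (addr_gt0 A0 B0) rr0).
  by apply: boundB => //; exact: ltW.
move=> z zr e e0; have e20 : 0 < e / 2 by rewrite divr_gt0.
have [|N1 N1P] := cS z _ _ e20.
  by move=> i; apply: lt_le_trans (zr i) _; rewrite ge_min lexx.
have [|N2 N2P] := dS z _ _ e20.
  by move=> i; apply: lt_le_trans (zr i) _; rewrite ge_min lexx orbT.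
exists (maxn N1 N2) => N; rewrite geq_max => /andP[/N1P NN1 /N2P NN2].
rewrite subr0 evB; have := cmodD (ev N c z - f z) (f z - ev N d z).
by rewrite subrKA (cmodB (f z)); move: NN1 NN2; lra.
Qed.

Lemma taylor_germ f g c : has_taylor f c -> has_taylor g c ->
  \forall z \near (0 : 'cV[Cplx R]_n), f z = g z.
Proof.
move=> /has_taylorP[_ [r r0 cS]] /has_taylorP[_ [r' r'0 dS]].
apply/near0P; exists (Num.min r r'); first by rewrite lt_min r0.
move=> z zr; apply: (@sums_unique _ _ c z); [apply: cS|apply: dS] => i;
  apply: lt_le_trans (zr i) _; by rewrite ge_min lexx ?orbT.
Qed.

Lemma taylor_sbound f c : has_taylor f c -> sbound c.
Proof. by move=> /has_taylorP[]. Qed.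

Lemma taylor_at0 f c : has_taylor f c -> f 0 = c 0.
Proof.
move=> /has_taylorP[_ [r r0 cS]]; apply: (@sums_unique _ _ c 0).
  by apply: cS => i; rewrite mxE cmod0.
move=> e e0; exists 1%N => N N1; rewrite /ev (bigD1_seq 0) ?uniq_mbox ?mlen_mbox ?mlen0//=.
rewrite monom0 mulr1 big1 ?addr0 ?subrr ?cmod0// => Q.
rewrite -mlen_eq0 -lt0n => Q0; rewrite /monom.
have [i Qi] : exists i, (0 < Q i)%N.
  apply/existsP; rewrite -[X in is_true X]negbK negb_exists; apply/negP => /forallP Qz.
  by move: Q0; rewrite /mlen big1// => i _; apply/eqP; rewrite eqn0Ngt.
by rewrite (bigD1 i)//= mxE expr0n eqn0Ngt Qi mul0r mulr0.
Qed.

Lemma has_taylorD f g c d : has_taylor f c -> has_taylor g d ->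
  has_taylor (fun z => f z + g z) (fun Q => c Q + d Q).
Proof.
move=> /has_taylorP[cB [r r0 cS]] /has_taylorP[dB [r' r'0 dS]].
apply/has_taylorP; split; first exact: sboundD.
exists (Num.min r r'); first by rewrite lt_min r0.
move=> z zr e e0; have e20 : 0 < e / 2 by rewrite divr_gt0.
have [|N1 N1P] := cS z _ _ e20.
  by move=> i; apply: lt_le_trans (zr i) _; rewrite ge_min lexx.
have [|N2 N2P] := dS z _ _ e20.
  by move=> i; apply: lt_le_trans (zr i) _; rewrite ge_min lexx orbT.
exists (maxn N1 N2) => N; rewrite geq_max => /andP[/N1P NN1 /N2P NN2].
have -> : ev N (fun Q => c Q + d Q) z = ev N c z + ev N d z.
  by rewrite /ev -big_split; apply: eq_bigr => Q _; rewrite mulrDl.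
rewrite opprD addrACA; apply: le_lt_trans (cmodD _ _) _; lra.
Qed.

Lemma has_taylorZ f c (a : Cplx R) : has_taylor f c ->
  has_taylor (fun z => a * f z) (fun Q => a * c Q).
Proof.
move=> /has_taylorP[cB [r r0 cS]]; apply/has_taylorP; split; first exact: sboundZ.
exists r => // z zr e e0; have a1 : 0 < 1 + cmod a by rewrite ltr_pwDl// cmod_ge0.
have [//|N0 N0P] := cS z zr (e / (1 + cmod a)); first by rewrite divr_gt0.
exists N0 => N /N0P; rewrite ltr_pdivlMr//; apply: le_lt_trans.
have -> : ev N (fun Q => a * c Q) z = a * ev N c z.
  by rewrite /ev mulr_sumr; apply: eq_bigr => Q _; rewrite mulrA.
rewrite -mulrBr cmodM mulrC; apply: ler_wpM2l; rewrite ?cmod_ge0// lerDr//.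
Qed.

Lemma has_taylor_poly N c : ssupp N c -> has_taylor (ev N c) c.
Proof.
move=> cN; apply/has_taylorP; split; first exact: sbound_supp cN.
by exists 1 => // z _ e e0; exists N => M NM; rewrite (ev_widen z cN NM) subrr cmod0.
Qed.

Lemma has_taylor0 : @has_taylor R n (fun=> 0) (fun=> 0).
Proof.
rewrite (_ : (fun=> 0) = @ev R n 0 (fun=> 0)); first exact: has_taylor_poly.
by apply/funext => z; rewrite /ev big1// => Q _; rewrite mul0r.
Qed.

Lemma has_taylor_sum (I : Type) (r : seq I) (F : I -> 'cV[Cplx R]_n -> Cplx R)
    (C : I -> fps R n) : (forall i, has_taylor (F i) (C i)) ->
  has_taylor (fun z => \sum_(i <- r) F i z) (fun Q => \sum_(i <- r) C i Q).
Proof.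
move=> FC; elim: r => [|i r IH].
  rewrite (_ : (fun z => _) = fun=> 0); last by apply/funext => z; rewrite big_nil.
  rewrite (_ : (fun Q => _) = fun=> 0); first exact: has_taylor0.
  by apply/funext => z; rewrite big_nil.
rewrite (_ : (fun z => _) = fun z => F i z + \sum_(i <- r) F i z); last first.
  by apply/funext => z; rewrite big_cons.
rewrite (_ : (fun Q => _) = fun Q => C i Q + \sum_(i <- r) C i Q); last first.
  by apply/funext => z; rewrite big_cons.
exact: (has_taylorD (FC i) IH).
Qed.

Lemma has_taylor_lin (A : 'M[Cplx R]_n) s :
  has_taylor (fun z => (A *m z) s 0) (smap_lin A s).
Proof.
rewrite (_ : (fun z => _) = ev 2 (smap_lin A s)); first exact/has_taylor_poly/ssupp_lin.
by apply/funext => z; rewrite ev_lin// mxE.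
Qed.

Definition sconj c : fps R n := fun Q => (c Q)^*.

Lemma monom_conj Q z : monom Q (mxconj z) = (monom Q z)^*.
Proof. by rewrite rmorph_prod; apply: eq_bigr => i _; rewrite mxE rmorphXn. Qed.

Lemma mxconjK (p q : nat) (A : 'M[Cplx R]_(p, q)) : mxconj (mxconj A) = A.
Proof. by apply/matrixP => i j; rewrite !mxE conjCK. Qed.

Lemma has_taylor_conj f c : has_taylor f c ->
  has_taylor (fun z => (f (mxconj z))^*) (sconj c).
Proof.
move=> /has_taylorP[[K [A [K0 A0 cB]]] [r r0 cS]]; apply/has_taylorP; split.
  by exists K, A; split=> // Q; rewrite cmod_conj.
exists r => // z zr e e0; have [|N0 N0P] := cS (mxconj z) _ e e0.
  by move=> i; rewrite mxE cmod_conj.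
exists N0 => N /N0P; rewrite -cmod_conj rmorphB/=; congr (cmod (_ - _) < _).
rewrite /ev rmorph_sum; under eq_bigr do rewrite rmorphM/= monom_conj conjCK.
by [].
Qed.

Lemma has_taylor_smonom f c P : has_taylor f c ->
  has_taylor (fun z => f z * monom P z) (smul c (smonom R P)).
Proof.
move=> fc; have /has_taylorP[cB [r r0 cS]] := fc.
have [K [A [K0 A0 cB']]] := cB.
apply/has_taylorP; split; first by apply: sbound_smul => //; exact: sbound_smonom.
pose rho := Num.min 1 (4 * A)^-1.
have rho0 : 0 < rho by rewrite lt_min ltr01 invr_gt0 mulr_gt0.
have Ar : A * rho <= 4^-1.
  have : rho <= (4 * A)^-1 by rewrite ge_min lexx orbT.
  by move=> /(ler_wpM2l (ltW A0)); rewrite invfM mulrCA mulfV ?gt_eqF// mulr1.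
exists (Num.min r rho); first by rewrite lt_min r0.
move=> z zr e e0; have zrho i : cmod (z i 0) <= rho.
  by apply: ltW; apply: lt_le_trans (zr i) _; rewrite ge_min lexx orbT.
have e20 : 0 < e / 2 by rewrite divr_gt0.
have [|N0 N0P] := cS z _ _ e20.
  by move=> i; apply: lt_le_trans (zr i) _; rewrite ge_min lexx.
have [|N1 N1P] := @small_half R (2 * K * 2 ^+ n) (e / 2) _ e20; first by nneg.
exists (maxn N0 (N1 + mlen P)) => N; rewrite geq_max => /andP[/N0P NN0 NN1].
(* The coefficients that stay in the box after multiplication by the monomial; those lost have
   degree at least [N - mlen P], hence at least [N1]. *)
pose c' Q := if P + Q \in mbox n N then c Q else 0.
have -> : ev N (smul c (smonom R P)) z = ev N c' z * monom P z.
  rewrite smulC /ev; under eq_bigr do rewrite smul_smonom.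
  transitivity (\sum_(Q <- mbox n N | mle P Q) c (msub Q P) * monom (msub Q P) z * monom P z).
    rewrite [RHS]big_mkcond/=; apply: eq_bigr => Q _; case: ifP => [PQ|_]; last by rewrite mul0r.
    by rewrite -mulrA -monomD addrC msubKC.
  rewrite (big_mbox_shift N P (fun T => c T * monom T z * monom P z)) [LHS]big_mkcond mulr_suml.
  by apply: eq_bigr => Q _; rewrite /c'; case: ifP => // _; rewrite !mul0r.
have close : cmod (ev N c' z - ev N c z) <= 2 * K * 2 ^+ n * 2^-1 ^+ N1.
  apply: ev_close (ltW rho0) Ar zrho _ _ _ => //; try exact: ltW.
    by move=> Q QN1; rewrite /c' mlen_mbox// mlenD; lia.
  by move=> Q; rewrite /c'; case: ifP => // _; rewrite cmod0; nneg.
have P1 : cmod (monom P z) <= 1.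
  apply: le_trans (monom_bound (rho := 1) _ _) _; last by rewrite expr1n.
  by move=> i; apply: le_trans (zrho i) _; rewrite ge_min lexx.
rewrite -mulrBl cmodM; apply: (@le_lt_trans _ _ (cmod (ev N c' z - f z))).
  by rewrite ler_piMr ?cmod_ge0.
have := cmodD (ev N c' z - ev N c z) (ev N c z - f z); rewrite subrKA.
by move: NN0 N1P close; lra.
Qed.

End TaylorCalculus.

(** * Taylor series of a composition *)

Section TaylorComposition.
Variables (R : realType) (n : nat).
Implicit Types (c d : fps R n) (z w : 'cV[Cplx R]_n) (g : smap R n).

Lemma monom_lipschitz Q w w' (sigma eta : R) : 0 <= sigma -> 0 <= eta ->
  (forall i, cmod (w i 0) <= sigma) -> (forall i, cmod (w' i 0) <= sigma) ->
  (forall i, cmod (w i 0 - w' i 0) <= sigma * eta) ->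
  cmod (monom Q w - monom Q w') <= (mlen Q)%:R * sigma ^+ mlen Q * eta.
Proof.
move=> s0 e0 ws w's ww'.
pose A k (x y : Cplx R) := [/\ cmod x <= sigma ^+ k, cmod y <= sigma ^+ k &
  cmod (x - y) <= k%:R * sigma ^+ k * eta].
have AM k l x y x' y' : A k x y -> A l x' y' -> A (k + l)%N (x * x') (y * y').
  move=> [xk yk xyk] [xl yl xyl]; split; rewrite ?exprD ?cmodM; [exact: ler_pM (cmod_ge0 _) (cmod_ge0 _) _ _ ..|].
  have -> : x * x' - y * y' = x * (x' - y') + (x - y) * y' by ring.
  apply: le_trans (cmodD _ _) _; rewrite !cmodM.
  apply: le_trans (lerD (ler_pM (cmod_ge0 _) (cmod_ge0 _) xk xyl)
    (ler_pM (cmod_ge0 _) (cmod_ge0 _) xyk yl)) _.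
  by rewrite le_eqVlt natrD; apply/orP; left; apply/eqP; ring.
have A0 : A 0%N 1 1.
  by split; rewrite ?cmod1 ?expr0// subrr cmod0 mul0r mul0r.
have AX i k : A k (w i 0 ^+ k) (w' i 0 ^+ k).
  elim: k => [//|k IH]; rewrite !exprS; apply: (AM 1%N) IH.
  by split; rewrite ?expr1 ?mul1r.
suff [] : A (mlen Q) (monom Q w) (monom Q w') by [].
rewrite /mlen /monom; elim/big_rec3: _ => // i y1 y2 y3 _; exact: AM.
Qed.

(** The factor [mlen Q] coming from a difference of monomials is absorbed by [2 ^ mlen Q], at the
    price of a quarter in the condition on [sigma]. *)
Lemma ev_lipschitz N c w w' K A (sigma eta : R) : 0 <= K -> 0 <= A ->
  0 <= sigma -> 0 <= eta -> A * sigma <= 4^-1 ->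
  (forall i, cmod (w i 0) <= sigma) -> (forall i, cmod (w' i 0) <= sigma) ->
  (forall i, cmod (w i 0 - w' i 0) <= sigma * eta) ->
  (forall Q, cmod (c Q) <= K * A ^+ mlen Q) ->
  cmod (ev N c w - ev N c w') <= K * 2 ^+ n * eta.
Proof.
move=> K0 A0 s0 e0 As ws w's ww' cB; rewrite /ev -sumrB.
apply: le_trans (cmod_sum _ _ _) _.
have As0 : 0 <= 2 * (A * sigma) by nneg.
have As2 : 2 * (A * sigma) <= 2^-1 by lra.
have H := ler_wpM2l (mulr_ge0 K0 e0) (@geometric_tail R n N 0 _ As0 As2).
rewrite expr0 mul1r in H; rewrite [leRHS]mulrAC; apply: le_trans H.
rewrite mulr_sumr; apply: ler_sum => Q _; rewrite -mulrBr cmodM.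
apply: le_trans (ler_pM (cmod_ge0 _) (cmod_ge0 _) (cB Q) (monom_lipschitz Q s0 e0 ws w's ww')) _.
rewrite (_ : K * _ * _ = K * eta * ((mlen Q)%:R * (A * sigma) ^+ mlen Q)); last first.
  by rewrite exprMn; ring.
apply: ler_wpM2l; first exact: mulr_ge0.
rewrite [leRHS]exprMn; apply: ler_wpM2r; first by nneg.
by rewrite -natrX ler_nat ltnW// ltn_expl.
Qed.

(** The series and the function are both compared with the composition of truncations at degree [N]:
    for the series by a bound uniform in [N], for the function because the truncations of [g]
    converge at [z] and those of [c] are uniformly Lipschitz. *)
Lemma has_taylor_comp (f : 'cV[Cplx R]_n -> Cplx R) c (G : 'cV[Cplx R]_n -> 'cV[Cplx R]_n) g :
  has_taylor f c -> has_taylor_map G g -> fixes0 g ->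
  has_taylor (fun z => f (G z)) (scomp c g).
Proof.
move=> /has_taylorP[cB [r r0 cS]] Gg g0.
have gB : forall s, sbound (g s) by move=> s; exact: taylor_sbound (Gg s).
apply/has_taylorP; split; first exact: sbound_scomp.
have [K [A [K0 A0 {}cB]]] := cB.
have [L [B [L0 B0 {}gB]]] := sbound_uniform gB.
have [K1 [A1 [K10 A10 sB]]] := scomp_uniform_bound n K0 A0 L0 B0.
have /choice[rG rGP] : forall s, exists r, 0 < r /\
    forall z, (forall i, cmod (z i 0) < r) -> sums (g s) z (G z s 0).
  by move=> s; have /has_taylorP[_ [r' ? ?]] := Gg s; exists r'.
have [rho1 rho10 rho1P] : exists2 rho, 0 < rho & forall s, rho <= rG s.
  have S0 : 0 < 1 + \sum_s (rG s)^-1.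
    by rewrite ltr_pwDl// sumr_ge0// => s _; rewrite invr_ge0 ltW; case: (rGP s).
  (* This stands for a minimum: it is below every [rG s], and positive even when [n = 0]. *)
  exists (1 + \sum_s (rG s)^-1)^-1 => [|s]; first by rewrite invr_gt0.
  have rs0 : 0 < rG s by case: (rGP s).
  rewrite -[leRHS]invrK lef_pV2 ?posrE ?invr_gt0// (bigD1 s)//= addrCA lerDl addr_ge0//.
  by apply: sumr_ge0 => i _; rewrite invr_ge0 ltW; case: (rGP i).
pose sigma := Num.min (r / 2) (4 * A)^-1.
have s0 : 0 < sigma by rewrite lt_min divr_gt0// invr_gt0 mulr_gt0.
have sr : sigma < r by rewrite gt_min ltr_pdivrMr//; apply/orP; left; lra.
have As : A * sigma <= 4^-1.
  have : sigma <= (4 * A)^-1 by rewrite ge_min lexx orbT.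
  by move=> /(ler_wpM2l (ltW A0)); rewrite invfM mulrCA mulfV ?gt_eqF// mulr1.
pose D := L * (2 * B) * 2 ^+ n; have D0 : 0 < D by rewrite !mulr_gt0 ?exprn_gt0.
(* [rho1] is for the convergence of [g], [sigma / D] keeps [G z] where [c] converges, and the last
   two make the tails of [g] and of the composition decay. *)
pose rho := Num.min (Num.min rho1 (sigma / D)) (Num.min (4 * B)^-1 (4 * A1)^-1).
have rho0 : 0 < rho by rewrite !lt_min rho10 divr_gt0//= !invr_gt0 !mulr_gt0.
have Br : B * rho <= 4^-1.
  have : rho <= (4 * B)^-1 by rewrite !ge_min lexx !orbT.
  by move=> /(ler_wpM2l (ltW B0)); rewrite invfM mulrCA mulfV ?gt_eqF// mulr1.
have A1r : A1 * rho <= 4^-1.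
  have : rho <= (4 * A1)^-1 by rewrite !ge_min lexx !orbT.
  by move=> /(ler_wpM2l (ltW A10)); rewrite invfM mulrCA mulfV ?gt_eqF// mulr1.
have Dr : D * rho <= sigma.
  have : rho <= sigma / D by rewrite !ge_min lexx !orbT.
  by rewrite ler_pdivlMr// mulrC.
exists rho => // z zr.
have zrho i : cmod (z i 0) <= rho by exact: ltW.
have gz s : sums (g s) z (G z s 0).
  have [_] := rGP s; apply => i; apply: lt_le_trans (zr i) _; apply: le_trans (rho1P s).
  by rewrite !ge_min lexx.
have Br2 : B * rho <= 2^-1 by apply: le_trans Br _; lra.
pose gt N s := strunc N.+1 (g s).
have gtB N s Q : cmod (gt N s Q) <= L * B ^+ mlen Q.
  by rewrite /gt /strunc; case: ifP => // _; rewrite cmod0; nneg.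
pose wN N : 'cV[Cplx R]_n := \col_s ev N.+1 (gt N s) z.
have gt0 N : fixes0 (gt N) by exact: fixes0_strunc.
have wNs N i : cmod (wN N i 0) <= sigma.
  have gt1 : sorder 1 (gt N i) by move/sorder_fixes0: (gt0 N); apply.
  rewrite mxE; apply: le_trans (ev_small N.+1 (ltW L0) (ltW B0) (ltW rho0) Br2 zrho gt1 (gtB N i)) _.
  by apply: le_trans Dr; rewrite expr1 le_eqVlt /D; apply/orP; left; apply/eqP; ring.
have wNG N i : cmod (wN N i 0 - G z i 0) <= 2 * L * 2 ^+ n * 2^-1 ^+ N.+1.
  rewrite mxE; exact: (sums_trunc N.+1 (ltW L0) (ltW B0) (ltW rho0) Br zrho (gB i) (gz i)).
have Gs i : cmod (G z i 0) <= sigma.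
  apply/ler_addgt0Pr => e e0; have [|N NP] := @small_half R (2 * L * 2 ^+ n) e _ e0; first by nneg.
  have := cmodD (G z i 0 - wN N i 0) (wN N i 0); rewrite subrK cmodB => H.
  have : 2 * L * 2 ^+ n * 2^-1 ^+ N.+1 <= 2 * L * 2 ^+ n * 2^-1 ^+ N.
    by apply: ler_wpM2l; [nneg|apply: ler_wiXn2l => //; lra].
  by move: H (wNs N i) (wNG N i) NP; lra.
have cGz : sums c (G z) (f (G z)) by apply: cS => i; exact: le_lt_trans sr.
pose ct N := strunc N.+1 c.
have ctB N Q : cmod (ct N Q) <= K * A ^+ mlen Q.
  by rewrite /ct /strunc; case: ifP => // _; rewrite cmod0; nneg.
(* The three constants come from [step3], [step4] and [step1], in this order. *)
pose E := K * 2 ^+ n * (2 * L * 2 ^+ n / sigma) + 2 * K * 2 ^+ n + 2 * K1 * 2 ^+ n.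
have E0 : 0 <= E by rewrite /E !addr_ge0//; nneg.
move=> e e0; have [N NP] := small_half E0 e0.
exists (N * N + N).+1 => M MN; apply: le_lt_trans NP.
have hN : (2^-1 : R) ^+ N.+1 <= 2^-1 ^+ N by apply: ler_wiXn2l => //; lra.
have h0 : (0 : R) <= 2^-1 ^+ N by nneg.
have ctN : ssupp N.+1 (ct N) by exact: ssupp_strunc.
have gtN s : ssupp N.+1 (gt N s) by exact: ssupp_strunc.
have step1 : cmod (ev M (scomp c g) z - ev M (scomp (ct N) (gt N)) z) <=
    2 * K1 * 2 ^+ n * 2^-1 ^+ N.+1.
  apply: (@ev_close _ _ _ _ _ _ z K1 A1 rho) => //; try exact: ltW.
  - move=> Q QN; apply: scomp_agree_deg => // [P PQ|s P PQ].
      by rewrite /ct /strunc (leq_ltn_trans PQ).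
    by rewrite /gt /strunc (leq_ltn_trans PQ).
  - exact: sB.
  - exact: sB.
have step2 : ev M (scomp (ct N) (gt N)) z = ev N.+1 (ct N) (wN N).
  by apply: (ev_scomp z (gt0 N) ctN gtN).2; [exact: leq_ltn_trans (leq_addr _ _) MN|exact: leq_ltn_trans (leq_addl _ _) MN].
have step3 : cmod (ev N.+1 (ct N) (wN N) - ev N.+1 (ct N) (G z)) <=
    K * 2 ^+ n * (2 * L * 2 ^+ n / sigma * 2^-1 ^+ N.+1).
  apply: (@ev_lipschitz _ _ _ _ _ A sigma) => //; try exact: ltW.
    by have s0' := ltW s0; have L0' := ltW L0; nneg.
  move=> i; apply: le_trans (wNG N i) _.
  by rewrite le_eqVlt; apply/orP; left; apply/eqP; field; rewrite gt_eqF.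
have step4 : cmod (ev N.+1 (ct N) (G z) - f (G z)) <= 2 * K * 2 ^+ n * 2^-1 ^+ N.+1.
  exact: (sums_trunc N.+1 (ltW K0) (ltW A0) (ltW s0) As Gs cB cGz).
rewrite step2 in step1.
have d1 := cmodD (ev M (scomp c g) z - ev N.+1 (ct N) (wN N)) (ev N.+1 (ct N) (wN N) - f (G z)).
have d2 := cmodD (ev N.+1 (ct N) (wN N) - ev N.+1 (ct N) (G z)) (ev N.+1 (ct N) (G z) - f (G z)).
rewrite !subrKA in d1 d2.
have : E * 2^-1 ^+ N.+1 <= E * 2^-1 ^+ N by apply: ler_wpM2l.
rewrite {1}/E; move: d1 d2 step1 step3 step4; lra.
Qed.

Lemma has_taylor_map_comp (F G : 'cV[Cplx R]_n -> 'cV[Cplx R]_n) (f g : smap R n) :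
  has_taylor_map F f -> has_taylor_map G g -> fixes0 g ->
  has_taylor_map (F \o G) (smap_comp f g).
Proof. by move=> Ff Gg g0 s; exact: has_taylor_comp (Ff s) Gg g0. Qed.

End TaylorComposition.

(** * Monomial ideals *)

Section MonomialIdeals.
Variables (R : realType) (n : nat) (gs : seq (midx n)).
Implicit Types (c d : fps R n) (z w : 'cV[Cplx R]_n) (P Q : midx n).
Implicit Types (f g : 'cV[Cplx R]_n -> Cplx R).

(** A decidable form of [outside_ideal], free of germs; [outsideP] identifies the two. *)
Definition out Q := ~~ has (fun P => mle P Q) gs.

Lemma out_down P Q : mle P Q -> out Q -> out P.
Proof.
move=> PQ; apply: contra => /hasP[T Tgs TP]; apply/hasP; exists T => //.
exact: mle_trans PQ.
Qed.

Definition vanish_out c := forall Q, out Q -> c Q = 0.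

Lemma vanish_smul_smonom (a : 'I_(size gs) -> fps R n) :
  vanish_out (fun Q => \sum_k smul (a k) (smonom R (tnth (in_tuple gs) k)) Q).
Proof.
move=> Q Qout; apply: big1 => k _; rewrite smulC smul_smonom; case: ifP => // kQ.
by case/hasP: Qout; exists (tnth (in_tuple gs) k) => //; exact: mem_tnth.
Qed.

Lemma formal_ideal_vanish c : in_formal_ideal gs c -> vanish_out c.
Proof. by move=> [a cE] Q Qout; rewrite cE; exact: vanish_smul_smonom. Qed.

Lemma ideal_vanish f c : in_ideal gs f -> has_taylor f c -> vanish_out c.
Proof.
move=> [a [/choice[b ab] /near0P[r r0 fE]]] fc.
have fb : has_taylor f
    (fun Q => \sum_k smul (b k) (smonom R (tnth (in_tuple gs) k)) Q).
  have := @has_taylor_sum R n _ (index_enum 'I_(size gs)) _ _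
    (fun k => has_taylor_smonom (tnth (in_tuple gs) k) (ab k)).
  by move/has_taylor_eq; apply; apply/near0P; exists r => // z /fE ->.
by rewrite (taylor_unique fc fb); exact: vanish_smul_smonom.
Qed.

(** Every exponent of the ideal is assigned to the first generator dividing it. The cofactors [b k]
    then share the coefficients of [c] without overlap and inherit its geometric bound. *)
Lemma vanish_ideal f c : has_taylor f c -> vanish_out c -> in_ideal gs f.
Proof.
move=> fc c0; pose gk (k : 'I_(size gs)) := tnth (in_tuple gs) k.
pose b k Q := if find (fun P => mle P (gk k + Q)) gs == k then c (gk k + Q) else 0.
have bB k : sbound (b k).
  have [K [A [K0 A0 cB]]] := taylor_sbound fc.
  exists (K * A ^+ mlen (gk k)), A; split; rewrite ?mulr_gt0 ?exprn_gt0// => Q.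
  rewrite /b -mulrA -exprD -mlenD; case: ifP => // _.
  by rewrite cmod0; nneg.
have /choice[a ab] : forall k, exists a, has_taylor a (b k).
  by move=> k; exact: germ_exists.
exists a; split; first by move=> k; exists (b k); exact: ab.
have := @has_taylor_sum R n _ (index_enum 'I_(size gs)) _ _
  (fun k => has_taylor_smonom (gk k) (ab k)).
set e := (fun Q => \sum_(_ <- _) _); suff -> : e = c by exact: taylor_germ.
apply/funext => Q; rewrite /e.
have E k : smul (b k) (smonom R (gk k)) Q =
    if find (fun P => mle P Q) gs == k then c Q else 0.
  rewrite smulC smul_smonom /b; case: ifP => [kQ|kQ]; first by rewrite msubKC.
  case: eqP => // kE; have hs : has (fun P => mle P Q) gs by rewrite has_find kE.
  have := nth_find (gk k) hs; rewrite kE => /=.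
  by rewrite -[X in mle X Q](tnth_nth _ (in_tuple gs)) -/(gk k) kQ.
under eq_bigr do rewrite E.
have [hs|/c0 ->] := boolP (has (fun P => mle P Q) gs); last first.
  by apply: big1 => k _; rewrite if_same.
have ks := hs; rewrite has_find in ks; rewrite (bigD1 (Ordinal ks))//= eqxx.
rewrite big1 ?addr0// => k; rewrite -val_eqE/= eq_sym => /negPf ->//.
Qed.

Lemma has_taylor_monom Q : has_taylor (@monom R n Q) (smonom R Q).
Proof.
have QS : ssupp (mlen Q).+1 (smonom R Q).
  move=> P PQ; rewrite /smonom; case: eqP => // PQ'; by rewrite PQ' ltnn in PQ.
rewrite (_ : @monom R n Q = ev (mlen Q).+1 (smonom R Q)); first exact: has_taylor_poly.
apply/funext => z; rewrite /ev (bigD1_seq Q) ?uniq_mbox ?mlen_mbox//=.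
rewrite /smonom eqxx mul1r big1 ?addr0// => P /negPf ->; exact: mul0r.
Qed.

Lemma outsideP Q : outside_ideal R gs Q <-> out Q.
Proof.
split=> [Qout|Qout QI].
  apply/negP => Qin; apply: Qout; apply: (vanish_ideal (has_taylor_monom Q)).
  move=> P; rewrite /smonom; case: eqP => // ->.
  by rewrite /out Qin.
have := ideal_vanish QI (has_taylor_monom Q) Qout.
by rewrite /smonom eqxx => /eqP; rewrite oner_eq0.
Qed.

Lemma in_ideal_conj h :
  in_ideal gs h -> in_conj_ideal gs (fun z => h (mxconj z)).
Proof.
move=> [a [aH /near0P[r r0 hE]]]; exists a; split=> //; apply/near0P.
by exists r => // z zr; apply: hE => i; rewrite mxE cmod_conj.
Qed.

(** At the conjugate of [w] the hypothesis becomes holomorphic and puts [f (B *m w)] into the ideal.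
    It speaks of germs, so the series [c] must first be realized by one, whence [sbound c]. *)
Lemma vanish_comp_lin (B : 'M[Cplx R]_n) c :
  (forall f, in_ideal gs f -> in_conj_ideal gs (fun z => f (antilin B z))) ->
  sbound c -> vanish_out c -> vanish_out (scomp c (smap_lin B)).
Proof.
move=> HB cB c0; have [f fc] := germ_exists cB.
have [a [aH /near0P[r r0 fE]]] := HB f (vanish_ideal fc c0).
have fB : in_ideal gs (fun w => f (B *m w)).
  exists a; split=> //; apply/near0P; exists r => // w wr.
  have := fE (mxconj w); rewrite /antilin mxconjK; apply=> i.
  by rewrite mxE cmod_conj.
apply: (ideal_vanish fB); apply: has_taylor_comp fc _ _; last exact: fixes0_lin.
by move=> s; exact: has_taylor_lin.
Qed.

End MonomialIdeals.

Lemma properly_embedded_shift (R : realType) (n : nat) (gs : seq (midx n)) :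
  properly_embedded R gs -> (0 < n)%N ->
  exists k, forall Q, out gs Q -> out gs (Q + midx_unit k).
Proof.
move=> [gs' [gsE gs'P]] n0.
(* The lists [gs] and [gs'] may differ, but they generate the same ideal of germs and so have the
   same complement. *)
have outE Q : out gs Q = out gs' Q.
  apply/idP/idP => /(@outsideP R) Qo; apply/(@outsideP R) => H; apply: Qo; exact/gsE.
have [k kP] : exists k : 'I_n, forall Q, Q \in gs' -> Q k = 0%N.
  case: gs'P => [->|//]; exists (Ordinal n0) => Q; by rewrite in_nil.
exists k => Q; rewrite !outE; apply: contra => /hasP[P Pgs PQ]; apply/hasP; exists P => //.
apply/mleP => i; have /mleP/(_ i) := PQ; rewrite !ffunE.
by case: eqP => [->|_]; [rewrite kP|rewrite addr0].
Qed.

(** * Counting small divisors *)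

Section Counting.
Variables (R : realType) (n m : nat) (bad : pred (midx n)).
Hypothesis m_gt0 : (0 < m)%N.
Hypothesis bad_large : forall Q, bad Q -> (m < mlen Q)%N.
Hypothesis bad_sep : forall P Q, bad P -> bad Q -> mle P Q -> P != Q ->
  (mlen P + m <= mlen Q)%N.
Implicit Types P Q : midx n.

Let t Q : R := (mlen Q)%:R / m%:R.

(* An upper bound for the number of bad multi-indices in any decomposition tree
   with root [Q]; the second kind of value accounts for the bad multi-indices
   close above [Q], below which no other one occurs. *)
Let bounds Q : set R := [set x | x = Num.max 0 (2 * t Q - 1) \/
  exists T, [/\ bad T, mle Q T, Q != T & x = Num.max 0 (2 * t T - 2)]].

Definition nbad Q : R := inf (bounds Q).

Let bounds_ge0 Q : lbound (bounds Q) 0.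
Proof. by move=> x [->|[T [_ _ _ ->]]]; rewrite le_max lexx. Qed.

Let bounds0 Q : bounds Q !=set0.
Proof. by exists (Num.max 0 (2 * t Q - 1)); left. Qed.

Lemma nbad_ge0 Q : 0 <= nbad Q.
Proof. exact: lb_le_inf (bounds0 Q) (@bounds_ge0 Q). Qed.

Let nbad_le Q x : bounds Q x -> nbad Q <= x.
Proof. by move=> Qx; apply: ge_inf => //; exists 0; exact: bounds_ge0. Qed.

Let tD P Q : t (P + Q) = t P + t Q.
Proof. by rewrite /t mlenD natrD mulrDl. Qed.

Let t_ge0 Q : 0 <= t Q. Proof. by rewrite divr_ge0. Qed.

Let t_bad Q : bad Q -> 1 < t Q.
Proof. by move=> /bad_large mQ; rewrite /t ltr_pdivlMr ?ltr0n// mul1r ltr_nat. Qed.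

Lemma nbad_le2 Q : nbad Q <= 2 * t Q.
Proof.
apply: le_trans (nbad_le (or_introl erefl)) _.
by rewrite ge_max; have := t_ge0 Q; lra.
Qed.

(** The induction step of Brjuno's counting, at a node [P + Q] of a decomposition tree, checked
    against both kinds of values in [bounds]. *)
Lemma nbad_super P Q : P != 0 -> Q != 0 ->
  nbad P + nbad Q + (bad (P + Q))%:R <= nbad (P + Q).
Proof.
move=> P0 Q0; apply: lb_le_inf => // x.
have PPQ := mle_addr P Q; have QPQ := mle_addl Q P.
have PnPQ : P != P + Q.
  by apply: contraNneq Q0 => /(congr1 (@mlen n)); rewrite mlenD -mlen_eq0; lia.
have QnPQ : Q != P + Q.
  by apply: contraNneq P0 => /(congr1 (@mlen n)); rewrite mlenD -mlen_eq0; lia.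
have := nbad_le (or_introl erefl : bounds P _); rewrite le_max => bP.
have := nbad_le (or_introl erefl : bounds Q _); rewrite le_max => bQ.
have bT T S : bad T -> mle S T -> S != T -> nbad S <= 2 * t T - 2.
  move=> Tb ST SnT; have : bounds S (Num.max 0 (2 * t T - 2)) by right; exists T.
  by move=> /nbad_le; have := t_bad Tb; rewrite le_max => t1 /orP[]; lra.
(* When [P + Q] is bad: if both counts are bounded by [2 * t - 1], one of the two subtracted units
   pays for the new node; if one count is 0, the other is at most [2 * t (P + Q) - 2], by the second
   kind of value with [P + Q] itself as [T]. *)
have main : nbad P + nbad Q + (bad (P + Q))%:R <= Num.max 0 (2 * t (P + Q) - 1).
  rewrite le_max; have := tD P Q; have [b|_] := boolP (bad (P + Q)).
    rewrite (_ : true%:R = 1 :> R)//; have := bT _ _ b PPQ PnPQ; have := bT _ _ b QPQ QnPQ; have := t_bad b.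
    by move: bP bQ => /orP[?|?] /orP[?|?] *; apply/orP; right; lra.
  rewrite addr0; move: bP bQ => /orP[?|?] /orP[?|?] *; apply/orP; [left|right|right|right]; first by lra.
  - by have := t_ge0 P; lra.
  - by have := t_ge0 Q; lra.
  - by lra.
case=> [->//|[T [Tb PQT PQnT ->]]].
(* For a value of the second kind: if [P + Q] is bad, its separation from [T] lowers [t] by 1 and
   [main] suffices; otherwise [T] also lies above [P] and [Q], and bounds either count when the
   other is 0. *)
have tT := t_bad Tb; have tPQ := tD P Q.
have ? := t_ge0 P; have ? := t_ge0 Q.
rewrite le_max; apply/orP; right; have [b|nb] := boolP (bad (P + Q)).
  rewrite b (_ : true%:R = 1 :> R)// in main; rewrite (_ : true%:R = 1 :> R)//; have : t (P + Q) + 1 <= t T.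
    have := bad_sep b Tb PQT PQnT; rewrite -(ler_nat R) natrD /t.
    rewrite -(ler_pM2r (_ : 0 < m%:R^-1 :> R)) ?invr_gt0 ?ltr0n// mulrDl.
    by rewrite mulfV ?pnatr_eq0 -?lt0n.
  by move: main; rewrite le_max => /orP[]; lra.
have tQT : t (P + Q) <= t T by rewrite ler_pM2r ?invr_gt0 ?ltr0n// ler_nat mle_mlen.
have PT : nbad P <= 2 * t T - 2.
  apply: bT => //; first exact: mle_trans PQT.
  apply: contraNneq PQnT => PT; apply/eqP/mle_eqlen => //.
  by apply/eqP; rewrite eqn_leq mle_mlen//= -PT mle_mlen.
have QT : nbad Q <= 2 * t T - 2.
  apply: bT => //; first exact: mle_trans PQT.
  apply: contraNneq PQnT => QT; apply/eqP/mle_eqlen => //.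
  by apply/eqP; rewrite eqn_leq mle_mlen//= -QT mle_mlen.
by rewrite addr0; move: bP bQ => /orP[?|?] /orP[?|?]; lra.
Qed.

End Counting.

(** * Weights absorbing the small divisors *)

Section DivisorWeights.
Variables (R : realType) (n : nat) (U : pred (midx n)).
Variables (delta : midx n -> 'I_n -> R) (lam : nat -> R) (Lam : R).
Hypothesis lam_ge0 : forall j, 0 <= lam j.
Hypothesis lam_sum : forall N, \sum_(1 <= j < N) lam j / 2 ^+ j <= Lam.
Hypothesis delta_large : forall j Q s, (0 < j)%N -> U Q ->
  (2 <= mlen Q <= 2 ^ j)%N -> expR (- lam j) <= delta Q s.
Hypothesis delta_sep : forall j P Q s, (0 < j)%N -> mle P Q -> P != Q -> U Q ->
  (2 <= mlen P)%N -> delta P s < expR (- lam j) -> delta Q s < expR (- lam j) ->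
  (mlen P + 2 ^ j <= mlen Q)%N.
Implicit Types P Q : midx n.

Let bad j s Q := [&& U Q, (2 <= mlen Q)%N & delta Q s < expR (- lam j)].

Let bad_large j s Q : (0 < j)%N -> bad j s Q -> (2 ^ j < mlen Q)%N.
Proof.
move=> j0 /and3P[UQ Q2 dQ]; rewrite ltnNge; apply/negP => Qj.
by have := delta_large s j0 UQ; rewrite Q2 Qj leNgt dQ => /(_ isT).
Qed.

Let bad_sep j s P Q : (0 < j)%N -> bad j s P -> bad j s Q -> mle P Q -> P != Q ->
  (mlen P + 2 ^ j <= mlen Q)%N.
Proof.
by move=> j0 /and3P[UP P2 dP] /and3P[UQ Q2 dQ] PQ PnQ; exact: delta_sep dQ.
Qed.

(** Logarithm of the weight. Being below the threshold [expR (- lam j)] costs [lam j.+1], as often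
    as [nbad] allows; the first term pays [lam 1] once per inner node of a binary tree with [mlen Q]
    leaves. *)
Let E J Q : R := lam 1%N * (mlen Q).-1%:R +
  \sum_(1 <= j < J) \sum_s lam j.+1 * nbad R (2 ^ j) (bad j s) Q.

Let cost J Q : R := lam 1%N +
  \sum_(1 <= j < J) \sum_s lam j.+1 * (bad j s Q)%:R.

Let E_super J P Q : P != 0 -> Q != 0 ->
  E J P + E J Q + cost J (P + Q) <= E J (P + Q).
Proof.
move=> P0 Q0; rewrite /E /cost.
have -> : (mlen (P + Q)).-1 = ((mlen P).-1 + (mlen Q).-1 + 1)%N.
  by move: P0 Q0; rewrite mlenD -!mlen_eq0; lia.
have : \sum_(1 <= j < J) \sum_s lam j.+1 * nbad R (2 ^ j) (bad j s) P +
    \sum_(1 <= j < J) \sum_s lam j.+1 * nbad R (2 ^ j) (bad j s) Q +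
    \sum_(1 <= j < J) \sum_s lam j.+1 * (bad j s (P + Q))%:R <=
    \sum_(1 <= j < J) \sum_s lam j.+1 * nbad R (2 ^ j) (bad j s) (P + Q).
  rewrite -!big_split/=; apply: ler_sum_nat => j /andP[j0 _].
  rewrite -!big_split/=; apply: ler_sum => s _; rewrite -!mulrDr.
  apply: ler_wpM2l => //; apply: nbad_super => //; first by rewrite expn_gt0.
    by move=> T; exact: bad_large.
  by move=> S T; exact: bad_sep.
rewrite !natrD; lra.
Qed.

Let E_ge0 J Q : 0 <= E J Q.
Proof.
rewrite addr_ge0 ?mulr_ge0// sumr_ge0// => j _; rewrite sumr_ge0// => s _.
by rewrite mulr_ge0 ?nbad_ge0.
Qed.

Let cost_ge0 J Q : 0 <= cost J Q.
Proof.
by rewrite addr_ge0// sumr_ge0// => j _; rewrite sumr_ge0// => s _; rewrite mulr_ge0.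
Qed.

Let cost_delta J Q s : (0 < J)%N -> U Q -> (2 <= mlen Q <= 2 ^ J)%N ->
  expR (- cost J Q) <= delta Q s.
Proof.
move=> J0 UQ QJ.
have ex : exists j, (0 < j)%N && (expR (- lam j) <= delta Q s).
  by exists J; rewrite J0 delta_large.
(* Take the least threshold that the divisor respects. If it is not the first, the divisor is bad
   for the preceding one, and [cost] contains exactly the required [lam j]; if it is the first, the
   term [lam 1] is enough. *)
case: (ex_minnP ex) => j /andP[j0 jd] jmin; apply: le_trans jd.
have jJ : (j <= J)%N by apply: jmin; rewrite J0 delta_large.
rewrite ler_expR lerN2 /cost.
case: j j0 jmin jJ => [//|[_ _ _|k _ jmin jJ]].
  rewrite lerDl sumr_ge0// => j _; rewrite sumr_ge0// => i _; exact: mulr_ge0.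
have kb : bad k.+1 s Q.
  rewrite /bad UQ ltNge; case/andP: QJ => -> _ /=; apply/negP => kd.
  by have := jmin k.+1; rewrite kd ltnn => /(_ isT).
rewrite (bigD1_seq k.+1) ?iota_uniq ?mem_index_iota//= (bigD1 s)//= kb mulr1.
rewrite addrCA -addrA lerDl !addr_ge0// ?sumr_ge0// => [j _|j _].
  by rewrite mulr_ge0.
by rewrite sumr_ge0// => i _; rewrite mulr_ge0.
Qed.

(** Here the Brjuno sum enters: [nbad_le2] makes the exponent linear in the degree. In the constant,
    4 is the 2 of that bound times the 2 from passing from [2 ^ j] to [2 ^ j.+1], and [n] counts the
    components. *)
Let E_le J Q : E J Q <= (lam 1%N + 4 * n%:R * Lam) * (mlen Q)%:R.
Proof.
rewrite mulrDl lerD//.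
  by apply: ler_wpM2l => //; rewrite ler_nat leq_pred.
apply: (@le_trans _ _ (\sum_(1 <= j < J) 4 * n%:R * (mlen Q)%:R * (lam j.+1 / 2 ^+ j.+1))).
  apply: ler_sum_nat => j /andP[j0 _].
  apply: (@le_trans _ _ (\sum_(s < n) lam j.+1 * (2 * ((mlen Q)%:R / (2 ^ j)%:R)))).
    apply: ler_sum => s _; apply: ler_wpM2l => //; exact: nbad_le2.
  rewrite sumr_const card_ord natrX -mulr_natl le_eqVlt; apply/orP; left; apply/eqP.
  by rewrite exprS; field; rewrite expf_neq0.
rewrite -mulr_sumr [leRHS]mulrAC; apply: ler_wpM2l; first by nneg.
case: J => [|J]; first by have := lam_sum 1; rewrite !big_geq.
apply: le_trans (lam_sum J.+2); rewrite [leRHS]big_ltn// big_add1/=.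
by rewrite lerDr divr_ge0// exprn_ge0.
Qed.

(** The order of quantifiers matters: the weights depend on the truncation [J], their growth rate
    [C] does not. *)
Lemma divisor_weights : exists2 C : R, 0 < C & forall J, (0 < J)%N ->
  exists w d : midx n -> R, [/\ forall P, 1 <= w P <= C ^+ mlen P,
    forall P, 0 <= d P <= 1,
    forall P Q, P != 0 -> Q != 0 -> w P * w Q <= d (P + Q) * w (P + Q) &
    forall Q s, U Q -> (2 <= mlen Q <= 2 ^ J)%N -> d Q <= delta Q s].
Proof.
exists (expR (lam 1%N + 4 * n%:R * Lam)); first exact: expR_gt0.
move=> J J0; exists (fun P => expR (E J P)), (fun P => expR (- cost J P)).
split=> [P|P|P Q P0 Q0|Q s UQ QJ].
- by rewrite -[leLHS]expR0 ler_expR E_ge0/= -expRM_natr ler_expR E_le.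
- by rewrite expR_ge0 -[leRHS]expR0 ler_expR oppr_le0 cost_ge0.
- rewrite -!expRD ler_expR [leRHS]addrC lerBrDr; exact: E_super.
- exact: cost_delta.
Qed.

End DivisorWeights.

(** * Convergence from an inequality with small divisors *)

Section SmallDivisors.
Variables (R : realType) (n : nat) (U : pred (midx n)).
Hypothesis Udown : forall P Q, mle P Q -> U Q -> U P.
Implicit Types (P Q : midx n) (h : fps R n) (G H phi : smap R n).

(** Having no linear part, [h] reads [G] only in strictly smaller degrees, which makes a recursion
    on the degree possible. *)
Lemma scomp_agree_order2 d h G H Q : fixes0 G -> fixes0 H -> sorder 2 h ->
  (forall s T, U T -> (mlen T < d)%N -> G s T = H s T) ->
  U Q -> (mlen Q <= d)%N -> scomp h G Q = scomp h H Q.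
Proof.
move=> G0 H0 h2 GH UQ Qd; rewrite !(@scompE _ _ (mlen Q).+1)//.
apply: eq_bigr => P _; have [P2|P2] := ltnP (mlen P) 2; first by rewrite h2 ?mul0r.
congr (_ * _); apply: (@spow_agree _ _ U d) => //; apply/orP; left.
by move: Qd P2; lia.
Qed.

Variables (delta : midx n -> 'I_n -> R) (lam : nat -> R) (Lam : R).
Hypothesis lam_ge0 : forall j, 0 <= lam j.
Hypothesis lam_sum : forall N, \sum_(1 <= j < N) lam j / 2 ^+ j <= Lam.
Hypothesis delta_large : forall j Q s, (0 < j)%N -> U Q ->
  (2 <= mlen Q <= 2 ^ j)%N -> expR (- lam j) <= delta Q s.
Hypothesis delta_sep : forall j P Q s, (0 < j)%N -> mle P Q -> P != Q -> U Q ->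
  (2 <= mlen P)%N -> delta P s < expR (- lam j) -> delta Q s < expR (- lam j) ->
  (mlen P + 2 ^ j <= mlen Q)%N.

(** The estimate for compositions of order 2 carries the factor [d Q], which is at most the divisor
    and cancels it; by the choice of [x] the remaining constant is at most [x], so the ball is
    preserved. *)
Lemma small_divisor_bound phi (K A : R) : 0 < K -> 0 < A ->
  (forall s, sorder 2 (phi s)) -> (forall s Q, ~~ U Q -> phi s Q = 0) ->
  (forall s Q, U Q -> (2 <= mlen Q)%N -> exists h, [/\ sorder 2 h,
    forall P, cmod (h P) <= K * A ^+ mlen P &
    delta Q s * cmod (phi s Q) <= cmod (scomp h (near_id phi) Q)]) ->
  forall s, sbound (phi s).
Proof.
move=> K0 A0 phi2 phiU phiE.
have [C C0 Cw] := divisor_weights lam_ge0 lam_sum delta_large delta_sep.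
have [x [x0 Ax Kx]] := contraction_radius n K0 A0.
have C8 : (0 : R) < 8 ^+ n by rewrite exprn_gt0.
pose y := x / 8 ^+ n; have y0 : 0 < y by rewrite divr_gt0.
pose tau := 4 / y; have t0 : 0 < tau by rewrite divr_gt0.
pose G := near_id phi; have G0 : fixes0 G by exact: fixes0_near_id.
(* For a given [Q], the truncation [J = (mlen Q).+1] is large enough, and the resulting bound
   [y * (C * tau) ^+ mlen Q] no longer involves [J]. *)
suff H J w d : (0 < J)%N -> (forall P, 1 <= w P <= C ^+ mlen P) ->
    (forall P, 0 <= d P <= 1) ->
    (forall P Q, P != 0 -> Q != 0 -> w P * w Q <= d (P + Q) * w (P + Q)) ->
    (forall Q s, U Q -> (2 <= mlen Q <= 2 ^ J)%N -> d Q <= delta Q s) ->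
    forall k s Q, U Q -> (mlen Q <= 2 ^ J)%N -> (mlen Q < k)%N ->
    cmod (G s Q) <= y * majorant w tau Q.
  move=> s; exists y, (C * tau); split=> // [|Q]; first exact: mulr_gt0.
  have CQ0 : 0 <= y * (C * tau) ^+ mlen Q 
    by have y0' := ltW y0; have Ct := ltW (mulr_gt0 C0 t0); nneg.
  have [UQ|/phiU ->] := boolP (U Q); last by rewrite cmod0.
  have [Q2|Q2] := ltnP (mlen Q) 2; first by rewrite phi2// cmod0.
  have QJ : (mlen Q <= 2 ^ (mlen Q).+1)%N by apply: ltnW; rewrite ltnW// ltn_expl.
  have [//|w [d [w1 d1 wM dD]]] := Cw (mlen Q).+1.
  have := H _ w d (ltn0Sn _) w1 d1 wM dD _ s Q UQ QJ (leqnn _).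
  rewrite /G /near_id smap_idE; case: eqP => [e|_]; first by rewrite e mlen_unit in Q2.
  rewrite add0r => /le_trans; apply; rewrite ler_pM2l//.
  have /andP[w1Q wC] := w1 Q; have w0 : 0 <= w Q by apply: le_trans w1Q.
  rewrite /majorant [(C * tau) ^+ _]exprMn -[leRHS]mulr1; apply: ler_pM; rewrite ?vweight_le1//.
  - by nneg.
  - exact/ltW/vweight_gt0.
  - by apply: ler_wpM2r => //; nneg.
move=> J0 w1C d1 wM dD; have w1 P : 1 <= w P by case/andP: (w1C P).
have w0 P : 0 <= w P by apply: le_trans (w1 P).
elim=> [//|k IH] s Q UQ QJ; rewrite ltnS => Qk.
have [Q2|Q2] := ltnP (mlen Q) 2.
  by rewrite /G /near_id phi2// addr0; exact: smap_id_bound.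
have e0 : 0 < delta Q s by apply: lt_le_trans (expR_gt0 _) (delta_large s J0 UQ _); rewrite Q2.
have [h [h2 hB hE]] := phiE s Q UQ Q2.
rewrite /G /near_id smap_idE; case: eqP => [e|_]; first by rewrite e mlen_unit in Q2.
rewrite add0r -(ler_pM2l e0); apply: le_trans hE _.
(* The truncation keeps the degrees covered by the induction hypothesis and vanishes in the others,
   so it obeys the majorant on all of [U']. *)
pose G' s := strunc k (G s).
have G'0 : fixes0 G' by exact: fixes0_strunc.
rewrite (@scomp_agree_order2 k h _ G')// => [|t T UT Tk]; last by rewrite /G' /strunc Tk.
pose U' := [pred Q | U Q && (mlen Q <= 2 ^ J)%N].
have U'down P T : mle P T -> U' T -> U' P.
  move=> PT /andP[UT TJ]; rewrite /U' /= (Udown PT UT) (leq_trans _ TJ)//; exact: mle_mlen.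
have G'B t T : U' T -> cmod (G' t T) <= x / 8 ^+ n * majorant w tau T.
  move=> /andP[UT TJ]; rewrite /G' /strunc; case: ifP => [Tk|_]; first exact: IH.
  by rewrite cmod0 mulr_ge0 ?(ltW y0)//; apply: majorant_ge0 => //; exact: ltW.
have wM' P T : P != 0 -> T != 0 -> U' (P + T) -> w P * w T <= d (P + T) * w (P + T).
  by move=> P0 T0 _; exact: wM.
have UQ' : U' Q by rewrite /U'/= UQ.
have m0 := majorant_ge0 w0 (ltW t0) Q.
apply: le_trans (scomp_bound U'down w0 d1 wM' (ltW t0) (ltW x0) (ltW K0) (ltW A0) Ax
  (isT : (0 < 2)%N) h2 G'0 G'B hB UQ') _.
rewrite [leRHS]mulrCA; apply: ler_pM.
- by have K0' := ltW K0; have A0' := ltW A0; nneg.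
- by apply: mulr_ge0 => //; case/andP: (d1 Q).
- by apply: ler_wpM2r; rewrite ?invr_ge0 ?(ltW C8).
- by apply: ler_wpM2r => //; apply: dD; rewrite ?Q2.
Qed.

End SmallDivisors.

(** * The diophantine condition *)

Section Diophantine.
Variable R : realType.

Lemma sum_geometric_le (a : R) N M : 0 <= a -> \sum_(N <= k < M) a / 2 ^+ k <= 2 * a.
Proof.
move=> a0; rewrite -mulr_sumr mulrC ler_wpM2r//.
apply: (@le_trans _ _ (\sum_(0 <= k < M) 2 ^- k)); last first.
  rewrite big_mkord; apply: le_trans (sum_half R M).
  by apply: ler_sum => k _; rewrite exprVn.
have [NM|MN] := leqP N M; last first.
  by rewrite big_geq ?(ltnW MN)// sumr_ge0// => k _; rewrite invr_ge0 exprn_ge0.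
by rewrite [leRHS](big_cat_nat (n := N))//= lerDr sumr_ge0.
Qed.

(** The positive parts of the terms add up to at most [2 * a], so after a partial sum below
    [A - 2 * a] all later ones stay below [A]; partial sums unbounded below would thus tend to
    [-oo]. *)
Lemma series_lower_bound (u : nat -> \bar R) (a : R) : 0 <= a ->
  (forall k, (0 < k)%N -> (u k <= (a / 2 ^+ k)%:E)%E) ->
  (- \sum_(1 <= k <oo) u k < +oo)%E ->
  exists l : R, forall N, ((- l)%:E <= \sum_(1 <= k < N) u k)%E.
Proof.
move=> a0 ua; apply: contraPP => /forallNP H.
suff -> : (\sum_(1 <= k <oo) u k = -oo)%E by [].
apply/cvg_lim => //; apply/cvgeNyPle => A.
have /existsNP[N /negP] := H (2 * a - A); rewrite -ltNge => SN.
exists (maxn 1 N) => // M /= NM.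
have [N0|N0] := leqP N 1.
  have Aa : 2 * a <= A.
    by move: SN; rewrite big_geq// lte_fin; lra.
  apply: le_trans (_ : (\sum_(1 <= k < M) (a / 2 ^+ k)%:E <= _)%E); last first.
    by rewrite sumEFin lee_fin (le_trans _ Aa)// sum_geometric_le.
  by rewrite big_nat [leRHS]big_nat; apply: lee_sum => k /andP[k1 _]; exact: ua.
have NM' : (N <= M)%N by apply: leq_trans NM; rewrite leq_maxr.
rewrite (big_cat_nat (n := N))//=; last exact: ltnW.
apply: (@le_trans _ _ ((- (2 * a - A))%:E + \sum_(N <= k < M) (a / 2 ^+ k)%:E)%E).
  apply: leeD; first exact: ltW.
  rewrite big_nat [leRHS]big_nat; apply: lee_sum => k /andP[k1 _]; apply: ua.
  by apply: leq_trans k1; exact: ltnW.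
rewrite sumEFin -EFinD lee_fin; have := sum_geometric_le N M a0; lra.
Qed.

Variables (m n : nat) (mu : 'I_m -> 'I_m -> 'rV[Cplx R]_n).

Definition divisor (Q : midx n) (s : 'I_n) : R :=
  \big[Num.max/0]_(p : 'I_m * 'I_m) cmod (eigpow (mu p.1 p.2) Q - mu p.1 p.2 0 s).

Lemma divisor_ge Q s i j :
  cmod (eigpow (mu i j) Q - mu i j 0 s) <= divisor Q s.
Proof.
exact: (le_bigmax 0 (fun p : 'I_m * 'I_m => cmod (eigpow (mu p.1 p.2) Q - mu p.1 p.2 0 s)) (i, j)).
Qed.

Lemma divisor_lt Q s e : 0 < e ->
  (forall i j, cmod (eigpow (mu i j) Q - mu i j 0 s) < e) -> divisor Q s < e.
Proof. by move=> e0 H; apply/bigmax_ltP; split=> // -[i j] _; exact: H. Qed.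

Lemma divisor_attained Q s : 0 < divisor Q s ->
  exists i j, divisor Q s = cmod (eigpow (mu i j) Q - mu i j 0 s).
Proof.
move=> d0; apply/not_existsP => H; suff : divisor Q s < divisor Q s by rewrite ltxx.
apply: divisor_lt => // i j; rewrite lt_neqAle divisor_ge andbT.
by apply/eqP => e; apply: (H i); exists j.
Qed.

Lemma omega_le (S : set (midx n)) k Q s : (2 <= mlen Q <= 2 ^ k)%N -> S Q ->
  divisor Q s != 0 -> (omega mu S k <= (divisor Q s)%:E)%E.
Proof.
move=> Qk SQ dQ; apply: ereal_inf_lbound; exists (divisor Q s) => //; split=> //.
by exists Q, s; split.
Qed.

Lemma omega_finite (S : set (midx n)) Q0 s0 : diophantine mu S ->
  mlen Q0 = 2%N -> S Q0 -> 0 < divisor Q0 s0 ->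
  exists r : nat -> R, exists l : R,
    [/\ forall k, (0 < k)%N -> 0 < r k <= divisor Q0 s0,
        forall k Q s, (0 < k)%N -> (2 <= mlen Q <= 2 ^ k)%N -> S Q -> divisor Q s != 0 ->
          r k <= divisor Q s &
        forall N, - l <= \sum_(1 <= k < N) ln (r k) / 2 ^+ k].
Proof.
move=> dio Q02 SQ0 d0; set b := divisor Q0 s0.
have ob k : (0 < k)%N -> (omega mu S k <= b%:E)%E.
  move=> k0; apply: omega_le => //; last by rewrite gt_eqF.
  by rewrite Q02/= -[2%N]expn1 leq_exp2l.
pose a : R := `|ln b|; have a0 : 0 <= a by exact: normr_ge0.
pose u k := (lne (omega mu S k) * ((2 ^+ k)^-1)%:E)%E.
have uE k : (0 < k)%N -> (u k = -oo)%E \/ exists2 r : R, 0 < r <= b &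
    omega mu S k = r%:E /\ u k = (ln r / 2 ^+ k)%:E.
  move=> k0; have k2 : 0 < (2 ^+ k)^-1 :> R by rewrite invr_gt0 exprn_gt0.
  rewrite /u; have := ob k k0; case: (omega mu S k) => [r rb||_].
  - have [r0|r0] := ltP 0 r; last first.
      by left; rewrite le0_lneNy ?lee_fin// mulNyr gtr0_sg// mul1e.
    right; exists r; first by rewrite r0 -lee_fin.
    by rewrite lne_EFin.
  - by rewrite leye_eq.
  - by left; rewrite le0_lneNy ?leNye// mulNyr gtr0_sg// mul1e.
have ua k : (0 < k)%N -> (u k <= (a / 2 ^+ k)%:E)%E.
  move=> /uE[->|[r /andP[r0 rb] [_ ->]]]; first exact: leNye.
  rewrite lee_fin ler_wpM2r ?invr_ge0 ?exprn_ge0//.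
  apply: le_trans (ler_norm _); rewrite ler_ln ?posrE//.
have [l lP] := series_lower_bound a0 ua dio.
have /choice[r rP] : forall k, exists r : R, (0 < k)%N ->
    [/\ 0 < r <= b, omega mu S k = r%:E & u k = (ln r / 2 ^+ k)%:E].
  move=> k; have [k0|] := posnP k; first by exists 0; rewrite k0.
  move=> k0; have [uk|[r rb [ok uk]]] := uE k k0; last by exists r.
  have := lP k.+1; rewrite big_nat_recr//= uk addeNy.
  by rewrite leeNy_eq.
exists r, l; split=> [k k0|k Q s k0 Qk SQ dQ|N].
- by have [] := rP k k0.
- by have [_ ok _] := rP k k0; have := omega_le Qk SQ dQ; rewrite ok lee_fin.
- have := lP N; rewrite -lee_fin -sumEFin; rewrite [in X in (_ <= X)%E -> _]big_nat.
  rewrite [in X in _ -> (_ <= X)%E]big_nat => /le_trans; apply.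
  by apply: lee_sum => k /andP[k1 _]; have [_ _ <-] := rP k k1.
Qed.

End Diophantine.

(** * Multipliers, non-resonance and differences of divisors *)

Section Multipliers.
Variables (R : realType) (m n : nat) (B : 'I_m -> 'M[Cplx R]_n).
Variables (mu : 'I_m -> 'I_m -> 'rV[Cplx R]_n) (gs : seq (midx n)).
Hypothesis B_unit : forall i, B i \in unitmx.
Hypothesis B_conj : forall i, B i *m mxconj (B i) = 1%:M.
Hypothesis D_diag : forall i j, B i *m mxconj (B j) = diag_mx (mu i j).
Hypothesis nonres : nonresonant_on mu gs.
Implicit Types P Q : midx n.

Lemma mxconjM (p q r : nat) (X : 'M[Cplx R]_(p, q)) (Y : 'M[Cplx R]_(q, r)) :
  mxconj (X *m Y) = mxconj X *m mxconj Y.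
Proof. by rewrite /mxconj map_mxM. Qed.

Lemma mu_inv i j s : mu i j 0 s * mu j i 0 s = 1.
Proof.
have : diag_mx (mu i j) *m diag_mx (mu j i) = 1%:M.
  rewrite -!D_diag -mulmxA [mxconj _ *m (_ *m _)]mulmxA.
  have -> : mxconj (B j) *m B j = 1%:M.
    have := congr1 (@mxconj _ _ _) (B_conj j); rewrite mxconjM mxconjK => ->.
    by rewrite /mxconj map_mx1.
  by rewrite mul1mx B_conj.
by move=> /matrixP/(_ s s); rewrite mulmx_diag !mxE eqxx !mulr1n.
Qed.

Lemma mu_neq0 i j s : mu i j 0 s != 0.
Proof. by apply/eqP => e; have /eqP := mu_inv i j s; rewrite e mul0r eq_sym oner_eq0. Qed.

Lemma muV i j s : (mu i j 0 s)^-1 = mu j i 0 s.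
Proof. by apply: (mulfI (mu_neq0 i j s)); rewrite mulfV ?mu_neq0// mu_inv. Qed.

Lemma eigpowD (nu : 'rV[Cplx R]_n) P Q : eigpow nu (P + Q) = eigpow nu P * eigpow nu Q.
Proof. by rewrite -big_split; apply: eq_bigr => i _; rewrite ffunE exprD. Qed.

Lemma eigpow_unit (nu : 'rV[Cplx R]_n) s : eigpow nu (midx_unit s) = nu 0 s.
Proof.
rewrite /eigpow (bigD1 s)//= ffunE eqxx expr1 big1 ?mulr1// => j /negPf js.
by rewrite ffunE js.
Qed.

(** Both [D_ij B_i] and [B_i conj(D_ji)] equal [B_i conj(B_j) B_i]; the matrices [D] being diagonal,
    the entry [(k, s)] can be compared. *)
Lemma B_intertwines i j k s :
  B i k s != 0 -> mu i j 0 k = (mu j i 0 s)^*.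
Proof.
move=> Bks; have : diag_mx (mu i j) *m B i = B i *m mxconj (diag_mx (mu j i)).
  by rewrite -!D_diag mxconjM mxconjK mulmxA.
move=> /matrixP/(_ k s).
rewrite !mxE (bigD1 k)//= mxE eqxx mulr1n big1 => [|l /negPf lk]; last first.
  by rewrite mxE eq_sym lk mulr0n mul0r.
rewrite addr0 (bigD1 s)//= !mxE eqxx mulr1n big1 => [|l /negPf ls]; last first.
  by rewrite !mxE ls mulr0n rmorph0 mulr0.
by rewrite addr0 mulrC => /(mulfI Bks).
Qed.

(** Non-resonance is applied not at [s] but at a row [k] with [B i0 k s != 0]: by [B_intertwines], a
    zero divisor at [(Q, s)] would give [conj(mu_i0j^Q) = mu_i0j,k^-1] for all [j]. *)
Lemma divisor_gt0 (i0 : 'I_m) Q s : out gs Q -> (2 <= mlen Q)%N -> 0 < divisor mu Q s.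
Proof.
move=> Qout Q2; rewrite lt_neqAle (le_trans _ (divisor_ge mu Q s i0 i0)) ?cmod_ge0// andbT.
apply/eqP => d0.
have E j : eigpow (mu i0 j) Q = mu i0 j 0 s.
  apply/eqP; rewrite -subr_eq0 -cmod_eq0 eq_le cmod_ge0 andbT d0; exact: divisor_ge.
have /existsP[k Bk] : [exists k, B i0 k s != 0].
  rewrite -[X in is_true X]negbK negb_exists; apply/negP => /forallP Bz.
  have /matrixP/(_ s s) := mulVmx (B_unit i0).
  rewrite !mxE eqxx big1 => [/eqP|k _]; first by rewrite eq_sym oner_eq0.
  by have := Bz k; rewrite negbK => /eqP ->; rewrite mulr0.
have [j /eqP] := nonres ((outsideP R gs Q).2 Qout) Q2 i0 k; apply.
by rewrite E (B_intertwines j Bk) -fmorphV muV.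
Qed.

Lemma mu_bounds : exists2 b : R, 1 <= b &
  forall i j s, cmod (mu i j 0 s) <= b /\ b^-1 <= cmod (mu i j 0 s).
Proof.
pose b : R := 1 + \sum_i \sum_j \sum_s cmod (mu i j 0 s).
have S0 : forall i j, 0 <= \sum_s cmod (mu i j 0 s).
  by move=> i j; apply: sumr_ge0 => s _; exact: cmod_ge0.
have b1 : 1 <= b by rewrite lerDl sumr_ge0// => i _; apply: sumr_ge0 => j _; exact: S0.
have bm i j s : cmod (mu i j 0 s) <= b.
  have term (I : finType) (F : I -> R) a : (forall a, 0 <= F a) -> F a <= \sum_a F a.
    by move=> F0; rewrite (bigD1 a)//= lerDl sumr_ge0.
  apply: le_trans (term _ (fun s => cmod (mu i j 0 s)) s (fun=> cmod_ge0 _)) _.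
  apply: le_trans (term _ (fun j => \sum_s cmod (mu i j 0 s)) j (S0 i)) _.
  apply: le_trans (term _ (fun i => \sum_j \sum_s cmod (mu i j 0 s)) i _) _.
    by move=> i'; apply: sumr_ge0 => j' _; exact: S0.
  by rewrite lerDr.
exists b => // i j s; split=> //; have b0 : 0 < b by exact: lt_le_trans b1.
rewrite -[leRHS]invrK -cmodV muV lef_pV2 ?posrE// lt_neqAle cmod_ge0 andbT.
by rewrite eq_sym cmod_eq0 mu_neq0.
Qed.

(** With [p] and [q] the multipliers of [P] and [Q - P], both [p] and [p * q] are [e]-close to
    [mu_s]. Hence [|p| |q - 1| < 2 e], where [|p|] is at least [(2 * b)^-1]; multiplying [q - 1] by
    [mu_k] costs one more [b]. *)
Lemma divisor_difference (b e : R) P Q k s : 1 <= b ->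
  (forall i j s, cmod (mu i j 0 s) <= b /\ b^-1 <= cmod (mu i j 0 s)) ->
  0 < e -> e <= (2 * b)^-1 -> mle P Q ->
  divisor mu P s < e -> divisor mu Q s < e ->
  divisor mu (msub Q P + midx_unit k) k < 4 * b ^+ 2 * e.
Proof.
move=> b1 mub e0 eb PQ dP dQ; have b0 : 0 < b by exact: lt_le_trans b1.
apply: divisor_lt => [|i j]; first by rewrite !mulr_gt0// exprn_gt0.
have hP := le_lt_trans (divisor_ge mu P s i j) dP.
have hQ := le_lt_trans (divisor_ge mu Q s i j) dQ.
rewrite eigpowD eigpow_unit.
move: hP hQ; rewrite -[in eigpow _ Q](msubKC PQ) eigpowD.
set p := eigpow _ P; set q := eigpow _ (msub Q P); set ms := mu i j 0 s => hP hQ.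
have [mkb _] := mub i j k; have [_ msb] := mub i j s.
have pb : (2 * b)^-1 <= cmod p.
  have e2 : b^-1 = (2 * b)^-1 + (2 * b)^-1 by field; rewrite gt_eqF.
  have := cmodD (ms - p) p; rewrite subrK cmodB.
  by move: msb hP eb; rewrite -/ms e2; lra.
have pq : cmod p * cmod (q - 1) < 2 * e.
  rewrite -cmodM mulrBr mulr1; have := cmodD (p * q - ms) (ms - p); rewrite subrKA.
  by rewrite (cmodB ms); lra.
have q1 : cmod (q - 1) < 4 * b * e.
  have : (2 * b)^-1 * cmod (q - 1) < 2 * e.
    by apply: le_lt_trans pq; apply: ler_wpM2r => //; exact: cmod_ge0.
  by rewrite mulrC ltr_pdivrMr ?mulr_gt0//; lra.
rewrite (_ : q * _ - _ = mu i j 0 k * (q - 1)); last by ring.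
rewrite cmodM; apply: (@le_lt_trans _ _ (b * cmod (q - 1))).
  by apply: ler_wpM2r => //; exact: cmod_ge0.
by rewrite -(ltr_pM2l b0) in q1; apply: lt_le_trans q1 _; rewrite le_eqVlt; apply/orP; left; apply/eqP; ring.
Qed.

(** The index [Q - P + e_k] may lie in the ideal, where [divisor_gt0] is silent. But a zero divisor
    there forces [mu_ij^(Q - P) = 1] for all [i], [j], hence also a zero divisor at
    [(Q - P + e_l, l)]; for [P l > 0] that index divides [Q] and is outside. *)
Lemma divisor_difference_neq0 (i0 : 'I_m) P Q k : out gs Q -> mle P Q -> P != Q -> P != 0 ->
  divisor mu (msub Q P + midx_unit k) k != 0.
Proof.
move=> Qout PQ PnQ P0; apply/eqP => d0.
have q1 i j : eigpow (mu i j) (msub Q P) = 1.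
  have : cmod (eigpow (mu i j) (msub Q P + midx_unit k) - mu i j 0 k) == 0.
    by rewrite eq_le cmod_ge0 andbT -d0 divisor_ge.
  rewrite cmod_eq0 subr_eq0 eigpowD eigpow_unit => /eqP/(congr1 (fun x => x / mu i j 0 k)).
  by rewrite -mulrA mulfV ?mu_neq0// mulr1.
have /existsP[l Pl] : [exists l, (0 < P l)%N].
  rewrite -[X in is_true X]negbK negb_exists; apply/negP => /forallP Pz.
  case/eqP: P0; apply/ffunP => l; have := Pz l; rewrite -eqn0Ngt ffunE => /eqP; exact.
have sPQ := mlen_msub PQ.
have lPQ : (mlen P < mlen Q)%N.
  rewrite ltn_neqAle mle_mlen// andbT; apply: contra PnQ => /eqP e; apply/eqP.
  exact: mle_eqlen.
have TQ : mle (msub Q P + midx_unit l) Q.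
  apply/mleP => i; rewrite !ffunE; have /mleP/(_ i) := PQ; case: eqP => [->|_] /=.
    by move: Pl; rewrite -[_ + _]/(_ + _)%N; lia.
  by rewrite addr0 => _; exact: leq_subr.
have := @divisor_gt0 i0 _ l (out_down TQ Qout).
rewrite mlenD mlen_unit => /(_ _)/lt0r_neq0/eqP; apply; first by lia.
apply/eqP; rewrite eq_le; apply/andP; split; last first.
  by apply: le_trans (divisor_ge mu _ l i0 i0); exact: cmod_ge0.
rewrite /divisor; elim/big_ind: _ => //= [x y x0 y0|p _]; first by rewrite ge_max x0.
by rewrite eigpowD q1 eigpow_unit mul1r subrr cmod0.
Qed.

(* The shift by the unit [k] is where proper embeddedness enters: the divisor at
   [Q - P + e_k] must be among those controlled by the diophantine condition. *)
Lemma diophantine_scale (S : set (midx n)) (i0 : 'I_m) (k : 'I_n) Q0 :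
  diophantine mu S -> (forall Q, out gs Q -> S Q) ->
  (forall Q, out gs Q -> S (Q + midx_unit k)) -> out gs Q0 -> mlen Q0 = 2%N ->
  exists (lam : nat -> R) (Lam : R),
    [/\ forall j, 0 <= lam j,
        forall N, \sum_(1 <= j < N) lam j / 2 ^+ j <= Lam,
        forall j Q s, (0 < j)%N -> out gs Q -> (2 <= mlen Q <= 2 ^ j)%N ->
          expR (- lam j) <= divisor mu Q s &
        forall j P Q s, (0 < j)%N -> mle P Q -> P != Q -> out gs Q ->
          (2 <= mlen P)%N -> divisor mu P s < expR (- lam j) ->
          divisor mu Q s < expR (- lam j) -> (mlen P + 2 ^ j <= mlen Q)%N].
Proof.
move=> dio SU SUk Q0out Q02.
have d0 : 0 < divisor mu Q0 k by apply: (divisor_gt0 i0) => //; rewrite Q02.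
have [r [l [rw rd rl]]] := omega_finite dio Q02 (SU _ Q0out) d0.
set w := divisor mu Q0 k in d0 rw; have [b b1 mub] := mu_bounds.
have b0 : 0 < b by exact: lt_le_trans b1.
have b2 : 1 <= b ^+ 2 by rewrite exprn_ege1.
(* The thresholds are [r j / v]: the factor [4 * b ^+ 2] undoes the loss in [divisor_difference],
   and [1 + w], with [w] above all [r j], keeps them at most 1 and at most [(2 * b)^-1]. *)
pose v := 4 * b ^+ 2 * (1 + w); have v1 : 1 <= v.
  by rewrite /v; nra.
have v0 : 0 < v by exact: lt_le_trans v1.
pose lam j := if j is 0 then 0 else - ln (r j / v).
have r0 j : (0 < j)%N -> 0 < r j by move=> /rw/andP[].
have lamE j : (0 < j)%N -> expR (- lam j) = r j / v.
  by case: j => // j _; rewrite opprK lnK// posrE divr_gt0// r0.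
have lnv : 0 <= ln v by rewrite ln_ge0.
have lamE' j : (0 < j)%N -> lam j = ln v - ln (r j).
  by case: j => // j _; rewrite /lam ln_div ?posrE ?r0// opprB.
exists lam, (l + 2 * ln v); split.
- case=> [//|j]; rewrite /lam oppr_ge0 -ln1 ler_ln ?posrE ?divr_gt0 ?r0//.
  rewrite ler_pdivrMr// mul1r; have /andP[_ rjw] := rw j.+1 isT.
  by apply: le_trans rjw _; rewrite /v; nra.
- move=> N; have := rl N; have := sum_geometric_le 1 N lnv.
  have -> : \sum_(1 <= j < N) lam j / 2 ^+ j =
      \sum_(1 <= j < N) ln v / 2 ^+ j - \sum_(1 <= j < N) ln (r j) / 2 ^+ j.
    rewrite -sumrB big_nat [RHS]big_nat; apply: eq_bigr => j /andP[j0 _].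
    by rewrite lamE'// mulrBl.
  lra.
- move=> j Q s j0 Qout Qj; rewrite lamE//.
  have dQ : divisor mu Q s != 0.
    by rewrite gt_eqF// (divisor_gt0 i0)//; case/andP: Qj.
  apply: le_trans (rd j Q s j0 Qj (SU _ Qout) dQ).
  by rewrite ler_pdivrMr// ler_peMr// ltW// r0.
move=> j P Q s j0 PQ PnQ Qout P2; rewrite lamE// => dP dQ.
have e0 : 0 < r j / v by rewrite divr_gt0// r0.
have /andP[rj0 rjw] := rw j j0.
have eb : r j / v <= (2 * b)^-1.
  rewrite ler_pdivrMr// mulrC ler_pdivlMr ?mulr_gt0//.
  have bb : b <= b ^+ 2 by rewrite expr2; apply: ler_peMl => //; exact: ltW.
  have wb : 0 <= w * (b ^+ 2 - b) by apply: mulr_ge0; [exact: ltW|rewrite subr_ge0].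
  have h : 0 <= (w - r j) * b by apply: mulr_ge0; [rewrite subr_ge0|exact: ltW].
  have wb0 : 0 <= w * b ^+ 2 by apply: mulr_ge0; [exact: ltW|exact/exprn_ge0/ltW].
  by rewrite /v; lra.
have P0 : P != 0 by rewrite -mlen_eq0 -lt0n (leq_trans _ P2).
have dT := divisor_difference k b1 mub e0 eb PQ dP dQ.
have dT0 := divisor_difference_neq0 i0 k Qout PQ PnQ P0.
have sPQ := mlen_msub PQ.
have lPQ : (mlen P < mlen Q)%N.
  rewrite ltn_neqAle mle_mlen// andbT; apply: contra PnQ => /eqP e; apply/eqP.
  exact: mle_eqlen.
set T := msub Q P + _ in dT dT0.
have TE : mlen T = (mlen (msub Q P)).+1 by rewrite mlenD mlen_unit addn1.
(* Since [T] is one longer than [Q - P], excluding [mlen T <= 2 ^ j] gives the separation [2 ^ j]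
   without loss. *)
have [Tj|Tj] := leqP (mlen T) (2 ^ j); last first.
  by move: Tj sPQ; rewrite TE; clear; lia.
have T2 : (2 <= mlen T <= 2 ^ j)%N.
  by rewrite Tj andbT TE; move: lPQ sPQ; clear; lia.
have := rd j T k j0 T2 (SUk _ (out_down (mle_msub P Q) Qout)) dT0.
rewrite leNgt => /negP; case; apply: lt_le_trans dT _.
rewrite mulrA ler_pdivrMr// mulrC ler_pM2l// /v ler_peMr//; last by rewrite lerDl ltW.
by apply: mulr_ge0 => //; exact/exprn_ge0/ltW.
Qed.

End Multipliers.

(** * Jets, conjugation and germs of maps *)

Section Jets.
Variables (R : realType) (n : nat).
Implicit Types (F G : smap R n) (A : 'M[Cplx R]_n) (P Q : midx n).

Lemma smap_lin_unit A s t : smap_lin A s (midx_unit t) = A s t.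
Proof.
rewrite /smap_lin (bigD1 t)//= eqxx mulr1 big1 ?addr0// => j /negPf jt.
by rewrite (inj_eq (@midx_unit_inj n)) eq_sym jt mulr0.
Qed.

Lemma smap_lin_eq0 A s Q : mlen Q != 1%N -> smap_lin A s Q = 0.
Proof.
move=> Q1; rewrite /smap_lin big1// => j _; case: eqP => [e|_]; last by rewrite mulr0.
by rewrite e mlen_unit in Q1.
Qed.

Lemma jac_lin A : jac (smap_lin A) = A.
Proof. by apply/matrixP => s t; rewrite mxE smap_lin_unit. Qed.

Lemma first_jet F s Q : fixes0 F -> (mlen Q < 2)%N -> F s Q = smap_lin (jac F) s Q.
Proof.
move=> F0; case Q1 : (mlen Q) => [|[|//]] _.
  have /eqP Q0 : Q == 0 by rewrite -mlen_eq0 Q1.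
  by rewrite Q0 F0 fixes0_lin.
by have [t ->] := mlen1P Q1; rewrite smap_lin_unit mxE.
Qed.

Lemma sorder2_nonlinear F s : fixes0 F ->
  sorder 2 (fun Q => F s Q - smap_lin (jac F) s Q).
Proof. by move=> F0 Q Q2; rewrite -first_jet// subrr. Qed.

Lemma scomp_split F G s Q : fixes0 G ->
  scomp (F s) G Q = \sum_t jac F s t * G t Q +
    scomp (fun P => F s P - smap_lin (jac F) s P) G Q.
Proof.
move=> G0; rewrite -scomp_lin// -scompD; congr scomp.
by apply/funext => P; rewrite addrC subrK.
Qed.

Lemma jac_comp F G : fixes0 F -> fixes0 G -> jac (smap_comp F G) = jac F *m jac G.
Proof.
move=> F0 G0; apply/matrixP => s t; rewrite !mxE /smap_comp scomp_split//.
rewrite (sorder_scomp G0 (sorder2_nonlinear s F0)) ?mlen_unit// addr0.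
by apply: eq_bigr => k _; rewrite !mxE.
Qed.

Lemma jac_near_id F : (forall s, sorder 2 (F s)) -> jac (near_id F) = 1%:M.
Proof.
move=> F2; apply/matrixP => s t.
by rewrite mxE /near_id F2 ?mlen_unit// addr0 /smap_id smap_lin_unit.
Qed.

Definition smap_conj F : smap R n := fun s => sconj (F s).

Lemma smap_conjK F : smap_conj (smap_conj F) = F.
Proof. by apply/funext => s; apply/funext => Q; rewrite /smap_conj /sconj conjCK. Qed.

Lemma fixes0_conj F : fixes0 F -> fixes0 (smap_conj F).
Proof. by move=> F0 s; rewrite /smap_conj /sconj F0 conjC0. Qed.

Lemma jac_conj F : jac (smap_conj F) = mxconj (jac F).
Proof. by apply/matrixP => s t; rewrite !mxE. Qed.

Lemma smap_conj_lin A : smap_conj (smap_lin A) = smap_lin (mxconj A).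
Proof.
apply/funext => s; apply/funext => Q; rewrite /smap_conj /sconj /smap_lin rmorph_sum.
by apply: eq_bigr => j _; rewrite rmorphM/= conjC_nat mxE.
Qed.

Lemma sconj_smul (f g : fps R n) : sconj (smul f g) = smul (sconj f) (sconj g).
Proof.
apply/funext => Q; rewrite /sconj /smul rmorph_sum.
by apply: eq_bigr => P _; rewrite rmorphM.
Qed.

Lemma sconj_spow F Q : sconj (spow F Q) = spow (smap_conj F) Q.
Proof.
symmetry; apply: (@spow_ind2 R n (fun _ f f' => f' = sconj f)) => //.
  by apply/funext => P; rewrite /sconj /smonom conjC_nat.
by move=> k l f f' g g' -> ->; rewrite sconj_smul.
Qed.

Lemma smap_conj_comp F G : smap_conj (smap_comp F G) = smap_comp (smap_conj F) (smap_conj G).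
Proof.
apply/funext => s; apply/funext => Q; rewrite /smap_conj /smap_comp /scomp {1}/sconj rmorph_sum.
by apply: eq_bigr => P _; rewrite rmorphM/= -sconj_spow.
Qed.

Lemma smap_conj_id : smap_conj (@smap_id R n) = @smap_id R n.
Proof. by rewrite /smap_id smap_conj_lin /mxconj map_mx1. Qed.

Lemma midx_below Q k : (k <= mlen Q)%N -> exists2 P, mle P Q & mlen P = k.
Proof.
elim: k => [|k IH] kQ; first by exists 0; [exact: mle0|exact: mlen0].
have [P PQ Pk] := IH (ltnW kQ).
have /existsP[l lP] : [exists l, (P l < Q l)%N].
  rewrite -[X in is_true X]negbK negb_exists; apply/negP => /forallP H.
  move: kQ; rewrite -Pk ltnNge => /negP; apply; apply: leq_sum => i _.
  by rewrite leqNgt.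
exists (P + midx_unit l); last by rewrite mlenD mlen_unit Pk addn1.
apply/mleP => i; rewrite !ffunE; case: eqP => [->|_] /=.
  by rewrite -[_ + _]/(_ + _)%N addn1.
by rewrite addr0; apply/mleP.
Qed.

End Jets.

(** * Germs of holomorphic maps *)

Section GermMaps.
Variables (R : realType) (n : nat).
Implicit Types (F G : 'cV[Cplx R]_n -> 'cV[Cplx R]_n) (f g : smap R n).

Lemma has_taylor_map_lin (A : 'M[Cplx R]_n) : has_taylor_map (mulmx A) (smap_lin A).
Proof. by move=> s; exact: has_taylor_lin. Qed.

Lemma has_taylor_map_id : has_taylor_map (fun z : 'cV[Cplx R]_n => z) (@smap_id R n).
Proof.
move=> s; apply: (has_taylor_eq (has_taylor_lin 1%:M s)).
by apply/near0P; exists 1 => // z _; rewrite mul1mx.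
Qed.

Lemma has_taylor_mapD F G f g : has_taylor_map F f -> has_taylor_map G g ->
  has_taylor_map (fun z => F z + G z) (fun s Q => f s Q + g s Q).
Proof.
move=> Ff Gg s; apply: (has_taylor_eq (has_taylorD (Ff s) (Gg s))).
by apply/near0P; exists 1 => // z _; rewrite mxE.
Qed.

Lemma has_taylor_mapB F G f g : has_taylor_map F f -> has_taylor_map G g ->
  has_taylor_map (fun z => F z - G z) (fun s Q => f s Q - g s Q).
Proof.
move=> Ff Gg s.
have -> : (fun Q => f s Q - g s Q) = (fun Q => f s Q + (-1) * g s Q).
  by apply/funext => Q; rewrite mulN1r.
apply: (has_taylor_eq (has_taylorD (Ff s) (has_taylorZ (-1) (Gg s)))).
by apply/near0P; exists 1 => // z _; rewrite !mxE mulN1r.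
Qed.

Lemma has_taylor_map_conj F f : has_taylor_map F f ->
  has_taylor_map (fun z => mxconj (F (mxconj z))) (smap_conj f).
Proof.
move=> Ff s; apply: (has_taylor_eq (has_taylor_conj (Ff s))).
by apply/near0P; exists 1 => // z _; rewrite mxE.
Qed.

Lemma taylor_map_unique F f g : has_taylor_map F f -> has_taylor_map F g -> f = g.
Proof. by move=> Ff Fg; apply/funext => s; exact: taylor_unique (Ff s) (Fg s). Qed.

Lemma taylor_map_germ F G f : has_taylor_map F f -> has_taylor_map G f ->
  \forall z \near (0 : 'cV[Cplx R]_n), F z = G z.
Proof.
move=> Ff Gf; have H : \forall z \near (0 : 'cV[Cplx R]_n), forall s, F z s 0 = G z s 0.
  exact: (filter_forall _ (fun s => taylor_germ (Ff s) (Gf s))).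
by apply: filterS H => z Hz; apply/matrixP => s j; rewrite ord1.
Qed.

Lemma germ_map_exists f : (forall s, sbound (f s)) -> exists F, has_taylor_map F f.
Proof.
move=> fB; have /choice[a ab] : forall s, exists a, has_taylor a (f s).
  by move=> s; exact: germ_exists.
exists (fun z => \col_s a s z) => s; apply: (has_taylor_eq (ab s)).
by apply/near0P; exists 1 => // z _; rewrite mxE.
Qed.

Lemma taylor_map_at0 F f : has_taylor_map F f -> fixes0 f -> F 0 = 0.
Proof.
move=> Ff f0; apply/matrixP => s j; rewrite ord1 (taylor_at0 (Ff s)) f0 mxE//.
Qed.

Lemma holo_diffeo_taylor F G f g : has_taylor_map F f -> has_taylor_map G g ->
  fixes0 f -> fixes0 g -> smap_comp f g = @smap_id R n -> smap_comp g f = @smap_id R n ->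
  holo_diffeo F G.
Proof.
move=> Ff Gg f0 g0 fg gf; split.
- by split; [exists f|exact: taylor_map_at0 Ff f0].
- by split; [exists g|exact: taylor_map_at0 Gg g0].
- apply: taylor_map_germ has_taylor_map_id.
  by rewrite -fg; exact: has_taylor_map_comp.
- apply: taylor_map_germ has_taylor_map_id.
  by rewrite -gf; exact: has_taylor_map_comp.
Qed.

End GermMaps.

(** * Linearization *)

(* With [Ps] inverse to [P] and [c] for conjugation: the conjugate [h] of [rho_i]
   satisfies [h o conj (Ps F_ji P) = (Ps F_ij P) o h]. *)
Lemma intertwine_formal (R : realType) (n : nat) (P Ps Pc Psc r r' : smap R n) :
  fixes0 P -> fixes0 Ps -> fixes0 Pc -> fixes0 Psc -> fixes0 r -> fixes0 r' ->
  smap_comp Pc Psc = @smap_id R n -> smap_comp P Ps = @smap_id R n ->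
  smap_comp (smap_comp Ps (smap_comp r Pc)) (smap_comp Psc (smap_comp (smap_comp r' r) Pc)) =
  smap_comp (smap_comp Ps (smap_comp (smap_comp r r') P)) (smap_comp Ps (smap_comp r Pc)).
Proof.
move=> P0 Ps0 Pc0 Psc0 r0 r'0 E E'.
have rP0 := fixes0_comp r0 Pc0; have r'rP0 := fixes0_comp r'0 rP0.
have PsrP0 := fixes0_comp Ps0 rP0.
rewrite (smap_compA r' r0 Pc0) (smap_compA r r'0 P0).
transitivity (smap_comp Ps (smap_comp r (smap_comp r' (smap_comp r Pc)))).
  rewrite (smap_compA Ps rP0 (fixes0_comp Psc0 r'rP0)).
  rewrite (smap_compA r Pc0 (fixes0_comp Psc0 r'rP0)).
  by rewrite -(smap_compA Pc Psc0 r'rP0) E smap_id_comp.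
rewrite (smap_compA Ps (fixes0_comp r0 (fixes0_comp r'0 P0)) PsrP0).
rewrite (smap_compA r (fixes0_comp r'0 P0) PsrP0) (smap_compA r' P0 PsrP0).
by rewrite -(smap_compA P Ps0 rP0) E' smap_id_comp.
Qed.

Section Linearization.
Variables (R : realType) (m n : nat) (B : 'I_m -> 'M[Cplx R]_n).
Variables (mu : 'I_m -> 'I_m -> 'rV[Cplx R]_n) (gs : seq (midx n)).
Hypothesis B_unit : forall i, B i \in unitmx.
Hypothesis B_conj : forall i, B i *m mxconj (B i) = 1%:M.
Hypothesis D_diag : forall i j, B i *m mxconj (B j) = diag_mx (mu i j).
Hypothesis nonres : nonresonant_on mu gs.
Variable i0 : 'I_m.
Implicit Types (P Q : midx n).

(* The germ of [rho i] at [z] is the sum of the series [rb i] at the conjugate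
   of [z]; hence [F_ij] is the composite of [rb i] with the conjugate of [rb j]. *)
Variable rb : 'I_m -> smap R n.
Hypothesis rb0 : forall i, fixes0 (rb i).
Hypothesis rb_jac : forall i, jac (rb i) = B i.
Hypothesis rb_bound : forall i s, sbound (rb i s).

Definition pair_series i j := smap_comp (rb i) (smap_conj (rb j)).

Lemma fixes0_pair i j : fixes0 (pair_series i j).
Proof. by apply: fixes0_comp => //; exact: fixes0_conj. Qed.

Lemma jac_pair i j : jac (pair_series i j) = diag_mx (mu i j).
Proof. by rewrite jac_comp ?jac_conj ?rb_jac//; exact: fixes0_conj. Qed.

Lemma sbound_conj (f : fps R n) : sbound f -> sbound (sconj f).
Proof.
by move=> [K [A [K0 A0 fB]]]; exists K, A; split=> // Q; rewrite cmod_conj.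
Qed.

Lemma sbound_comp (F G : smap R n) : fixes0 G -> (forall s, sbound (F s)) ->
  (forall s, sbound (G s)) -> forall s, sbound (smap_comp F G s).
Proof. by move=> G0 FB GB s; exact: sbound_scomp. Qed.

Lemma sbound_pair i j s : sbound (pair_series i j s).
Proof.
apply: sbound_comp => //; first exact: fixes0_conj.
by move=> t; apply: sbound_conj; exact: rb_bound.
Qed.

Lemma diag_sum (nu : 'rV[Cplx R]_n) s (v : 'I_n -> Cplx R) :
  \sum_t diag_mx nu s t * v t = nu 0 s * v s.
Proof.
rewrite (bigD1 s)//= mxE eqxx mulr1n big1 ?addr0// => t /negPf ts.
by rewrite mxE eq_sym ts mulr0n mul0r.
Qed.

(** * Bounds for the coefficients outside the ideal *)

Section NormalizedLinearization.
Variables Phih Psih : smap R n.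
Hypothesis Phih_id : smap_tangent_id Phih.
Hypothesis Psih0 : fixes0 Psih.
Hypothesis PhihPsih : smap_comp Phih Psih = @smap_id R n.
Hypothesis conj_out : forall i j s, vanish_out gs (fun Q =>
  smap_comp Psih (smap_comp (pair_series i j) Phih) s Q - smap_lin (diag_mx (mu i j)) s Q).

Definition outer_part : smap R n :=
  fun s Q => if out gs Q && (1 < mlen Q)%N then Phih s Q else 0.

Lemma sorder_outer s : sorder 2 (outer_part s).
Proof. by move=> Q Q2; rewrite /outer_part [(1 < _)%N]ltnNge -ltnS Q2 andbF. Qed.

Lemma outer_agree s Q : out gs Q -> Phih s Q = near_id outer_part s Q.
Proof.
move=> Qout; have [P0 PJ] := Phih_id; have [Q2|Q2] := ltnP (mlen Q) 2.
  rewrite (first_jet _ P0 Q2) PJ (first_jet _ (fixes0_near_id sorder_outer) Q2).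
  by rewrite (jac_near_id sorder_outer).
rewrite /near_id /outer_part Qout Q2 /smap_id smap_lin_eq0 ?add0r//.
by apply: contraTneq Q2 => ->.
Qed.

(** From [F o Phih = Phih o (Psih o F o Phih)], where the last factor is [D] outside the ideal. By
    [scomp_agree], the inner [Phih] may be replaced by its outer part. *)
Lemma outer_equation i j s Q : out gs Q ->
  smap_comp (pair_series i j) (near_id outer_part) s Q =
    eigpow (mu i j) Q * near_id outer_part s Q.
Proof.
move=> Qout; have [P0 PJ] := Phih_id.
have F0 := fixes0_pair i j; have O0 := fixes0_near_id sorder_outer.
have FP0 := fixes0_comp F0 P0; have SFP0 := fixes0_comp Psih0 FP0.
have L0 := @fixes0_lin R n (diag_mx (mu i j)).
rewrite -outer_agree// -scomp_diag.
transitivity (smap_comp (pair_series i j) Phih s Q).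
  apply: (@scomp_agree _ _ (out gs)) => //; first exact: out_down.
  by move=> t T Tout _; rewrite outer_agree.
rewrite -[smap_comp _ Phih]smap_id_comp// -PhihPsih smap_compA//.
apply: (@scomp_agree _ _ (out gs)) => //; first exact: out_down.
by move=> t T Tout _; apply/eqP; rewrite -subr_eq0; apply/eqP; exact: conj_out.
Qed.

(** Of the equations for all pairs, only the one attaining the divisor is kept. The pair depends on
    [(Q, s)], so its nonlinear part has to be bounded uniformly in [i] and [j]. *)
Lemma outer_divisor s Q : out gs Q -> (2 <= mlen Q)%N ->
  exists i j, divisor mu Q s * cmod (outer_part s Q) =
    cmod (scomp (fun P => pair_series i j s P - smap_lin (diag_mx (mu i j)) s P)
      (near_id outer_part) Q).
Proof.
move=> Qout Q2; have O0 := fixes0_near_id sorder_outer.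
have [i [j ->]] := divisor_attained (divisor_gt0 B_unit B_conj D_diag nonres i0 s Qout Q2).
exists i, j; rewrite -cmodM; congr cmod.
have := outer_equation i j s Qout; rewrite /smap_comp scomp_split// jac_pair diag_sum.
have -> : near_id outer_part s Q = outer_part s Q.
  by rewrite /near_id /smap_id smap_lin_eq0 ?add0r//; apply: contraTneq Q2 => ->.
by move=> /(canRL (addKr _)) ->; ring.
Qed.

Lemma outer_sbound :
  (diophantine mu setT \/
   properly_embedded R gs /\ diophantine mu (outside_ideal R gs)) ->
  forall s, sbound (outer_part s).
Proof.
move=> dio s; have n0 : (0 < n)%N by case: n s {dio} => [[]|].
(* If no exponent of degree 2 is outside the ideal, none of higher degree is, and the outer part is
   zero; otherwise [Q0] provides the upper bound required by [omega_finite]. *)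
have [[Q0 Q0out Q02]|none] := pselect (exists2 Q, out gs Q & mlen Q = 2%N); last first.
  apply: (@sbound_supp _ _ 0) => Q _; rewrite /outer_part; case: ifP => // /andP[Qout Q2].
  have [T TQ T2] := midx_below Q2; case: none; exists T => //.
  exact: out_down Qout.
have [S [k [dS SU SUk]]] : exists (S : set (midx n)) (k : 'I_n), [/\ diophantine mu S,
    forall Q, out gs Q -> S Q & forall Q, out gs Q -> S (Q + midx_unit k)].
  case: dio => [dio|[pe dio]]; first by exists setT, s.
  have [k kP] := properly_embedded_shift pe n0.
  exists (outside_ideal R gs), k; split=> // Q Qout; apply/outsideP => //.
  exact: kP.
have [lam [Lam [lam0 lamS large sep]]] := diophantine_scale B_unit B_conj D_diag nonres i0 dS SU SUk Q0out Q02.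
pose h (p : 'I_m * 'I_m * 'I_n) P :=
  pair_series p.1.1 p.1.2 p.2 P - smap_lin (diag_mx (mu p.1.1 p.1.2)) p.2 P.
have hB p : sbound (h p).
  have -> : h p = fun P => pair_series p.1.1 p.1.2 p.2 P +
      (-1) * smap_lin (diag_mx (mu p.1.1 p.1.2)) p.2 P.
    by apply/funext => P; rewrite mulN1r.
  by apply: sboundD; [exact: sbound_pair|exact/sboundZ/sbound_lin].
have [K [A [K0 A0 KA]]] := sbound_uniform hB.
move: s; apply: (small_divisor_bound (@out_down _ gs) lam0 lamS large sep K0 A0 sorder_outer).
  by move=> s Q Qin; rewrite /outer_part (negPf Qin).
move=> s Q Qout Q2; have [i [j E]] := outer_divisor s Qout Q2.
exists (h (i, j, s)); split; [|exact: KA|by rewrite E].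
by rewrite /h /= -jac_pair; apply: sorder2_nonlinear; exact: fixes0_pair.
Qed.

End NormalizedLinearization.

(** * The involutions in the linearizing coordinates *)

Section Involutions.
Variables phi psi : smap R n.
Hypothesis phi2 : forall s, sorder 2 (phi s).
Hypothesis psi2 : forall s, sorder 2 (psi s).
Hypothesis phi_bound : forall s, sbound (phi s).
Hypothesis psi_bound : forall s, sbound (psi s).
Local Notation Phi := (near_id phi).
Local Notation Psi := (near_id psi).
Hypothesis PhiPsi : smap_comp Phi Psi = @smap_id R n.
Hypothesis PsiPhi : smap_comp Psi Phi = @smap_id R n.
Hypothesis Phi_eq : forall i j s Q, out gs Q ->
  smap_comp (pair_series i j) Phi s Q = eigpow (mu i j) Q * Phi s Q.

Let Phi0 : fixes0 Phi. Proof. exact: fixes0_near_id. Qed.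
Let Psi0 : fixes0 Psi. Proof. exact: fixes0_near_id. Qed.

Definition conj_pair i j := smap_comp Psi (smap_comp (pair_series i j) Phi).
(** The value of this series at the conjugate of [z] is [rho i] at [z] in the new coordinates. *)
Definition conj_rho i := smap_comp Psi (smap_comp (rb i) (smap_conj Phi)).

Lemma fixes0_conj_pair i j : fixes0 (conj_pair i j).
Proof. by do 2 apply: fixes0_comp => //; exact: fixes0_pair. Qed.

Lemma fixes0_conj_rho i : fixes0 (conj_rho i).
Proof. by do 2 apply: fixes0_comp => //; exact: fixes0_conj. Qed.

Lemma jac_conj_pair i j : jac (conj_pair i j) = diag_mx (mu i j).
Proof.
have F0 := fixes0_pair i j.
rewrite jac_comp//; last exact: fixes0_comp.
by rewrite jac_comp// !jac_near_id// jac_pair mul1mx mulmx1.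
Qed.

Lemma jac_conj_rho i : jac (conj_rho i) = B i.
Proof.
have C0 := fixes0_conj Phi0.
rewrite jac_comp//; last exact: fixes0_comp.
rewrite jac_comp// jac_conj !jac_near_id// rb_jac /mxconj map_mx1.
by rewrite mul1mx mulmx1.
Qed.

Lemma conj_pair_out i j s Q : out gs Q ->
  conj_pair i j s Q = smap_lin (diag_mx (mu i j)) s Q.
Proof.
move=> Qout; have F0 := fixes0_pair i j; have L0 := @fixes0_lin R n (diag_mx (mu i j)).
rewrite -[smap_lin _]smap_id_comp// -PsiPhi smap_compA//.
apply: (@scomp_agree _ _ (out gs)) => //; [exact: out_down|exact: fixes0_comp|exact: fixes0_comp|].
by move=> t T Tout _; rewrite Phi_eq// -scomp_diag.
Qed.

Lemma conj_rho_intertwines i j :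
  smap_comp (conj_rho i) (smap_conj (conj_pair j i)) = smap_comp (conj_pair i j) (conj_rho i).
Proof.
have C0 := fixes0_conj Phi0; have D0 := fixes0_conj Psi0.
have r0 k := fixes0_conj (rb0 k).
have E : smap_comp (smap_conj Phi) (smap_conj Psi) = @smap_id R n.
  by rewrite -smap_conj_comp PhiPsi smap_conj_id.
rewrite /conj_rho /conj_pair /pair_series !smap_conj_comp smap_conjK.
exact: intertwine_formal.
Qed.

Lemma sbound_conj_pair i j s : sbound (conj_pair i j s).
Proof.
have F0 := fixes0_pair i j.
apply: sbound_comp => [|t|t]; [exact: fixes0_comp|exact: sbound_near_id|].
apply: sbound_comp => // [u|u]; [exact: sbound_pair|exact: sbound_near_id].
Qed.

Lemma conj_rho_out i s Q :
  (forall f, in_ideal gs f -> in_conj_ideal gs (fun z => f (antilin (B i) z))) ->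
  out gs Q -> conj_rho i s Q = smap_lin (B i) s Q.
Proof.
move=> HB; suff H d : forall s Q, out gs Q -> (mlen Q < d)%N ->
    conj_rho i s Q = smap_lin (B i) s Q by move=> Qout; exact: (H (mlen Q).+1).
have h0 := fixes0_conj_rho i.
elim: d => [//|d IH] {}s {}Q Qout; rewrite ltnS => Qd.
have [Q2|Q2] := ltnP (mlen Q) 2; first by rewrite (first_jet _ h0 Q2) jac_conj_rho.
rewrite smap_lin_eq0; last by apply: contraTneq Q2 => ->.
apply/eqP/negPn/negP => hQ.
have [j /eqP] := nonres ((outsideP R gs Q).2 Qout) Q2 i s; apply.
have g0 := fixes0_conj_pair i j.
have := congr1 (fun F : smap R n => F s Q) (conj_rho_intertwines i j).
have -> : smap_comp (conj_rho i) (smap_conj (conj_pair j i)) s Q =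
    (eigpow (mu j i) Q)^* * conj_rho i s Q.
  have -> : (eigpow (mu j i) Q)^* = eigpow (mxconj (mu j i)) Q.
    by rewrite rmorph_prod; apply: eq_bigr => t _; rewrite mxE rmorphXn.
  rewrite -scomp_diag; apply: (@scomp_agree _ _ (out gs)) => //.
  - exact: out_down.
  - exact/fixes0_conj/fixes0_conj_pair.
  - exact: fixes0_lin.
  move=> t T Tout _; rewrite /smap_conj /sconj conj_pair_out//.
  have -> : diag_mx (mxconj (mu j i)) = mxconj (diag_mx (mu j i)).
    by apply/matrixP => a b; rewrite !mxE rmorphMn.
  by rewrite -smap_conj_lin.
rewrite /smap_comp scomp_split// jac_conj_pair diag_sum.
set g := (fun P => _); have g2 : sorder 2 g.
  by rewrite /g -jac_conj_pair; exact: sorder2_nonlinear.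
have gB : sbound g.
  have -> : g = fun P => conj_pair i j s P + (-1) * smap_lin (diag_mx (mu i j)) s P.
    by apply/funext => P; rewrite mulN1r.
  by apply: sboundD; [exact: sbound_conj_pair|exact/sboundZ/sbound_lin].
have gout : vanish_out gs g by move=> P Pout; rewrite /g conj_pair_out// subrr.
(* Having order 2, [g] reads the series only below degree [mlen Q], where it is [B i] by induction;
   as [g] vanishes outside the ideal, which [B i] leaves invariant, nothing remains at [Q]. *)
have -> : scomp g (conj_rho i) Q = 0.
  rewrite (@scomp_agree_order2 _ _ (out gs) (@out_down _ gs) d g _ (smap_lin (B i)))//.
  - exact: (vanish_comp_lin HB gB gout).
  - exact: fixes0_lin.
rewrite addr0 => /(mulIf hQ) e.
have E : eigpow (mu i j) Q * eigpow (mu j i) Q = 1.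
  rewrite -big_split big1// => t _ /=.
  by rewrite -exprMn (mu_inv B_conj D_diag) expr1n.
have E0 : eigpow (mu j i) Q != 0.
  by apply/eqP => e0; move: E; rewrite e0 mulr0 => /eqP; rewrite eq_sym oner_eq0.
have E0' : (eigpow (mu j i) Q)^* != 0 by rewrite conjC_eq0.
by rewrite -e; apply: (mulIf E0'); rewrite mulVf// -rmorphM E rmorph1.
Qed.

End Involutions.
End Linearization.

Unset Implicit Arguments.
Set Strict Implicit.
Set Printing Implicit Defensive.

Theorem theorem3p2 (R : realType) (m n : nat)
    (M : 'I_m -> set 'cV[Cplx R]_n)
    (B : 'I_m -> 'M[Cplx R]_n)
    (Rem : 'I_m -> 'cV[Cplx R]_n -> 'cV[Cplx R]_n)
    (mu : 'I_m -> 'I_m -> 'rV[Cplx R]_n)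
    (gs : seq (midx n)) :
  let rho i z := antilin (B i) z + Rem i (mxconj z) in
  let F i j := rho i \o rho j in
  let D i j := B i *m mxconj (B j) in
  let tangent i := [set z | z = antilin (B i) z] in
  (forall i, exists c, [/\ has_taylor_map (Rem i) c, fixes0 c & jac c = 0]) ->
  (forall i, B i \in unitmx /\ B i *m mxconj (B i) = 1%:M) ->
  (forall i, \forall z \near (0 : 'cV[Cplx R]_n), rho i (rho i z) = z) ->
  (forall i, M i 0 /\ totally_real_submanifold (M i) (tangent i)) ->
  (forall i j, i != j -> tangent i <> tangent j) ->
  (forall i, \forall z \near (0 : 'cV[Cplx R]_n), M i z <-> rho i z = z) ->
  (forall i j, D i j = diag_mx (mu i j)) ->
  abelian_germs (gen_group F) ->
  (forall i j f, in_ideal gs f -> in_ideal gs (fun z => f (D i j *m z))) ->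
  (forall i f, in_ideal gs f -> in_conj_ideal gs (fun z => f (antilin (B i) z))) ->
  (diophantine mu setT \/
   properly_embedded R gs /\ diophantine mu (outside_ideal R gs)) ->
  nonresonant_on mu gs ->
  formally_linearizable_on F D gs ->
  exists Phi Psi : 'cV[Cplx R]_n -> 'cV[Cplx R]_n,
    [/\ holo_diffeo Phi Psi, tangent_id Phi,
        forall i j s,
          in_ideal gs (fun z => (Psi (F i j (Phi z)) - D i j *m z) s 0) &
        forall i s,
          in_conj_ideal gs
            (fun z => (Psi (rho i (Phi z)) - antilin (B i) z) s 0)].
Proof.
move=> rho F D tangent HRem HB _ _ _ _ HD _ _ HBinv Hdio Hnonres Hlin.
have B_unit i := (HB i).1; have B_conj i := (HB i).2.
have idT := @has_taylor_map_id R n; have id0 := @fixes0_id R n.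
(* An index [i0] is needed to compare divisors with actual moduli; for [m = 0] the identity
   answers. *)
have [[i0 _]|none] := pselect (exists i : 'I_m, True); last first.
  exists id, id; split.
  - by apply: (holo_diffeo_taylor idT idT) => //; exact: smap_id_comp.
  - by exists (@smap_id R n); split=> //; split=> //; exact: jac_lin.
  - by move=> i; case: none; exists i.
  - by move=> i; case: none; exists i.
have /choice[c cP] := HRem.
pose rb i : smap R n := fun s Q => smap_lin (B i) s Q + c i s Q.
pose rhoh i z := B i *m z + Rem i z.
have rhohT i : has_taylor_map (rhoh i) (rb i).
  by have [cT _ _] := cP i; apply: has_taylor_mapD cT; exact: has_taylor_map_lin.
have rb0 i : fixes0 (rb i).
  by move=> s; have [_ c0 _] := cP i; rewrite /rb c0 fixes0_lin addr0.
have rb_jac i : jac (rb i) = B i.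
  have [_ _ /matrixP cJ] := cP i; apply/matrixP => s t.
  by have := cJ s t; rewrite !mxE /rb smap_lin_unit => ->; rewrite addr0.
have rb_bound i s : sbound (rb i s) := taylor_sbound (rhohT i s).
have FT i j : has_taylor_map (F i j) (pair_series rb i j).
  have := has_taylor_map_comp (rhohT i) (has_taylor_map_conj (rhohT j)) (fixes0_conj (rb0 j)).
  exact.
have [Phih [Psih [Phih_id [Psih0 PhihPsih PsihPhih] _ Hconj]]] := Hlin.
have conj_out i j s : vanish_out gs (fun Q =>
    smap_comp Psih (smap_comp (pair_series rb i j) Phih) s Q -
    smap_lin (diag_mx (mu i j)) s Q).
  (* The series given by formal linearizability is the Taylor series of [F i j], hence
     [pair_series]. *)
  have [f [fT fI]] := Hconj i j; rewrite -HD -(taylor_map_unique fT (FT i j)).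
  exact: formal_ideal_vanish (fI s).
pose phi := outer_part gs Phih.
have phi2 : forall s, sorder 2 (phi s) := sorder_outer gs Phih.
have phiB : forall s, sbound (phi s).
  exact: (outer_sbound B_unit B_conj HD Hnonres i0 rb0 rb_jac rb_bound Phih_id Psih0 PhihPsih conj_out Hdio).
have [psi [psi2 PhiPsi PsiPhi /(_ phiB) psiB]] := formal_inverse phi2.
have Phi_eq := outer_equation rb0 Phih_id Psih0 PhihPsih conj_out.
have Phi0 := fixes0_near_id phi2; have Psi0 := fixes0_near_id psi2.
have [PF PFT] := germ_map_exists (fun s => sbound_near_id (phiB s)).
have [PsF PsFT] := germ_map_exists (fun s => sbound_near_id (psiB s)).
have F0 i j := fixes0_pair rb0 i j.
exists PF, PsF; split.
- exact: holo_diffeo_taylor PFT PsFT Phi0 Psi0 PhiPsi PsiPhi.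
- exists (near_id phi); split=> //; split=> //; exact: jac_near_id.
- move=> i j s.
  have GT := has_taylor_mapB (has_taylor_map_comp PsFT (has_taylor_map_comp (FT i j) PFT Phi0)
    (fixes0_comp (F0 i j) Phi0)) (has_taylor_map_lin (D i j)).
  apply: (vanish_ideal (GT s)) => Q Qout.
  by rewrite HD -(conj_pair_out rb0 phi2 PsiPhi Phi_eq)// subrr.
move=> i s.
have CT := has_taylor_map_conj PFT; have C0 := fixes0_conj Phi0.
have GT := has_taylor_mapB (has_taylor_map_comp PsFT (has_taylor_map_comp (rhohT i) CT C0)
  (fixes0_comp (rb0 i) C0)) (has_taylor_map_lin (B i)).
(* In the variable [w], the conjugate of [z], the map is holomorphic and membership is read off from
   Taylor coefficients; conjugating the variable back gives the conjugate ideal. *)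
have GI : in_ideal gs (fun w => (PsF (rhoh i (mxconj (PF (mxconj w)))) - B i *m w) s 0).
  apply: (vanish_ideal (GT s)) => Q Qout.
  rewrite -(conj_rho_out B_conj HD Hnonres rb0 rb_jac rb_bound phi2 psi2 phiB psiB PhiPsi PsiPhi Phi_eq s (HBinv i) Qout).
  by rewrite subrr.
have := in_ideal_conj GI.
rewrite (_ : (fun z => _) = fun z => (PsF (rho i (PF z)) - antilin (B i) z) s 0)//.
by apply/funext => z; rewrite mxconjK.
Qed.
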